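(* Suppose $f_u(E_k)=\mathbb{C}$ for all $u=1,\ldots,m$. Let $\Omega\subset E_k$ be an arbitrary domain and $\Phi:\Omega\to\mathbb{A}_n^m$ a monogenic function. Then for every $r\in\mathbb{N}$ the Gateaux derivative $\Phi^{(r)}$ of order $r$ exists and is a monogenic function in $\Omega$.
   Context: Fix integers $1\le m\le n$. $\mathbb{A}_n^m$ is an $n$-dimensional commutative associative algebra with unit over $\mathbb{C}$ having a basis $\{I_r\}_{r=1}^n$ with the multiplication rules: (1) for $r,s\in\{1,\ldots,m\}$: $I_rI_s=0$ if $r\ne s$ and $I_rI_r=I_r$; (2) for $r,s\in\{m+1,\ldots,n\}$: $I_rI_s=\sum_{p=\max\{r,s\}+1}^n\Upsilon^s_{r,p}I_p$ with $\Upsilon^s_{r,p}\in\mathbb{C}$; (3) for each $s\in\{m+1,\ldots,n\}$ there is a unique $u_s\in\{1,\ldots,m\}$ such that for all $r\in\{1,\ldots,m\}$: $I_rI_s=I_s$ if $r=u_s$ and $I_rI_s=0$ otherwise. For $u=1,\ldots,m$, $f_u:\mathbb{A}_n^m\to\mathbb{C}$ is the linear functional $f_u(\sum_r\lambda_rI_r)=\lambda_u$. Let $2\le k\le 2n$ and let $e_1=1=\sum_{r=1}^mI_r$, $e_j=\sum_{r=1}^n a_{jr}I_r$ ($j=2,\ldots,k$) be linearly independent over $\mathbb{R}$; $E_k$ is their real linear span. A continuous function $\Phi:\Omega\to\mathbb{A}_n^m$ is monogenic in $\Omega$ if for every $\zeta\in\Omega$ there is $\Phi'(\zeta)\in\mathbb{A}_n^m$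 (the Gateaux derivative) with $\lim_{\varepsilon\to0^+}(\Phi(\zeta+\varepsilon h)-\Phi(\zeta))\varepsilon^{-1}=h\Phi'(\zeta)$ for all $h\in E_k$. Higher Gateaux derivatives are defined by $\Phi^{(r)}:=(\Phi^{(r-1)})'$. *)

(* Defs.v *)
From Stdlib Require Import Reals Lra.
Open Scope R_scope.

Definition Cplx : Type := (R * R)%type.
Definition Cre (z : Cplx) : R := fst z.
Definition Cim (z : Cplx) : R := snd z.
Definition C0 : Cplx := (0, 0).
Definition C1 : Cplx := (1, 0).
Definition Cadd (z w : Cplx) : Cplx := (Cre z + Cre w, Cim z + Cim w).
Definition Copp (z : Cplx) : Cplx := (- Cre z, - Cim z).
Definition Cmul (z w : Cplx) : Cplx :=
  (Cre z * Cre w - Cim z * Cim w, Cre z * Cim w + Cim z * Cre w).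
Definition RCmul (x : R) (z : Cplx) : Cplx := (x * Cre z, x * Cim z).
Definition Cmod (z : Cplx) : R := sqrt (Cre z * Cre z + Cim z * Cim z).

(** [Csum n f] = f 1 + ... + f n  (indices start at 1, as in the paper). *)
Fixpoint Csum (n : nat) (f : nat -> Cplx) : Cplx :=
  match n with
  | O => C0
  | S n' => Cadd (Csum n' f) (f n)
  end.

Fixpoint Rsum1 (n : nat) (f : nat -> R) : R :=
  match n with
  | O => 0
  | S n' => Rsum1 n' f + f n
  end.

(** * The algebra A_n^m
    An element  sum_{r=1}^n lambda_r I_r  is represented by its coordinate
    function  r |-> lambda_r ; only the coordinates r = 1..n are meaningful. *)
Definition Alg : Type := nat -> Cplx.

Definition Aeq (n : nat) (a b : Alg) : Prop :=
  forall r, (1 <= r <= n)%nat -> a r = b r.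

Definition Aadd (a b : Alg) : Alg := fun r => Cadd (a r) (b r).
Definition Asub (a b : Alg) : Alg := fun r => Cadd (a r) (Copp (b r)).
Definition Ascal (x : R) (a : Alg) : Alg := fun r => RCmul x (a r).
Definition Azero : Alg := fun _ => C0.
Definition Abasis (r : nat) : Alg := fun p => if Nat.eqb p r then C1 else C0.

(** Coefficient of I_p in the product I_r I_s, following rules (1)-(3)
    of the definition of A_n^m (rule (3) together with commutativity for
    the case r > m >= s).  [Ups s r p] is Upsilon^s_{r,p}, [u s] is u_s. *)
Definition struct_const (m n : nat) (Ups : nat -> nat -> nat -> Cplx)
  (u : nat -> nat) (r s p : nat) : Cplx :=
  if Nat.leb r m then
    if Nat.leb s m then
      (if andb (Nat.eqb r s) (Nat.eqb p r) then C1 else C0)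
    else
      (if andb (Nat.eqb r (u s)) (Nat.eqb p s) then C1 else C0)
  else
    if Nat.leb s m then
      (if andb (Nat.eqb s (u r)) (Nat.eqb p r) then C1 else C0)
    else
      (if Nat.ltb (Nat.max r s) p then Ups s r p else C0).

Definition Amul (m n : nat) (Ups : nat -> nat -> nat -> Cplx) (u : nat -> nat)
  (a b : Alg) : Alg :=
  fun p => Csum n (fun r => Csum n (fun s =>
             Cmul (Cmul (a r) (b s)) (struct_const m n Ups u r s p))).

Definition is_algebra_Anm (m n : nat) (Ups : nat -> nat -> nat -> Cplx)
  (u : nat -> nat) : Prop :=
  (1 <= m <= n)%nat /\
  (forall s, (m + 1 <= s <= n)%nat -> (1 <= u s <= m)%nat) /\
  (forall a b, Aeq n (Amul m n Ups u a b) (Amul m n Ups u b a)) /\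
  (forall a b c, Aeq n (Amul m n Ups u (Amul m n Ups u a b) c)
                       (Amul m n Ups u a (Amul m n Ups u b c))).

Definition Aunit (m : nat) : Alg := fun r => if Nat.leb r m then C1 else C0.

Definition f_coord (u : nat) (a : Alg) : Cplx := a u.

Definition Anorm (n : nat) (a : Alg) : R := Rsum1 n (fun r => Cmod (a r)).

Definition evec (m : nat) (acoef : nat -> nat -> Cplx) (j : nat) : Alg :=
  if Nat.eqb j 1 then Aunit m else fun r => acoef j r.

Definition Ecomb (m k : nat) (acoef : nat -> nat -> Cplx) (x : nat -> R) : Alg :=
  fun r => Csum k (fun j => RCmul (x j) (evec m acoef j r)).

Definition lin_indep_R (m n k : nat) (acoef : nat -> nat -> Cplx) : Prop :=
  forall x : nat -> R, Aeq n (Ecomb m k acoef x) Azero ->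
    forall j, (1 <= j <= k)%nat -> x j = 0.

Definition in_Ek (m n k : nat) (acoef : nat -> nat -> Cplx) (h : Alg) : Prop :=
  exists x : nat -> R, Aeq n h (Ecomb m k acoef x).

Definition open_in_Ek (m n k : nat) (acoef : nat -> nat -> Cplx)
  (U : Alg -> Prop) : Prop :=
  (forall z, U z -> in_Ek m n k acoef z) /\
  (forall z, U z -> exists delta, delta > 0 /\
     forall h, in_Ek m n k acoef h -> Anorm n h < delta -> U (Aadd z h)).

Definition domain_in_Ek (m n k : nat) (acoef : nat -> nat -> Cplx)
  (Om : Alg -> Prop) : Prop :=
  open_in_Ek m n k acoef Om /\
  (exists z, Om z) /\
  (forall U V : Alg -> Prop,
      open_in_Ek m n k acoef U -> open_in_Ek m n k acoef V ->
      (forall z, Om z -> U z \/ V z) ->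
      (forall z, Om z -> U z -> V z -> False) ->
      (exists z, Om z /\ U z) -> (exists z, Om z /\ V z) -> False).

Definition continuous_on (n : nat) (Om : Alg -> Prop) (Phi : Alg -> Alg) : Prop :=
  forall z, Om z -> forall eps, eps > 0 -> exists delta, delta > 0 /\
    forall w, Om w -> Anorm n (Asub w z) < delta ->
      Anorm n (Asub (Phi w) (Phi z)) < eps.

Definition is_gateaux_deriv (m n k : nat) (Ups : nat -> nat -> nat -> Cplx)
  (u : nat -> nat) (acoef : nat -> nat -> Cplx) (Om : Alg -> Prop)
  (Phi Phi' : Alg -> Alg) : Prop :=
  forall z, Om z -> forall h, in_Ek m n k acoef h ->
    forall eta, eta > 0 -> exists delta, delta > 0 /\
      forall eps, 0 < eps < delta ->
        Om (Aadd z (Ascal eps h)) /\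
        Anorm n (Asub (Ascal (/ eps) (Asub (Phi (Aadd z (Ascal eps h))) (Phi z)))
                      (Amul m n Ups u h (Phi' z))) < eta.

Definition monogenic (m n k : nat) (Ups : nat -> nat -> nat -> Cplx)
  (u : nat -> nat) (acoef : nat -> nat -> Cplx) (Om : Alg -> Prop)
  (Phi : Alg -> Alg) : Prop :=
  continuous_on n Om Phi /\
  exists Phi', is_gateaux_deriv m n k Ups u acoef Om Phi Phi'.

(* Main.v *)
Require Import Defs.
From Stdlib Require Import Reals.
From Stdlib Require Import Lra Lia FunctionalExtensionality Classical
  ClassicalEpsilon Morphisms.
From Coquelicot Require Import Hierarchy Continuity Derive RInt Compactness Rcomplements.
From Coquelicot Require Complex.
(* [C1] is also the name of a notion of [Reals]. *)
Import Defs.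
Open Scope R_scope.

(* The hypothesis [f_u(E_k) = C] yields [e] in [E_k] such that [f_u(x + y e) <> 0] for all [u] and
   all real [(x, y) <> 0], so that [w = x + y e] is invertible. On a plane [zeta + span(1, e)] a
   monogenic function is a continuous [g(x, y)] with [g_x = Phi'] and [g_y = e g_x].

   Goursat: the integral [J] of [g (dx + e dy)] along the boundary of a rectangle vanishes. Only
   directional derivatives are available, so this is shown by a Baire category argument. Fix
   [eta > 0] and let [P] be the set of points without a neighbourhood in which [|J(R)| <= eta |R|]
   for all rectangles [R]. If [P] is not empty, Baire's theorem gives a portion of [P] on which the
   difference quotients are uniformly close to a constant. For a small rectangle [Q] with bounding
   rectangle [Q'] of the part of [P] in [Q], this makes [|J(Q')|] small compared with [|Q|], while
   [|J(Q)| <= eta (|Q| - |Q'|) + |J(Q')|]; if [Q'] is thin, it is cut into pieces of bounded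
   eccentricity and the estimate is iterated. No measure theory is needed.

   Applied to [g(w) (w - s)^-1] off its pole, Goursat's theorem gives a Cauchy formula and then
   [Phi'(zeta) = p^-1 J(Phi(zeta + w) w^-2)], where [p = J(w^-1)] is invertible because the
   imaginary part of [f_u(p)] has the sign of that of [f_u(e)]. The formula is uniform in [zeta],
   hence [Phi'] is continuous, and by the mean value theorem it may be differentiated in every
   direction of [E_k]. So [Phi'] is monogenic, and the theorem follows by induction. *)

(** * Additive functions of rectangles *)

(** In place of an integration over the exceptional set the accounting is by area alone: either [Q']
    fills a fixed fraction of [Q], and the saving [eta |Q'|] pays for the estimate on [P], or [Q']
    is so small that a cruder bound on it costs little. One plane suffices although [E_k] may have
    larger dimension: the integral formula expresses [Phi'(zeta)] by values of [Phi], and moving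
    [zeta] in any direction of [E_k] merely changes the function that is integrated. The period [p]
    is never evaluated. An element is a unit as soon as no [f_u] vanishes on it, so the sign of an
    imaginary part is enough, and no logarithm or argument enters. *)

Definition closed2 (S : R -> R -> Prop) : Prop :=
  forall x y, ~ S x y -> exists delta, delta > 0 /\
    forall x' y', Rabs (x' - x) <= delta -> Rabs (y' - y) <= delta -> ~ S x' y'.

Lemma INR_lt_pow2 (k : nat) : INR k < 2 ^ k.
Proof.
  induction k as [|k IH].
  - simpl; lra.
  - rewrite S_INR; simpl.
    assert (1 <= 2 ^ k) by (apply pow_R1_Rle; lra).
    lra.
Qed.

(** Cousin's principle: bisection down to a Lebesgue number of the gauge formed by the local radii.
    Every compactness argument on rectangles below is an instance for a suitable [G]. *)
Lemma rectangle_induction (G : R -> R -> R -> R -> Prop) (A B C D : R) :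
  A <= B -> C <= D ->
  (forall a x b c d, A <= a <= x -> x <= b <= B -> C <= c <= d -> d <= D ->
     G a x c d -> G x b c d -> G a b c d) ->
  (forall a b c y d, A <= a <= b -> b <= B -> C <= c <= y -> y <= d <= D ->
     G a b c y -> G a b y d -> G a b c d) ->
  (forall x y, A <= x <= B -> C <= y <= D -> exists delta, delta > 0 /\
     forall a b c d, A <= a <= b -> b <= B -> C <= c <= d -> d <= D ->
       x - delta <= a -> b <= x + delta -> y - delta <= c -> d <= y + delta ->
       G a b c d) ->
  G A B C D.
Proof.
  intros HAB HCD Hx Hy Hloc.
  (* The factor 2 gives room: a rectangle whose lower corner is within [delta] of the point and
     whose sides are at most [eps <= delta] stays within [2 * delta]. *)
  assert (Hch : forall x y, exists delta : posreal,
    A <= x <= B -> C <= y <= D ->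
     forall a b c d, A <= a <= b -> b <= B -> C <= c <= d -> d <= D ->
       x - 2 * delta <= a -> b <= x + 2 * delta ->
       y - 2 * delta <= c -> d <= y + 2 * delta -> G a b c d).
  { intros x y.
    destruct (classic (A <= x <= B /\ C <= y <= D)) as [[H1 H2]|H].
    - destruct (Hloc x y H1 H2) as (e & He & H).
      assert (He2 : 0 < e / 2) by lra.
      exists (mkposreal _ He2); intros _ _ a b c d; simpl; intros.
      apply H; lra.
    - exists (mkposreal 1 Rlt_0_1); intros; exfalso; tauto. }
  pose (delta x y := proj1_sig (constructive_indefinite_description _ (Hch x y))).
  assert (Hdelta := fun x y => proj2_sig (constructive_indefinite_description _ (Hch x y))).
  fold delta in Hdelta; cbv beta in Hdelta.
  destruct (compactness_value_2d A B C D delta) as [eps Heps].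
  assert (Hk : forall k a b c d, A <= a <= b -> b <= B -> C <= c <= d -> d <= D ->
     b - a <= eps * 2 ^ k -> d - c <= eps * 2 ^ k -> G a b c d).
  { induction k as [|k IH]; intros a b c d Ha Hb Hc Hd Hw Hh.
    (* [Heps] provides its gauge point under a double negation only, hence the argument by
       contradiction. *)
    - simpl in Hw, Hh. apply NNPP; intro HN.
      apply (Heps a c); [lra|lra|].
      intros (u & v & Hu & Hv & Hau & Hcv & Hle).
      apply HN, (Hdelta u v Hu Hv); try lra;
        unfold delta in *; apply Rabs_lt_between in Hau; apply Rabs_lt_between in Hcv; lra.
    - simpl in Hw, Hh.
      apply (Hx a ((a + b) / 2) b); try lra;
      apply (Hy _ _ c ((c + d) / 2) d); try lra; apply IH; lra. }
  destruct (archimed_cor1 (eps / (1 + (B - A) + (D - C)))) as (N & HN & HN0).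
  { apply Rdiv_lt_0_compat; [apply cond_pos|lra]. }
  assert (HNp : 0 < INR N) by (apply lt_0_INR; lia).
  assert (H1 : 1 + (B - A) + (D - C) <= eps * INR N).
  { apply Rlt_le. apply (Rmult_lt_compat_r (INR N * (1 + (B - A) + (D - C)))) in HN; [|nra].
    field_simplify in HN; lra. }
  assert (H2 := INR_lt_pow2 N).
  assert (He := cond_pos eps).
  apply (Hk N); try lra; nra.
Qed.

(** If no minimum is attained, each point of [S] is beaten by another one, which by continuity also
    beats a whole neighbourhood. Keeping the better of two competitors when gluing rectangles, one
    arrives at a point of [S] that beats all of [S], itself included. *)
Lemma linear_min_attained (S : R -> R -> Prop) (A B C D al be : R) :
  closed2 S -> (forall x y, S x y -> A <= x <= B /\ C <= y <= D) ->
  (exists x y, S x y) ->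
  exists x y, S x y /\ forall x' y', S x' y' -> al * x + be * y <= al * x' + be * y'.
Proof.
  intros Hcl Hbox (x0 & y0 & H0).
  apply NNPP; intro HN.
  assert (Hbetter : forall x y, S x y -> exists x' y', S x' y' /\
            al * x' + be * y' < al * x + be * y).
  { intros x y Hxy. apply NNPP; intro H. apply HN. exists x, y; split; [exact Hxy|].
    intros x' y' H'. apply Rnot_lt_le; intro Hlt. apply H; exists x', y'; tauto. }
  assert (HG : exists p q, S p q /\ forall x y, A <= x <= B -> C <= y <= D -> S x y ->
                al * p + be * q < al * x + be * y).
  { apply (rectangle_induction (fun a b c d => exists p q, S p q /\
        forall x y, a <= x <= b -> c <= y <= d -> S x y ->
                al * p + be * q < al * x + be * y) A B C D).
    - destruct (Hbox _ _ H0); lra.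
    - destruct (Hbox _ _ H0); lra.
    - intros a x b c d _ _ _ _ (p1 & q1 & S1 & H1) (p2 & q2 & S2 & H2).
      destruct (Rle_dec (al * p1 + be * q1) (al * p2 + be * q2)).
      + exists p1, q1; split; [exact S1|]. intros s t Hs Ht Hst.
        destruct (Rle_dec s x); [apply H1; lra || assumption|].
        eapply Rle_lt_trans; [eassumption|]. apply H2; lra || assumption.
      + exists p2, q2; split; [exact S2|]. intros s t Hs Ht Hst.
        destruct (Rle_dec s x).
        * eapply Rlt_trans; [apply Rnot_le_lt; eassumption|]. apply H1; lra || assumption.
        * apply H2; lra || assumption.
    - intros a b c y d _ _ _ _ (p1 & q1 & S1 & H1) (p2 & q2 & S2 & H2).
      destruct (Rle_dec (al * p1 + be * q1) (al * p2 + be * q2)).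
      + exists p1, q1; split; [exact S1|]. intros s t Hs Ht Hst.
        destruct (Rle_dec t y); [apply H1; lra || assumption|].
        eapply Rle_lt_trans; [eassumption|]. apply H2; lra || assumption.
      + exists p2, q2; split; [exact S2|]. intros s t Hs Ht Hst.
        destruct (Rle_dec t y).
        * eapply Rlt_trans; [apply Rnot_le_lt; eassumption|]. apply H1; lra || assumption.
        * apply H2; lra || assumption.
    - intros x y _ _.
      destruct (classic (S x y)) as [Hs|Hs].
      + destruct (Hbetter x y Hs) as (p & q & Hpq & Hlt).
        pose (gap := al * x + be * y - (al * p + be * q)).
        assert (Hgap : gap > 0) by (unfold gap; lra).
        (* A move by [gap / M] in both coordinates changes the functional by at most [gap / 2]. *)
        pose (M := 2 * (Rabs al + Rabs be + 1)).
        assert (HM : M > 0) by (unfold M; pose proof (Rabs_pos al); pose proof (Rabs_pos be); lra).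
        exists (gap / M); split; [apply Rdiv_lt_0_compat; lra|].
        intros a b c d _ _ _ _ Ha Hb Hc Hd. exists p, q; split; [exact Hpq|].
        intros s t Hs' Ht _.
        assert (E1 : Rabs (al * (s - x)) <= Rabs al * (gap / M)).
        { rewrite Rabs_mult. apply Rmult_le_compat_l; [apply Rabs_pos|].
          apply Rabs_le; lra. }
        assert (E2 : Rabs (be * (t - y)) <= Rabs be * (gap / M)).
        { rewrite Rabs_mult. apply Rmult_le_compat_l; [apply Rabs_pos|].
          apply Rabs_le; lra. }
        assert (E3 : (Rabs al + Rabs be + 1) * (gap / M) = gap / 2).
        { unfold M; field. unfold M in HM; lra. }
        assert (E4 : 0 < gap / M) by (apply Rdiv_lt_0_compat; lra).
        apply Rabs_le_between in E1; apply Rabs_le_between in E2.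
        unfold gap in *; lra.
      + destruct (Hcl x y Hs) as (e & He & H). exists e; split; [exact He|].
        intros a b c d _ _ _ _ Ha Hb Hc Hd. exists x0, y0; split; [exact H0|].
        intros s t Hs' Ht Hst. exfalso. apply (H s t); try assumption; apply Rabs_le; lra. }
  destruct HG as (p & q & Hpq & H).
  destruct (Hbox _ _ Hpq). specialize (H p q). specialize (H ltac:(assumption) ltac:(assumption) Hpq). lra.
Qed.

(** The sides pass through minimisers of the functionals [x], [-x], [y], [-y]. That each side meets
    [S] is the condition under which [Jportion] gives a bound. *)
Lemma bounding_rectangle (S : R -> R -> Prop) (A B C D : R) :
  closed2 S -> (forall x y, S x y -> A <= x <= B /\ C <= y <= D) ->
  (exists x y, S x y) ->
  exists a b c d, (A <= a <= b /\ b <= B /\ C <= c <= d /\ d <= D) /\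
    (forall x y, S x y -> a <= x <= b /\ c <= y <= d) /\
    (exists y, S a y) /\ (exists y, S b y) /\ (exists x, S x c) /\ (exists x, S x d).
Proof.
  intros Hcl Hbox Hne.
  destruct (linear_min_attained S A B C D 1 0 Hcl Hbox Hne) as (a & ya & Sa & Ha).
  destruct (linear_min_attained S A B C D (-1) 0 Hcl Hbox Hne) as (b & yb & Sb & Hb).
  destruct (linear_min_attained S A B C D 0 1 Hcl Hbox Hne) as (xc & c & Sc & Hc).
  destruct (linear_min_attained S A B C D 0 (-1) Hcl Hbox Hne) as (xd & d & Sd & Hd).
  exists a, b, c, d.
  assert (Hin : forall x y, S x y -> a <= x <= b /\ c <= y <= d).
  { intros x y H. specialize (Ha _ _ H); specialize (Hb _ _ H);
    specialize (Hc _ _ H); specialize (Hd _ _ H). lra. }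
  pose proof (Hin _ _ Sa); pose proof (Hin _ _ Sb); pose proof (Hin _ _ Sc).
  pose proof (Hbox _ _ Sa); pose proof (Hbox _ _ Sb); pose proof (Hbox _ _ Sc); pose proof (Hbox _ _ Sd).
  repeat split; try lra; try (apply Hin; assumption); try (eapply Hin; eassumption);
    try (apply (Hin x y); assumption); eauto.
Qed.

Section RectangleFunction.

Variables (J : R -> R -> R -> R -> R) (A B C D : R).

Definition subrect (a b c d : R) : Prop :=
  A <= a /\ a <= b /\ b <= B /\ C <= c /\ c <= d /\ d <= D.

Hypothesis Jx : forall a x b c d, subrect a b c d -> a <= x <= b ->
  J a b c d = J a x c d + J x b c d.
Hypothesis Jy : forall a b c y d, subrect a b c d -> c <= y <= d ->
  J a b c d = J a b c y + J a b y d.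
Hypothesis Jthin : forall eps, eps > 0 -> exists delta, delta > 0 /\
  forall a b c d, subrect a b c d -> b - a < delta \/ d - c < delta ->
    Rabs (J a b c d) < eps.
(** The shape in which the category argument enters. It controls only rectangles all of whose sides
    meet [P], and by the square of the half-perimeter, which compares with the area only under
    bounded eccentricity. *)
Hypothesis Jportion : forall eta (P : R -> R -> Prop), eta > 0 ->
  (forall x y, P x y -> A <= x <= B /\ C <= y <= D) -> closed2 P ->
  (exists x y, P x y) ->
  exists x0 y0 delta, P x0 y0 /\ delta > 0 /\
    forall a b c d, subrect a b c d ->
      x0 - delta <= a -> b <= x0 + delta -> y0 - delta <= c -> d <= y0 + delta ->
      (exists y, c <= y <= d /\ P a y) -> (exists y, c <= y <= d /\ P b y) ->
      (exists x, a <= x <= b /\ P x c) -> (exists x, a <= x <= b /\ P x d) ->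
      Rabs (J a b c d) <= eta * ((b - a) + (d - c)) ^ 2.

Definition locally_small (eta x y : R) : Prop :=
  exists delta, delta > 0 /\ forall a b c d, subrect a b c d ->
    x - delta <= a -> b <= x + delta -> y - delta <= c -> d <= y + delta ->
    Rabs (J a b c d) <= eta * ((b - a) * (d - c)).

Lemma Jx_bound K a x b c d : subrect a b c d -> a <= x <= b ->
  Rabs (J a x c d) <= K * ((x - a) * (d - c)) ->
  Rabs (J x b c d) <= K * ((b - x) * (d - c)) ->
  Rabs (J a b c d) <= K * ((b - a) * (d - c)).
Proof.
  intros H Hx H1 H2. rewrite (Jx a x b c d H Hx).
  eapply Rle_trans; [apply Rabs_triang|]. nra.
Qed.

Lemma Jy_bound K a b c y d : subrect a b c d -> c <= y <= d ->
  Rabs (J a b c y) <= K * ((b - a) * (y - c)) ->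
  Rabs (J a b y d) <= K * ((b - a) * (d - y)) ->
  Rabs (J a b c d) <= K * ((b - a) * (d - c)).
Proof.
  intros H Hx H1 H2. rewrite (Jy a b c y d H Hx).
  eapply Rle_trans; [apply Rabs_triang|]. nra.
Qed.

Lemma locally_small_bound eta a b c d : subrect a b c d ->
  (forall x y, a <= x <= b -> c <= y <= d -> locally_small eta x y) ->
  Rabs (J a b c d) <= eta * ((b - a) * (d - c)).
Proof.
  intros H Hs. unfold subrect in H.
  apply (rectangle_induction (fun a b c d =>
     Rabs (J a b c d) <= eta * ((b - a) * (d - c)))); try lra.
  - intros; eapply Jx_bound; eauto; unfold subrect; lra.
  - intros; eapply Jy_bound; eauto; unfold subrect; lra.
  - intros x y Hx Hy. destruct (Hs x y Hx Hy) as (e & He & Hl).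
    exists e; split; [exact He|]. intros; apply Hl; unfold subrect; lra.
Qed.

(* Only the interior of the rectangle is needed: thin boundary strips contribute little. *)
Lemma locally_small_bound_open eta a b c d : 0 <= eta -> subrect a b c d ->
  (forall x y, a < x < b -> c < y < d -> locally_small eta x y) ->
  Rabs (J a b c d) <= eta * ((b - a) * (d - c)).
Proof.
  intros Heta H Hs. apply Rnot_lt_le; intro Hlt.
  pose (gap := Rabs (J a b c d) - eta * ((b - a) * (d - c))).
  assert (Hgap : gap / 4 > 0) by (unfold gap; lra).
  destruct (Jthin _ Hgap) as (e & He & Hthin).
  assert (Hdeg : ~ (b - a < e \/ d - c < e)).
  { intro Hd. specialize (Hthin a b c d H Hd). unfold subrect in H.
    assert (0 <= (b - a) * (d - c)) by nra. unfold gap in *; nra. }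
  assert (Hb : e <= b - a) by lra. assert (Hd : e <= d - c) by lra.
  unfold subrect in H.
  (* Four boundary strips narrower than [e] together contribute less than [gap], and the remaining
     core lies in the open rectangle. *)
  set (f := e / 3).
  assert (Hf : 0 < f /\ f < e /\ e = 3 * f) by (unfold f; lra).
  assert (E1 := Jx a (a + f) b c d ltac:(unfold subrect; lra) ltac:(lra)).
  assert (E2 := Jx (a + f) (b - f) b c d ltac:(unfold subrect; lra) ltac:(lra)).
  assert (E3 := Jy (a + f) (b - f) c (c + f) d ltac:(unfold subrect; lra) ltac:(lra)).
  assert (E4 := Jy (a + f) (b - f) (c + f) (d - f) d ltac:(unfold subrect; lra) ltac:(lra)).
  assert (T1 := Hthin a (a + f) c d ltac:(unfold subrect; lra) ltac:(lra)).
  assert (T2 := Hthin (b - f) b c d ltac:(unfold subrect; lra) ltac:(lra)).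
  assert (T3 := Hthin (a + f) (b - f) c (c + f) ltac:(unfold subrect; lra) ltac:(lra)).
  assert (T4 := Hthin (a + f) (b - f) (d - f) d ltac:(unfold subrect; lra) ltac:(lra)).
  assert (T5 := locally_small_bound eta (a + f) (b - f) (c + f) (d - f)
    ltac:(unfold subrect; lra) ltac:(intros; apply Hs; lra)).
  assert (T6 : eta * ((b - f - (a + f)) * (d - f - (c + f))) <= eta * ((b - a) * (d - c))).
  { apply Rmult_le_compat_l; [exact Heta|]. apply Rmult_le_compat; lra. }
  apply Rabs_def2 in T1; apply Rabs_def2 in T2; apply Rabs_def2 in T3; apply Rabs_def2 in T4.
  apply Rabs_le_between in T5.
  assert (Rabs (J a b c d) < gap + eta * ((b - a) * (d - c))).
  { apply Rabs_def1; lra. }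
  unfold gap in *; lra.
Qed.

(** The longer side is halved until the sides have ratio at most 2, and additivity of area keeps the
    constant [K]. Halving never reaches that ratio for a rectangle with one side zero; there [Jthin]
    forces [J] to vanish. *)
Lemma bound_of_bounded_eccentricity K X1 X2 Y1 Y2 :
  (forall a b c d, subrect a b c d -> X1 <= a -> b <= X2 -> Y1 <= c -> d <= Y2 ->
     b - a <= 2 * (d - c) -> d - c <= 2 * (b - a) ->
     Rabs (J a b c d) <= K * ((b - a) * (d - c))) ->
  forall a b c d, subrect a b c d -> X1 <= a -> b <= X2 -> Y1 <= c -> d <= Y2 ->
     Rabs (J a b c d) <= K * ((b - a) * (d - c)).
Proof.
  intros Hecc.
  assert (Hk : forall k a b c d, subrect a b c d -> X1 <= a -> b <= X2 -> Y1 <= c -> d <= Y2 ->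
     b - a <= 2 ^ k * (2 * (d - c)) -> d - c <= 2 ^ k * (2 * (b - a)) ->
     Rabs (J a b c d) <= K * ((b - a) * (d - c))).
  { induction k as [|k IH]; intros a b c d H Ha Hb Hc Hd H1 H2; simpl in H1, H2.
    - apply Hecc; auto; lra.
    - destruct (Rle_dec (b - a) (2 * (d - c))) as [L1|L1].
      + destruct (Rle_dec (d - c) (2 * (b - a))) as [L2|L2]; [apply Hecc; auto|].
        unfold subrect in H.
        assert (1 <= 2 ^ k) by (apply pow_R1_Rle; lra).
        apply (Jy_bound K a b c ((c + d) / 2) d); try (unfold subrect; lra);
        apply IH; try (unfold subrect; lra); try nra.
      + unfold subrect in H.
        assert (1 <= 2 ^ k) by (apply pow_R1_Rle; lra).
        apply (Jx_bound K a ((a + b) / 2) b c d); try (unfold subrect; lra);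
        apply IH; try (unfold subrect; lra); try nra. }
  intros a b c d H Ha Hb Hc Hd.
  assert (Hdeg : forall eps, eps > 0 -> (b - a = 0 \/ d - c = 0) -> Rabs (J a b c d) < eps).
  { intros eps Heps Hz. destruct (Jthin eps Heps) as (e & He & Ht). apply Ht; auto. lra. }
  assert (Hzero : (b - a = 0 \/ d - c = 0) -> Rabs (J a b c d) <= K * ((b - a) * (d - c))).
  { intro Hz. replace ((b - a) * (d - c)) with 0 by (destruct Hz as [-> | ->]; ring).
    rewrite Rmult_0_r. apply Rnot_lt_le; intro. apply (Rlt_irrefl (Rabs (J a b c d))).
    apply Hdeg; auto. }
  destruct (Req_dec (b - a) 0); [auto|]. destruct (Req_dec (d - c) 0); [auto|].
  unfold subrect in H.
  set (w := b - a) in *; set (h := d - c) in *.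
  assert (Hw : 0 < w) by (unfold w in *; lra). assert (Hh : 0 < h) by (unfold h in *; lra).
  destruct (archimed_cor1 (Rmin (h / w) (w / h))) as (N & HN & HN0).
  { apply Rmin_glb_lt; apply Rdiv_lt_0_compat; lra. }
  assert (HNp : 0 < INR N) by (apply lt_0_INR; lia).
  assert (H2 := INR_lt_pow2 N).
  assert (Q1 : / INR N < h / w) by (eapply Rlt_le_trans; [exact HN|apply Rmin_l]).
  assert (Q2 : / INR N < w / h) by (eapply Rlt_le_trans; [exact HN|apply Rmin_r]).
  apply (Rmult_lt_compat_r (INR N * w)) in Q1; [|nra].
  apply (Rmult_lt_compat_r (INR N * h)) in Q2; [|nra].
  field_simplify in Q1; [|lra|lra]. field_simplify in Q2; [|lra|lra].
  apply (Hk N); try (unfold subrect; lra); fold w h; nra.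
Qed.

(** Two vertical slabs and two middle ones surround the inner rectangle. They share edges with it,
    where bad points may lie, so the estimate for open rectangles is the one to apply. *)
Lemma bound_outside_hull eta a b c d a' b' c' d' : 0 <= eta -> subrect a b c d ->
  a <= a' <= b' -> b' <= b -> c <= c' <= d' -> d' <= d ->
  (forall x y, a <= x <= b -> c <= y <= d -> ~ (a' <= x <= b' /\ c' <= y <= d') ->
     locally_small eta x y) ->
  Rabs (J a b c d) <=
    eta * ((b - a) * (d - c) - (b' - a') * (d' - c')) + Rabs (J a' b' c' d').
Proof.
  intros Heta H Ha Hb Hc Hd Hs. unfold subrect in H.
  assert (E1 := Jx a a' b c d ltac:(unfold subrect; lra) ltac:(lra)).
  assert (E2 := Jx a' b' b c d ltac:(unfold subrect; lra) ltac:(lra)).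
  assert (E3 := Jy a' b' c c' d ltac:(unfold subrect; lra) ltac:(lra)).
  assert (E4 := Jy a' b' c' d' d ltac:(unfold subrect; lra) ltac:(lra)).
  assert (T1 := locally_small_bound_open eta a a' c d Heta
    ltac:(unfold subrect; lra) ltac:(intros; apply Hs; lra)).
  assert (T2 := locally_small_bound_open eta b' b c d Heta
    ltac:(unfold subrect; lra) ltac:(intros; apply Hs; lra)).
  assert (T3 := locally_small_bound_open eta a' b' c c' Heta
    ltac:(unfold subrect; lra) ltac:(intros; apply Hs; lra)).
  assert (T4 := locally_small_bound_open eta a' b' d' d Heta
    ltac:(unfold subrect; lra) ltac:(intros; apply Hs; lra)).
  rewrite E1, E2, E3, E4.
  apply Rle_trans with (Rabs (J a a' c d) + (Rabs (J a' b' c c') +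
    (Rabs (J a' b' c' d') + Rabs (J a' b' d' d)) + Rabs (J b' b c d))).
  - eapply Rle_trans; [apply Rabs_triang|]. apply Rplus_le_compat_l.
    eapply Rle_trans; [apply Rabs_triang|]. apply Rplus_le_compat_r.
    eapply Rle_trans; [apply Rabs_triang|]. apply Rplus_le_compat_l.
    apply Rabs_triang.
  - nra.
Qed.

Lemma locally_small_everywhere eta : eta > 0 -> forall x y,
  A <= x <= B -> C <= y <= D -> locally_small eta x y.
Proof.
  intros Heta.
  pose (P x y := (A <= x <= B /\ C <= y <= D) /\ ~ locally_small eta x y).
  (* A point within [e / 2] of a locally small point of radius [e] is locally small with radius
     [e / 2]. *)
  assert (Hcl : closed2 P).
  { intros x y H.
    destruct (classic (A <= x <= B /\ C <= y <= D)) as [Hin|Hout].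
    - assert (Hls : locally_small eta x y) by (apply NNPP; intro; apply H; split; auto).
      destruct Hls as (e & He & Hls). exists (e / 2); split; [lra|].
      intros x' y' Hx Hy [_ HN]. apply HN. exists (e / 2); split; [lra|].
      intros. apply Rabs_le_between in Hx; apply Rabs_le_between in Hy.
      apply Hls; auto; lra.
    - assert (Hcase : exists delta, delta > 0 /\
         (x < A - delta \/ x > B + delta \/ y < C - delta \/ y > D + delta)).
      { apply not_and_or in Hout.
        destruct (Rlt_dec x A); [exists ((A - x) / 2); lra|].
        destruct (Rlt_dec B x); [exists ((x - B) / 2); lra|].
        destruct (Rlt_dec y C); [exists ((C - y) / 2); lra|].
        destruct (Rlt_dec D y); [exists ((y - D) / 2); lra|].
        exfalso; lra. }
      destruct Hcase as (e & He & Hc). exists e; split; [exact He|].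
      intros x' y' Hx Hy [Hin _].
      apply Rabs_le_between in Hx; apply Rabs_le_between in Hy. lra. }
  apply NNPP; intro HN.
  assert (Hne : exists x y, P x y).
  { apply NNPP; intro H. apply HN. intros x y Hx Hy. apply NNPP; intro.
    apply H. exists x, y; split; auto. }
  (* On rectangles of eccentricity at most 2 near [(x0, y0)], a bound [eta + th] improves to
     [eta + th / 10]; the starting value is [th = eta]. *)
  destruct (Jportion (eta / 60) P ltac:(lra) ltac:(intros x y [H _]; exact H) Hcl Hne)
    as (x0 & y0 & e & HP0 & He & Hport).
  apply (proj2 HP0). exists e; split; [exact He|].
  assert (Hstep : forall th,
    (th = eta \/
     forall a b c d, subrect a b c d -> x0 - e <= a -> b <= x0 + e -> y0 - e <= c -> d <= y0 + e ->
      Rabs (J a b c d) <= (eta + th) * ((b - a) * (d - c))) -> 0 <= th ->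
    forall a b c d, subrect a b c d -> x0 - e <= a -> b <= x0 + e -> y0 - e <= c -> d <= y0 + e ->
      Rabs (J a b c d) <= (eta + th / 10) * ((b - a) * (d - c))).
  { intros th Hth Hth0. apply bound_of_bounded_eccentricity.
    intros a b c d H Ha Hb Hc Hd Ecc1 Ecc2.
    destruct (classic (exists x y, (a <= x <= b /\ c <= y <= d) /\ P x y)) as [HPQ|HPQ].
    - assert (HclQ : closed2 (fun x y => (a <= x <= b /\ c <= y <= d) /\ P x y)).
      { intros x y Hxy. destruct (classic (P x y)) as [Hp|Hp].
        - assert (Hout : ~ (a <= x <= b /\ c <= y <= d)) by tauto.
          assert (Hcase : exists delta, delta > 0 /\
            (x < a - delta \/ x > b + delta \/ y < c - delta \/ y > d + delta)).
          { destruct (Rlt_dec x a); [exists ((a - x) / 2); lra|].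
            destruct (Rlt_dec b x); [exists ((x - b) / 2); lra|].
            destruct (Rlt_dec y c); [exists ((c - y) / 2); lra|].
            destruct (Rlt_dec d y); [exists ((y - d) / 2); lra|].
            exfalso; apply Hout; lra. }
          destruct Hcase as (f & Hf & Hcs). exists f; split; [exact Hf|].
          intros x' y' Hx Hy [Hin _].
          apply Rabs_le_between in Hx; apply Rabs_le_between in Hy. lra.
        - destruct (Hcl x y Hp) as (f & Hf & Hn). exists f; split; [exact Hf|].
          intros x' y' Hx Hy [_ Hpp]. eapply Hn; eauto. }
      destruct (bounding_rectangle _ a b c d HclQ ltac:(tauto) HPQ)
        as (a' & b' & c' & d' & Hsub & Hin & (ya & Sa) & (yb & Sb) & (xc & Sc) & (xd & Sd)).
      unfold subrect in H.
      assert (Hh := bound_outside_hull eta a b c d a' b' c' d' ltac:(lra)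
        ltac:(unfold subrect; lra) ltac:(lra) ltac:(lra) ltac:(lra) ltac:(lra)).
      lapply Hh; clear Hh; [intro Hh|].
      2:{ intros x y Hx Hy Hnot. apply NNPP; intro Hls. apply Hnot.
          apply Hin. split; [lra|]. split; [lra|exact Hls]. }
      assert (Hq := Hport a' b' c' d' ltac:(unfold subrect; lra)
         ltac:(lra) ltac:(lra) ltac:(lra) ltac:(lra)).
      assert (Hq' : Rabs (J a' b' c' d') <= eta / 60 * (b' - a' + (d' - c')) ^ 2).
      { apply Hq; [exists ya|exists yb|exists xc|exists xd];
          (split; [|tauto]); eapply Hin; eassumption. }
      clear Hq.
      (* Ratio at most 2 gives even [9 / 2] in place of 6. With 6, the factor [eta / 60] of the
         portion estimate becomes [eta / 10] times the area of the outer rectangle. *)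
      assert (Hq6 : (b' - a' + (d' - c')) ^ 2 <= 6 * ((b - a) * (d - c))).
      { apply Rle_trans with ((b - a + (d - c)) ^ 2).
        - apply pow_incr; lra.
        - set (w := b - a) in *; set (h := d - c) in *.
          assert (0 <= w) by (unfold w; lra). assert (0 <= h) by (unfold h; lra). nra. }
      assert (Hq0 : Rabs (J a' b' c' d') <= eta / 10 * ((b - a) * (d - c))) by nra.
      set (s := (b - a) * (d - c)) in *. set (s' := (b' - a') * (d' - c')) in *.
      assert (Hs0 : 0 <= s) by (unfold s; nra).
      assert (Hs0' : 0 <= s') by (unfold s'; nra).
      destruct Hth as [-> | Hth]; [nra|].
      (* If [s <= 10 * s'], the term [- eta * s'] absorbs [eta / 10 * s]. Otherwise the previous
         bound on the inner rectangle leaves an excess [th * s'], which is below [th / 10 * s]. *)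
      destruct (Rle_dec s (10 * s')).
      + nra.
      + assert (Hi := Hth a' b' c' d' ltac:(unfold subrect; lra)
         ltac:(lra) ltac:(lra) ltac:(lra) ltac:(lra)). fold s' in Hi. nra.
    - apply Rle_trans with (eta * ((b - a) * (d - c))).
      + apply locally_small_bound; [exact H|]. intros x y Hx Hy. apply NNPP; intro Hls.
        apply HPQ. exists x, y. split; [lra|]. split; [unfold subrect in H; lra|exact Hls].
      + unfold subrect in H. apply Rmult_le_compat_r; [nra|lra]. }
  (* The exponent is [S j] because the first application of [Hstep], with [th = eta], presupposes no
     bound. *)
  assert (Hall : forall j a b c d, subrect a b c d ->
      x0 - e <= a -> b <= x0 + e -> y0 - e <= c -> d <= y0 + e ->
      Rabs (J a b c d) <= (eta + eta * (/ 10) ^ S j) * ((b - a) * (d - c))).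
  { induction j as [|j IH].
    - intros a b c d. replace (eta * (/ 10) ^ 1) with (eta / 10) by (simpl; field).
      revert a b c d; apply Hstep; [left; reflexivity|lra].
    - intros a b c d. replace (eta * (/ 10) ^ S (S j)) with (eta * (/ 10) ^ S j / 10)
        by (simpl; field).
      revert a b c d; apply Hstep; [right; exact IH|].
      apply Rmult_le_pos; [lra|]. apply pow_le; lra. }
  (* The bounds decrease to [eta * s] as [j] grows. Dividing by [s + 1] rather than [s] covers
     rectangles of area zero. *)
  intros a b c d H Ha Hb Hc Hd. apply Rnot_lt_le; intro Hlt.
  set (s := (b - a) * (d - c)) in *.
  assert (Hs : 0 <= s) by (unfold s, subrect in *; nra).
  destruct (pow_lt_1_zero (/ 10) ltac:(rewrite Rabs_pos_eq; lra)
     ((Rabs (J a b c d) - eta * s) / (eta * (s + 1)))) as (N & Hsmall).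
  { apply Rdiv_lt_0_compat; [lra|nra]. }
  specialize (Hsmall (S N) ltac:(lia)). rewrite Rabs_pos_eq in Hsmall by (apply pow_le; lra).
  specialize (Hall N a b c d H Ha Hb Hc Hd). fold s in Hall.
  apply (Rmult_lt_compat_r (eta * (s + 1))) in Hsmall; [|nra].
  unfold Rdiv in Hsmall. rewrite Rmult_assoc, Rinv_l, Rmult_1_r in Hsmall by nra.
  assert (0 <= (/ 10) ^ S N) by (apply pow_le; lra). nra.
Qed.

Lemma rectangle_function_zero a b c d : subrect a b c d -> J a b c d = 0.
Proof.
  intros H. apply NNPP; intro HN. apply Rabs_pos_lt in HN.
  set (s := (b - a) * (d - c)).
  assert (Hs : 0 <= s) by (unfold s, subrect in *; nra).
  assert (He : Rabs (J a b c d) / (2 * (s + 1)) > 0) by (apply Rdiv_lt_0_compat; lra).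
  assert (Hb := locally_small_bound _ a b c d H (fun x y Hx Hy =>
    locally_small_everywhere _ He x y ltac:(unfold subrect in H; lra) ltac:(unfold subrect in H; lra))).
  fold s in Hb.
  assert (E : Rabs (J a b c d) / (2 * (s + 1)) * s = Rabs (J a b c d) * (s / (2 * (s + 1)))) by (field; lra).
  assert (E2 : s / (2 * (s + 1)) < 1).
  { apply (Rmult_lt_reg_r (2 * (s + 1))); [lra|]. unfold Rdiv. rewrite Rmult_assoc, Rinv_l; lra. }
  rewrite E in Hb. nra.
Qed.

End RectangleFunction.

(** * Compactness and category in the plane *)

(** Compactness for a condition that survives shrinking [de]. For [Q] of the form [nrm * de <= 1] it
    gives boundedness, for a modulus of continuity uniform continuity, for a ball inside an open set
    a positive margin. *)
Lemma uniform_on_rectangle (Q : R -> R -> R -> Prop) (A B C D : R) :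
  A <= B -> C <= D ->
  (forall x y de de', 0 < de' <= de -> Q x y de -> Q x y de') ->
  (forall x y, A <= x <= B -> C <= y <= D -> exists de, de > 0 /\
     forall x' y', A <= x' <= B -> C <= y' <= D ->
       Rabs (x' - x) <= de -> Rabs (y' - y) <= de -> Q x' y' de) ->
  exists de, de > 0 /\ forall x y, A <= x <= B -> C <= y <= D -> Q x y de.
Proof.
  intros HAB HCD Hmono Hloc.
  apply (rectangle_induction (fun a b c d => exists de, de > 0 /\
    forall x y, a <= x <= b -> c <= y <= d -> Q x y de)); auto.
  - intros a x b c d _ _ _ _ (d1 & Hd1 & H1) (d2 & Hd2 & H2).
    exists (Rmin d1 d2); split; [apply Rmin_glb_lt; assumption|].
    assert (0 < Rmin d1 d2) by (apply Rmin_glb_lt; assumption).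
    intros s t Hs Ht. destruct (Rle_dec s x).
    + apply (Hmono _ _ d1); [pose proof (Rmin_l d1 d2); lra|apply H1; lra].
    + apply (Hmono _ _ d2); [pose proof (Rmin_r d1 d2); lra|apply H2; lra].
  - intros a b c y d _ _ _ _ (d1 & Hd1 & H1) (d2 & Hd2 & H2).
    exists (Rmin d1 d2); split; [apply Rmin_glb_lt; assumption|].
    assert (0 < Rmin d1 d2) by (apply Rmin_glb_lt; assumption).
    intros s t Hs Ht. destruct (Rle_dec t y).
    + apply (Hmono _ _ d1); [pose proof (Rmin_l d1 d2); lra|apply H1; lra].
    + apply (Hmono _ _ d2); [pose proof (Rmin_r d1 d2); lra|apply H2; lra].
  - intros x y Hx Hy. destruct (Hloc x y Hx Hy) as (de & Hde & H).
    exists de; split; [exact Hde|]. intros a b c d Ha Hb Hc Hd Ha' Hb' Hc' Hd'.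
    exists de; split; [exact Hde|]. intros s t Hs Ht.
    apply H; try lra; apply Rabs_le; lra.
Qed.

(** If no portion of [P] lies in any [A N], a square centred in [P] can be shrunk, at stage [N], to
    one centred in [P] that avoids [A N]. The centres converge to a point of [P] outside every
    [A N]. *)
Lemma baire_plane (P : R -> R -> Prop) (A : nat -> R -> R -> Prop) :
  closed2 P -> (exists x y, P x y) ->
  (forall N x y, P x y -> ~ A N x y -> exists de, de > 0 /\
     forall x' y', Rabs (x' - x) <= de -> Rabs (y' - y) <= de -> ~ A N x' y') ->
  (forall x y, P x y -> exists N, A N x y) ->
  exists N x y de, P x y /\ de > 0 /\
    forall x' y', P x' y' -> Rabs (x' - x) <= de -> Rabs (y' - y) <= de -> A N x' y'.
Proof.
  intros Hcl (x0 & y0 & H0) Hopen Hcov. apply NNPP; intro HN.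
  assert (Hbad : forall N x y de, P x y -> de > 0 -> exists x' y', P x' y' /\
     Rabs (x' - x) <= de /\ Rabs (y' - y) <= de /\ ~ A N x' y').
  { intros N x y de Hp Hd. apply NNPP; intro H. apply HN. exists N, x, y, de.
    repeat split; auto. intros x' y' Hp' Hx Hy. apply NNPP; intro HA.
    apply H. exists x', y'; auto. }
  (* A state is a centre in [P] with a positive half-side; the subtype carries the invariant through
     the chosen successors. *)
  pose (St := {p : R * R * R | P (fst (fst p)) (snd (fst p)) /\ snd p > 0}).
  assert (Hstep : forall N (s : St), exists s' : St,
    let '(x, y, de) := proj1_sig s in let '(x', y', de') := proj1_sig s' in
    Rabs (x' - x) <= de / 2 /\ Rabs (y' - y) <= de / 2 /\ de' <= de / 2 /\
    forall p q, Rabs (p - x') <= de' -> Rabs (q - y') <= de' -> ~ A N p q).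
  { intros N [[[x y] de] [Hp Hd]]. simpl in *.
    destruct (Hbad N x y (de / 2) Hp ltac:(lra)) as (x' & y' & Hp' & Hx & Hy & HA).
    destruct (Hopen N x' y' Hp' HA) as (d' & Hd' & Hfree).
    assert (Hm : P (fst (fst (x', y', Rmin d' (de / 2)))) (snd (fst (x', y', Rmin d' (de / 2))))
       /\ snd (x', y', Rmin d' (de / 2)) > 0).
    { simpl; split; [exact Hp'|apply Rmin_glb_lt; lra]. }
    exists (exist _ (x', y', Rmin d' (de / 2)) Hm); simpl.
    split; [exact Hx|]. split; [exact Hy|]. split; [apply Rmin_r|].
    intros p q Hpp Hq. apply Hfree; eapply Rle_trans; eauto; apply Rmin_l. }
  assert (Hch : exists nxt : nat -> St -> St, forall N s,
    let '(x, y, de) := proj1_sig s in let '(x', y', de') := proj1_sig (nxt N s) in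
    Rabs (x' - x) <= de / 2 /\ Rabs (y' - y) <= de / 2 /\ de' <= de / 2 /\
    forall p q, Rabs (p - x') <= de' -> Rabs (q - y') <= de' -> ~ A N p q).
  { exists (fun N s => proj1_sig (constructive_indefinite_description _ (Hstep N s))).
    intros N s. exact (proj2_sig (constructive_indefinite_description _ (Hstep N s))). }
  destruct Hch as (nxt & Hnxt).
  assert (Hini : P (fst (fst (x0, y0, 1))) (snd (fst (x0, y0, 1))) /\ snd (x0, y0, 1) > 0)
    by (simpl; split; [exact H0|lra]).
  pose (sq := fix sq (k : nat) : St :=
     match k with O => exist _ (x0, y0, 1) Hini | S k' => nxt k' (sq k') end).
  pose (X k := fst (fst (proj1_sig (sq k)))). pose (Y k := snd (fst (proj1_sig (sq k)))).
  pose (De k := snd (proj1_sig (sq k))).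
  assert (HS : forall k, Rabs (X (S k) - X k) <= De k / 2 /\ Rabs (Y (S k) - Y k) <= De k / 2 /\
     De (S k) <= De k / 2 /\
     forall p q, Rabs (p - X (S k)) <= De (S k) -> Rabs (q - Y (S k)) <= De (S k) -> ~ A k p q).
  { intro k. specialize (Hnxt k (sq k)). unfold X, Y, De. simpl.
    destruct (proj1_sig (nxt k (sq k))) as [[x' y'] d'].
    destruct (proj1_sig (sq k)) as [[x y] d]. exact Hnxt. }
  assert (HP : forall k, P (X k) (Y k)) by (intro k; apply (proj2_sig (sq k))).
  assert (HDe : forall k, De k > 0) by (intro k; apply (proj2_sig (sq k))).
  assert (Hsmall : forall k, De k <= (/ 2) ^ k).
  { induction k as [|k IH]; [unfold De; simpl; lra|].
    destruct (HS k) as (_ & _ & H & _). simpl. lra. }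
  (* A move by at most half the radius, with the radius at least halved, keeps the intervals nested.
     The common point is the supremum of their left ends. *)
  assert (Hnest : forall (Z : nat -> R), (forall k, Rabs (Z (S k) - Z k) <= De k / 2) ->
     exists z, forall k, Rabs (z - Z k) <= De k).
  { intros Z HZ.
    assert (Hmon : forall j k, Z k - De k <= Z (k + j)%nat - De (k + j)%nat /\
       Z (k + j)%nat + De (k + j)%nat <= Z k + De k).
    { induction j as [|j IH]; intro k; [rewrite Nat.add_0_r; lra|].
      rewrite Nat.add_succ_r. specialize (IH k). specialize (HZ (k + j)%nat).
      destruct (HS (k + j)%nat) as (_ & _ & H & _). apply Rabs_le_between in HZ. lra. }
    destruct (completeness (fun z => exists k, z = Z k - De k)) as (z & Hub & Hlub).
    - exists (Z O + De O). intros z (k & ->).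
      destruct (Hmon k O) as [_ H]. simpl in H. specialize (HDe k). lra.
    - exists (Z O - De O), O; reflexivity.
    - exists z. intro k. apply Rabs_le. split.
      + specialize (Hub (Z k - De k) (ex_intro _ k eq_refl)). lra.
      + assert (z <= Z k + De k); [|lra]. apply Hlub. intros w (j & ->).
        destruct (Hmon j k) as [_ H1]. destruct (Hmon k j) as [H2 _].
        rewrite (Nat.add_comm j k) in H2. specialize (HDe (k + j)%nat). lra. }
  destruct (Hnest X) as (xi & Hxi); [intro; apply HS|].
  destruct (Hnest Y) as (yi & Hyi); [intro; apply HS|].
  assert (Hlim : P xi yi).
  { apply NNPP; intro Hn. destruct (Hcl xi yi Hn) as (de & Hde & Hfree).
    destruct (pow_lt_1_zero (/ 2) ltac:(rewrite Rabs_pos_eq; lra) de Hde) as (N & HpN).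
    specialize (HpN N (le_n N)). rewrite Rabs_pos_eq in HpN by (apply pow_le; lra).
    specialize (Hsmall N). specialize (Hxi N). specialize (Hyi N).
    apply (Hfree (X N) (Y N)); [| |apply HP]; rewrite Rabs_minus_sym; lra. }
  destruct (Hcov xi yi Hlim) as (N & HA).
  destruct (HS N) as (_ & _ & _ & H). apply (H xi yi); auto.
Qed.

(** * The algebra *)

Definition Aopp (a : Alg) : Alg := fun r => Copp (a r).

Lemma Cplx_ring : ring_theory C0 C1 Cadd Cmul (fun z w => Cadd z (Copp w)) Copp eq.
Proof.
  split; intros; unfold C0, C1, Cadd, Cmul, Copp, Cre, Cim; try apply injective_projections;
    simpl; try ring; destruct x; simpl; f_equal; ring.
Qed.
Add Ring Cplx_ring_inst : Cplx_ring.

Lemma Cmod_Complex z : Cmod z = Complex.Cmod z.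
Proof. unfold Cmod, Complex.Cmod, Cre, Cim. f_equal. ring. Qed.

Lemma Cmod_ge0 z : 0 <= Cmod z.
Proof. apply sqrt_pos. Qed.

Lemma Cmod_Cadd z w : Cmod (Cadd z w) <= Cmod z + Cmod w.
Proof. rewrite !Cmod_Complex. apply (Complex.Cmod_triangle z w). Qed.

Lemma Cmod_Cmul z w : Cmod (Cmul z w) = Cmod z * Cmod w.
Proof. rewrite !Cmod_Complex. apply (Complex.Cmod_mult z w). Qed.

Lemma Cmod_Copp z : Cmod (Copp z) = Cmod z.
Proof. unfold Cmod, Copp, Cre, Cim; simpl. f_equal; ring. Qed.

Lemma Cmod_RCmul x z : Cmod (RCmul x z) = Rabs x * Cmod z.
Proof.
  unfold Cmod, RCmul, Cre, Cim; simpl.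
  rewrite <- sqrt_Rsqr_abs, <- sqrt_mult_alt by apply Rle_0_sqr.
  f_equal; unfold Rsqr; ring.
Qed.

Lemma Cmod_C0 : Cmod C0 = 0.
Proof. unfold Cmod, C0, Cre, Cim; simpl. rewrite Rmult_0_l, Rplus_0_l. apply sqrt_0. Qed.

Lemma Cmod_eq0 z : Cmod z = 0 -> z = C0.
Proof. rewrite Cmod_Complex. apply Complex.Cmod_eq_0. Qed.

Lemma Rabs_fst_le_Cmod z : Rabs (fst z) <= Cmod z.
Proof.
  unfold Cmod, Cre, Cim. rewrite <- sqrt_Rsqr_abs. apply sqrt_le_1_alt.
  unfold Rsqr; nra.
Qed.

Lemma Rabs_snd_le_Cmod z : Rabs (snd z) <= Cmod z.
Proof.
  unfold Cmod, Cre, Cim. rewrite <- sqrt_Rsqr_abs. apply sqrt_le_1_alt.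
  unfold Rsqr; nra.
Qed.

Lemma Cmod_le_parts z : Cmod z <= Rabs (fst z) + Rabs (snd z).
Proof.
  unfold Cmod, Cre, Cim.
  rewrite <- (sqrt_Rsqr (Rabs (fst z) + Rabs (snd z))).
  - apply sqrt_le_1_alt. unfold Rsqr.
    pose proof (Rabs_pos (fst z)); pose proof (Rabs_pos (snd z)).
    pose proof (Rsqr_abs (fst z)) as E1; pose proof (Rsqr_abs (snd z)) as E2.
    unfold Rsqr in *. nra.
  - pose proof (Rabs_pos (fst z)); pose proof (Rabs_pos (snd z)); lra.
Qed.

Lemma Cmul_solvable al be : al <> C0 -> exists z, Cmul al z = be.
Proof.
  intro H. destruct al as [p q].
  assert (Hpq : p * p + q * q <> 0).
  { intro E. apply H. assert (p = 0) by nra. assert (q = 0) by nra. subst; reflexivity. }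
  exists (Cmul (RCmul (/ (p * p + q * q)) (p, - q)) be). destruct be as [r s].
  unfold Cmul, RCmul, Cre, Cim; simpl; f_equal; field; exact Hpq.
Qed.

Lemma Csum_ext n f g : (forall r, (1 <= r <= n)%nat -> f r = g r) -> Csum n f = Csum n g.
Proof.
  induction n as [|n IH]; intro H; simpl; [reflexivity|].
  rewrite IH, H; [reflexivity|lia|intros; apply H; lia].
Qed.

Lemma Csum_add n f g : Csum n (fun r => Cadd (f r) (g r)) = Cadd (Csum n f) (Csum n g).
Proof. induction n as [|n IH]; simpl; [ring|rewrite IH; ring]. Qed.

Lemma Csum_mul n z f : Csum n (fun r => Cmul z (f r)) = Cmul z (Csum n f).
Proof. induction n as [|n IH]; simpl; [ring|rewrite IH; ring]. Qed.

Lemma Csum_zero n f : (forall r, (1 <= r <= n)%nat -> f r = C0) -> Csum n f = C0.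
Proof.
  induction n as [|n IH]; intro H; simpl; [reflexivity|].
  rewrite IH, H; [ring|lia|intros; apply H; lia].
Qed.

Lemma Csum_single n f p : (1 <= p <= n)%nat ->
  (forall r, (1 <= r <= n)%nat -> r <> p -> f r = C0) -> Csum n f = f p.
Proof.
  induction n as [|n IH]; intros Hp H; [lia|]. simpl.
  destruct (Nat.eq_dec p (S n)) as [->|Hne].
  - rewrite Csum_zero; [ring|]. intros; apply H; lia.
  - rewrite IH, (H (S n)); [ring|lia|lia|lia|]. intros; apply H; lia.
Qed.

Lemma Csum_swap n k f :
  Csum n (fun r => Csum k (fun s => f r s)) = Csum k (fun s => Csum n (fun r => f r s)).
Proof.
  induction n as [|n IH]; simpl.
  - symmetry; apply Csum_zero; reflexivity.
  - rewrite IH, <- Csum_add. reflexivity.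
Qed.

Lemma Rsum1_le n f g : (forall r, (1 <= r <= n)%nat -> f r <= g r) -> Rsum1 n f <= Rsum1 n g.
Proof.
  induction n as [|n IH]; intro H; simpl; [lra|].
  apply Rplus_le_compat; [apply IH; intros; apply H; lia|apply H; lia].
Qed.

Lemma Rsum1_plus n f g : Rsum1 n (fun r => f r + g r) = Rsum1 n f + Rsum1 n g.
Proof. induction n as [|n IH]; simpl; [ring|rewrite IH; ring]. Qed.

Lemma Rsum1_scal n x f : Rsum1 n (fun r => x * f r) = x * Rsum1 n f.
Proof. induction n as [|n IH]; simpl; [ring|rewrite IH; ring]. Qed.

Lemma Rsum1_const n x : Rsum1 n (fun _ => x) = INR n * x.
Proof. induction n as [|n IH]; [simpl; ring|]. rewrite S_INR; simpl; rewrite IH; ring. Qed.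

Lemma Rsum1_ge0 n f : (forall r, (1 <= r <= n)%nat -> 0 <= f r) -> 0 <= Rsum1 n f.
Proof.
  intro H. apply Rle_trans with (Rsum1 n (fun _ => 0)); [rewrite Rsum1_const; lra|].
  apply Rsum1_le, H.
Qed.

Lemma Rsum1_term n f p : (forall r, (1 <= r <= n)%nat -> 0 <= f r) -> (1 <= p <= n)%nat ->
  f p <= Rsum1 n f.
Proof.
  induction n as [|n IH]; intros H Hp; [lia|]. simpl.
  destruct (Nat.eq_dec p (S n)) as [->|Hne].
  - assert (0 <= Rsum1 n f) by (apply Rsum1_ge0; intros; apply H; lia). lra.
  - assert (f p <= Rsum1 n f) by (apply IH; [intros; apply H; lia|lia]).
    assert (0 <= f (S n)) by (apply H; lia). lra.
Qed.

Lemma Cmod_Csum n f : Cmod (Csum n f) <= Rsum1 n (fun r => Cmod (f r)).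
Proof.
  induction n as [|n IH]; simpl; [rewrite Cmod_C0; lra|].
  eapply Rle_trans; [apply Cmod_Cadd|lra].
Qed.

(** * The sum norm on coordinates *)

Section Norm.

Variable n : nat.

Lemma Anorm_ge0 a : 0 <= Anorm n a.
Proof. apply Rsum1_ge0; intros; apply Cmod_ge0. Qed.

Lemma Anorm_Aadd a b : Anorm n (Aadd a b) <= Anorm n a + Anorm n b.
Proof. unfold Anorm. rewrite <- Rsum1_plus. apply Rsum1_le; intros; apply Cmod_Cadd. Qed.

Lemma Anorm_Aopp a : Anorm n (Aopp a) = Anorm n a.
Proof. unfold Anorm, Aopp. f_equal. extensionality r. apply Cmod_Copp. Qed.

Lemma Anorm_Asub a b : Anorm n (Asub a b) <= Anorm n a + Anorm n b.
Proof. rewrite <- (Anorm_Aopp b). apply (Anorm_Aadd a (Aopp b)). Qed.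

Lemma Anorm_Ascal x a : Anorm n (Ascal x a) = Rabs x * Anorm n a.
Proof.
  unfold Anorm, Ascal. rewrite <- Rsum1_scal. f_equal. extensionality r. apply Cmod_RCmul.
Qed.

Lemma Aeq_refl a : Aeq n a a.
Proof. intros r _; reflexivity. Qed.
Lemma Aeq_sym a b : Aeq n a b -> Aeq n b a.
Proof. intros H r Hr; symmetry; auto. Qed.
Lemma Aeq_trans a b c : Aeq n a b -> Aeq n b c -> Aeq n a c.
Proof. intros H1 H2 r Hr; rewrite H1; auto. Qed.

Lemma Anorm_ext a b : Aeq n a b -> Anorm n a = Anorm n b.
Proof.
  intro H; apply Rle_antisym; apply Rsum1_le; intros r Hr; rewrite H by exact Hr; lra.
Qed.

Lemma Anorm_Azero : Anorm n Azero = 0.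
Proof.
  unfold Anorm, Azero. rewrite Cmod_C0, Rsum1_const; ring.
Qed.

Lemma Cmod_le_Anorm a r : (1 <= r <= n)%nat -> Cmod (a r) <= Anorm n a.
Proof. intro H. apply (Rsum1_term n (fun r => Cmod (a r))); [intros; apply Cmod_ge0|exact H]. Qed.

Lemma Anorm_small a : (forall eps, eps > 0 -> Anorm n a <= eps) -> Aeq n a Azero.
Proof.
  intros H r Hr. apply Cmod_eq0, Rle_antisym; [|apply Cmod_ge0].
  eapply Rle_trans; [apply Cmod_le_Anorm; exact Hr|].
  apply Rnot_lt_le; intro Hlt. specialize (H (Anorm n a / 2) ltac:(lra)). lra.
Qed.

Lemma Anorm_le_parts a K :
  (forall r, (1 <= r <= n)%nat -> Rabs (fst (a r)) <= K /\ Rabs (snd (a r)) <= K) ->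
  Anorm n a <= 2 * INR n * K.
Proof.
  intro H. apply Rle_trans with (Rsum1 n (fun _ => 2 * K)); [|rewrite Rsum1_const; lra].
  apply Rsum1_le; intros r Hr. destruct (H r Hr).
  eapply Rle_trans; [apply Cmod_le_parts|lra].
Qed.

Lemma Anorm_sub_sym a b : Anorm n (Asub a b) = Anorm n (Asub b a).
Proof.
  rewrite <- Anorm_Aopp. f_equal. extensionality r.
  unfold Aopp, Asub. ring.
Qed.

Lemma Anorm_sub_triang a b c :
  Anorm n (Asub a c) <= Anorm n (Asub a b) + Anorm n (Asub b c).
Proof.
  replace (Asub a c) with (Aadd (Asub a b) (Asub b c)); [apply Anorm_Aadd|].
  extensionality r. unfold Aadd, Asub. ring.
Qed.

Lemma Aeq_of_sub a b : Aeq n (Asub a b) Azero -> Aeq n a b.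
Proof.
  intros H r Hr. specialize (H r Hr). unfold Asub, Azero in H.
  replace (a r) with (Cadd (Cadd (a r) (Copp (b r))) (b r)) by ring. rewrite H; ring.
Qed.

End Norm.

(** * Ring structure, characters and units *)

Section Algebra.

Variables (m n : nat) (Ups : nat -> nat -> nat -> Cplx) (u : nat -> nat).
Hypothesis Halg : is_algebra_Anm m n Ups u.

Local Notation "a == b" := (Aeq n a b) (at level 70).
Local Notation mul := (Amul m n Ups u).
Local Notation one := (Aunit m).
Local Notation nrm := (Anorm n).

#[local] Instance Aeq_equiv : Equivalence (Aeq n).
Proof. split; [exact (Aeq_refl n)|exact (Aeq_sym n)|exact (Aeq_trans n)]. Qed.

#[local] Instance Aadd_proper : Proper (Aeq n ==> Aeq n ==> Aeq n) Aadd.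
Proof. intros a b H c d H' r Hr. unfold Aadd. rewrite H, H' by exact Hr. reflexivity. Qed.
#[local] Instance Asub_proper : Proper (Aeq n ==> Aeq n ==> Aeq n) Asub.
Proof. intros a b H c d H' r Hr. unfold Asub. rewrite H, H' by exact Hr. reflexivity. Qed.
#[local] Instance Aopp_proper : Proper (Aeq n ==> Aeq n) Aopp.
Proof. intros a b H r Hr. unfold Aopp. rewrite H by exact Hr. reflexivity. Qed.
#[local] Instance Ascal_proper : Proper (eq ==> Aeq n ==> Aeq n) Ascal.
Proof. intros x y -> a b H r Hr. unfold Ascal. rewrite H by exact Hr. reflexivity. Qed.
#[local] Instance Amul_proper : Proper (Aeq n ==> Aeq n ==> Aeq n) mul.
Proof.
  intros a b H c d H' p Hp. unfold Amul. apply Csum_ext; intros r Hr.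
  apply Csum_ext; intros s Hs. rewrite H, H' by assumption. reflexivity.
Qed.
#[local] Instance Anorm_proper : Proper (Aeq n ==> eq) (Anorm n).
Proof. intros a b H. apply Anorm_ext, H. Qed.

(** The matrix of multiplication by [a], with row [p] and column [s]. The multiplication rules make
    it lower triangular with the values [f_u(a)] on the diagonal. *)
Definition mulmat (a : Alg) (p s : nat) : Cplx :=
  Csum n (fun r => Cmul (a r) (struct_const m n Ups u r s p)).

Lemma Amul_mulmat a b p : mul a b p = Csum n (fun s => Cmul (mulmat a p s) (b s)).
Proof.
  unfold Amul. rewrite Csum_swap. apply Csum_ext; intros s Hs.
  unfold mulmat. transitivity (Cmul (b s) (Csum n (fun r => Cmul (a r) (struct_const m n Ups u r s p)))).
  - rewrite <- Csum_mul. apply Csum_ext; intros; ring.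
  - ring.
Qed.

(* The index [q <= m] with [I_q I_p = I_p]. *)
Definition char_index (p : nat) : nat := if Nat.leb p m then p else u p.

Lemma char_index_range p : (1 <= p <= n)%nat -> (1 <= char_index p <= m)%nat.
Proof.
  intro Hp. unfold char_index. destruct (Nat.leb_spec p m); [lia|].
  apply Halg; lia.
Qed.

Ltac sconst := unfold struct_const;
  repeat match goal with
  | |- context [Nat.leb ?a ?b] => destruct (Nat.leb_spec a b)
  | |- context [Nat.ltb ?a ?b] => destruct (Nat.ltb_spec a b)
  | |- context [Nat.eqb ?a ?b] => destruct (Nat.eqb_spec a b)
  end; simpl; try ring; try lia; try (subst; lia); try congruence.

Lemma mulmat_above a p s : (1 <= p <= n)%nat -> (1 <= s <= n)%nat -> (p < s)%nat ->
  mulmat a p s = C0.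
Proof.
  intros Hp Hs Hlt. apply Csum_zero; intros r Hr.
  sconst.
Qed.

Lemma mulmat_diag a p : (1 <= p <= n)%nat -> mulmat a p p = a (char_index p).
Proof.
  intro Hp. unfold mulmat.
  assert (Hci := char_index_range p Hp). destruct Halg as [Hmn _].
  rewrite (Csum_single n _ (char_index p)); [|lia|].
  - unfold char_index in *. destruct (Nat.leb_spec p m) as [L|L]; sconst.
  - intros r Hr Hne. unfold char_index in *. destruct (Nat.leb_spec p m) as [L|L]; sconst.
Qed.

Lemma Amul_char a b p : (1 <= p <= m)%nat -> mul a b p = Cmul (a p) (b p).
Proof.
  intro Hp. rewrite Amul_mulmat. destruct Halg as [Hmn _].
  rewrite (Csum_single n _ p); [|lia|].
  - rewrite mulmat_diag by lia. unfold char_index. destruct (Nat.leb_spec p m); [reflexivity|lia].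
  - intros s Hs Hne. unfold mulmat. rewrite Csum_zero; [ring|].
    intros r Hr. sconst.
Qed.

Lemma triangular_solvable (M : nat -> nat -> Cplx) (t : nat -> Cplx) N :
  (forall p, (1 <= p <= N)%nat -> M p p <> C0) ->
  exists b : nat -> Cplx, forall p, (1 <= p <= N)%nat ->
    Csum p (fun s => Cmul (M p s) (b s)) = t p.
Proof.
  induction N as [|N IH]; intro H.
  - exists (fun _ => C0). intros; lia.
  - destruct IH as (b & Hb); [intros; apply H; lia|].
    destruct (Cmul_solvable (M (S N) (S N))
      (Cadd (t (S N)) (Copp (Csum N (fun s => Cmul (M (S N) s) (b s)))))) as (z & Hz);
      [apply H; lia|].
    exists (fun s => if Nat.eqb s (S N) then z else b s). intros p Hp.
    destruct (Nat.eq_dec p (S N)) as [->|Hne].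
    + simpl Csum. rewrite Nat.eqb_refl, Hz.
      rewrite (Csum_ext N _ (fun s => Cmul (M (S N) s) (b s))); [ring|].
      intros s Hs. destruct (Nat.eqb_spec s (S N)); [lia|reflexivity].
    + rewrite <- (Hb p) by lia. apply Csum_ext; intros s Hs.
      destruct (Nat.eqb_spec s (S N)); [lia|reflexivity].
Qed.

Lemma Csum_truncate (f : nat -> Cplx) p N : (p <= N)%nat ->
  (forall s, (p < s <= N)%nat -> f s = C0) -> Csum N f = Csum p f.
Proof.
  induction N as [|N IH]; intros Hp H.
  - replace p with O by lia. reflexivity.
  - destruct (Nat.eq_dec p (S N)) as [->|Hne]; [reflexivity|].
    simpl. rewrite IH, H; [ring|lia|lia|]. intros; apply H; lia.
Qed.

(** The triangular system [a b = 1] is solved by forward substitution, because each diagonal entry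
    is the value of a character of [a]. *)
Lemma Ainverse_exists a : (forall p, (1 <= p <= m)%nat -> a p <> C0) ->
  exists b, mul a b == one.
Proof.
  intro H.
  destruct (triangular_solvable (mulmat a) one n) as (b & Hb).
  { intros p Hp. rewrite mulmat_diag by exact Hp. apply H, char_index_range, Hp. }
  exists b. intros p Hp. rewrite Amul_mulmat, (Csum_truncate _ p); [apply Hb, Hp|lia|].
  intros s Hs. rewrite mulmat_above; [ring|lia|lia|lia].
Qed.

Lemma Amul_one a : mul one a == a.
Proof.
  intros p Hp. unfold Amul. destruct Halg as [Hmn [Hu _]].
  assert (Hci := char_index_range p Hp).
  rewrite (Csum_single n _ (char_index p)); [|lia|].
  - rewrite (Csum_single n _ p); [|lia|].
    + unfold Aunit, char_index in *. destruct (Nat.leb_spec p m) as [L|L]; sconst.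
    + intros s Hs Hne. unfold char_index in *. destruct (Nat.leb_spec p m) as [L|L]; sconst.
  - intros r Hr Hne. apply Csum_zero; intros s Hs. unfold Aunit, char_index in *.
    destruct (Nat.leb_spec p m) as [L|L]; sconst.
Qed.

Lemma Amul_Aadd_l a b c : mul (Aadd a b) c = Aadd (mul a c) (mul b c).
Proof.
  extensionality p. unfold Aadd at 2. unfold Amul. rewrite <- Csum_add. apply Csum_ext; intros r _.
  rewrite <- Csum_add. apply Csum_ext; intros s _. unfold Aadd; ring.
Qed.

(** The axioms hold only up to [Aeq n], since coordinates outside [1..n] are arbitrary; hence the
    setoid instances and a ring over a setoid. Commutativity and associativity are read off from
    [Halg]. *)
Lemma Aring_theory : ring_theory Azero one Aadd mul Asub Aopp (Aeq n).
Proof.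
  destruct Halg as [_ [_ [Hcomm Hassoc]]].
  split; intros; try (intros r Hr; unfold Aadd, Azero, Asub, Aopp; ring).
  - apply Amul_one.
  - apply Hcomm.
  - symmetry; apply Hassoc.
  - rewrite Amul_Aadd_l. reflexivity.
Qed.

Lemma Aring_ext : ring_eq_ext Aadd mul Aopp (Aeq n).
Proof. split; [exact Aadd_proper|exact Amul_proper|exact Aopp_proper]. Qed.

Add Ring Aring_inst : Aring_theory (setoid Aeq_equiv Aring_ext).

(** Turns a real scalar into a ring element, so that [ring] can move it. *)
Lemma Ascal_mul x a : Ascal x a == mul (Ascal x one) a.
Proof.
  rewrite <- (Amul_one a) at 1. intros p Hp. unfold Ascal at 1. unfold Amul.
  assert (HR : forall z, RCmul x z = Cmul (x, 0) z).
  { intro z. unfold RCmul, Cmul, Cre, Cim; simpl; f_equal; ring. }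
  rewrite HR, <- Csum_mul. apply Csum_ext; intros r _.
  rewrite <- Csum_mul. apply Csum_ext; intros s _. unfold Ascal. rewrite HR. ring.
Qed.

(** The sum norm is submultiplicative up to a constant: [S] adds the moduli of all structure
    constants, [INR n] counts the coordinates of the product, and 1 makes the constant positive. *)
Lemma Amul_bounded : exists K, K > 0 /\ forall a b, nrm (mul a b) <= K * (nrm a * nrm b).
Proof.
  set (S := Rsum1 n (fun r => Rsum1 n (fun s => Rsum1 n (fun p =>
             Cmod (struct_const m n Ups u r s p))))).
  assert (HS0 : 0 <= S).
  { apply Rsum1_ge0; intros; apply Rsum1_ge0; intros; apply Rsum1_ge0; intros; apply Cmod_ge0. }
  assert (HS : forall r s p, (1 <= r <= n)%nat -> (1 <= s <= n)%nat -> (1 <= p <= n)%nat ->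
     Cmod (struct_const m n Ups u r s p) <= S).
  { intros r s p Hr Hs Hp.
    eapply Rle_trans; [apply (Rsum1_term n (fun p => Cmod (struct_const m n Ups u r s p)) p);
      [intros; apply Cmod_ge0|exact Hp]|].
    eapply Rle_trans; [apply (Rsum1_term n (fun s => Rsum1 n (fun p =>
       Cmod (struct_const m n Ups u r s p))) s);
      [intros; apply Rsum1_ge0; intros; apply Cmod_ge0|exact Hs]|].
    apply (Rsum1_term n (fun r => Rsum1 n (fun s => Rsum1 n (fun p =>
       Cmod (struct_const m n Ups u r s p)))) r);
      [intros; apply Rsum1_ge0; intros; apply Rsum1_ge0; intros; apply Cmod_ge0|exact Hr]. }
  exists (INR n * S + 1). pose proof (pos_INR n).
  split; [nra|]. intros a b.
  assert (Hp : forall p, (1 <= p <= n)%nat -> Cmod (mul a b p) <= S * (nrm a * nrm b)).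
  { intros p Hp. unfold Amul.
    eapply Rle_trans; [apply Cmod_Csum|].
    apply Rle_trans with (Rsum1 n (fun r => S * nrm b * Cmod (a r))).
    - apply Rsum1_le; intros r Hr.
      eapply Rle_trans; [apply Cmod_Csum|].
      apply Rle_trans with (Rsum1 n (fun s => S * Cmod (a r) * Cmod (b s))).
      + apply Rsum1_le; intros s Hs. rewrite !Cmod_Cmul.
        pose proof (Cmod_ge0 (a r)); pose proof (Cmod_ge0 (b s)).
        specialize (HS r s p Hr Hs Hp).
        replace (S * Cmod (a r) * Cmod (b s)) with (Cmod (a r) * Cmod (b s) * S) by ring.
        apply Rmult_le_compat_l; [apply Rmult_le_pos; assumption|exact HS].
      + rewrite Rsum1_scal. unfold Anorm. lra.
    - rewrite Rsum1_scal. unfold Anorm. lra. }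
  apply Rle_trans with (Rsum1 n (fun _ => S * (nrm a * nrm b))).
  - apply Rsum1_le, Hp.
  - rewrite Rsum1_const. pose proof (Anorm_ge0 n a); pose proof (Anorm_ge0 n b). nra.
Qed.

(** * Limits and integrals of algebra-valued functions *)

(** Spelled out through [nrm], which is only a seminorm on functions [nat -> Cplx]: limits are
    determined up to [Aeq n]. *)
Definition Lim {T : Type} (F : (T -> Prop) -> Prop) (f : T -> Alg) (v : Alg) : Prop :=
  forall eps, eps > 0 -> F (fun t => nrm (Asub (f t) v) < eps).

Section Limits.

Context {T : Type} (F : (T -> Prop) -> Prop) {FF : Filter F}.

Lemma Lim_const v : Lim F (fun _ => v) v.
Proof.
  intros eps He. apply filter_forall. intros _.
  rewrite (Anorm_ext n _ Azero) by ring. rewrite Anorm_Azero. exact He.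
Qed.

Lemma Lim_ext f g v w : F (fun t => f t == g t) -> v == w -> Lim F f v -> Lim F g w.
Proof.
  intros Hfg Hvw H eps He. generalize (filter_and _ _ Hfg (H eps He)).
  apply filter_imp. intros t [E Hlt]. rewrite <- E, <- Hvw. exact Hlt.
Qed.

Lemma Lim_Aadd f g v w : Lim F f v -> Lim F g w -> Lim F (fun t => Aadd (f t) (g t)) (Aadd v w).
Proof.
  intros Hf Hg eps He.
  assert (He2 : eps / 2 > 0) by lra.
  generalize (filter_and _ _ (Hf (eps / 2) He2) (Hg (eps / 2) He2)).
  apply filter_imp. intros t [H1 H2].
  rewrite (Anorm_ext n _ (Aadd (Asub (f t) v) (Asub (g t) w))) by ring.
  eapply Rle_lt_trans; [apply Anorm_Aadd|lra].
Qed.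

Lemma Lim_Amul f g v w : Lim F f v -> Lim F g w -> Lim F (fun t => mul (f t) (g t)) (mul v w).
Proof.
  intros Hf Hg eps He. destruct Amul_bounded as (K & HK & Hmul).
  pose proof (Anorm_ge0 n v) as Hv; pose proof (Anorm_ge0 n w) as Hw.
  set (M := K * (1 + nrm v + nrm w)). assert (HM : M > 0) by (unfold M; nra).
  assert (He' : eps / M > 0) by (apply Rdiv_lt_0_compat; lra).
  set (de := Rmin 1 (eps / M)).
  assert (Hde : de > 0) by (apply Rmin_glb_lt; lra).
  assert (Hde1 : de <= 1) by apply Rmin_l.
  assert (Hde2 : M * de <= eps).
  { apply Rle_trans with (M * (eps / M)); [apply Rmult_le_compat_l; [lra|apply Rmin_r]|].
    right; field; lra. }
  generalize (filter_and _ _ (Hf de Hde) (Hg de Hde)).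
  apply filter_imp. intros t [H1 H2].
  rewrite (Anorm_ext n _ (Aadd (mul (Asub (f t) v) (Asub (g t) w))
    (Aadd (mul (Asub (f t) v) w) (mul v (Asub (g t) w))))) by ring.
  pose proof (Anorm_ge0 n (Asub (f t) v)) as Z1; pose proof (Anorm_ge0 n (Asub (g t) w)) as Z2.
  set (p := nrm (Asub (f t) v)) in *. set (q := nrm (Asub (g t) w)) in *.
  assert (N1 : nrm (mul (Asub (f t) v) (Asub (g t) w)) <= K * (p * q)) by apply Hmul.
  assert (N2 : nrm (mul (Asub (f t) v) w) <= K * (p * nrm w)) by apply Hmul.
  assert (N3 : nrm (mul v (Asub (g t) w)) <= K * (nrm v * q)) by apply Hmul.
  eapply Rle_lt_trans; [apply Anorm_Aadd|].
  eapply Rle_lt_trans; [apply Rplus_le_compat_l, Anorm_Aadd|].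
  assert (p * q <= p * 1) by (apply Rmult_le_compat_l; lra).
  assert (p * nrm w <= de * nrm w) by (apply Rmult_le_compat_r; lra).
  assert (nrm v * q <= nrm v * de) by (apply Rmult_le_compat_l; lra).
  apply Rle_lt_trans with (K * (p + de * nrm w + nrm v * de)); [nra|].
  apply Rlt_le_trans with (K * (de + de * nrm w + nrm v * de)); [|unfold M in Hde2; lra].
  apply Rmult_lt_compat_l; lra.
Qed.

Lemma Lim_Asub f g v w : Lim F f v -> Lim F g w -> Lim F (fun t => Asub (f t) (g t)) (Asub v w).
Proof.
  intros Hf Hg.
  apply (Lim_ext (fun t => Aadd (f t) (mul (Aopp one) (g t))) _ (Aadd v (mul (Aopp one) w))).
  - apply filter_forall; intro; ring.
  - ring.
  - apply Lim_Aadd; [exact Hf|]. apply Lim_Amul; [apply Lim_const|exact Hg].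
Qed.

End Limits.

Lemma Lim_comp {T S} (F : (T -> Prop) -> Prop) (G : (S -> Prop) -> Prop) (h : T -> S) f v :
  filterlim h F G -> Lim G f v -> Lim F (fun t => f (h t)) v.
Proof. intros Hh Hf eps He. exact (Hh _ (Hf eps He)). Qed.

Definition cont1 (f : R -> Alg) (t : R) : Prop := Lim (locally t) f (f t).
Definition cont2 (g : R -> R -> Alg) (x y : R) : Prop :=
  Lim (locally (x, y)) (fun p => g (fst p) (snd p)) (g x y).

Lemma cont2_iff g x y : cont2 g x y <-> forall eps, eps > 0 -> exists de, de > 0 /\
  forall x' y', Rabs (x' - x) <= de -> Rabs (y' - y) <= de ->
    nrm (Asub (g x' y') (g x y)) < eps.
Proof.
  split.
  - intros H eps He. destruct (H eps He) as (d & Hd).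
    exists (d / 2); split; [destruct d; simpl; lra|].
    intros x' y' Hx Hy. apply (Hd (x', y')).
    destruct d as [d Hd0]; simpl in *.
    split; simpl; (apply Rle_lt_trans with (d / 2); [assumption|lra]).
  - intros H eps He. destruct (H eps He) as (d & Hd0 & Hd).
    exists (mkposreal d Hd0). intros [x' y'] [Hx Hy]. apply Hd; apply Rlt_le; assumption.
Qed.

Lemma cont2_cont1_x g x y : cont2 g x y -> cont1 (fun t => g t y) x.
Proof.
  intro H. apply (Lim_comp (locally x) (locally (x, y)) (fun t => (t, y))
    (fun p => g (fst p) (snd p)) (g x y)); [|exact H].
  intros P (d & Hd). exists d. intros t Ht. apply Hd. split; [exact Ht|apply ball_center].
Qed.

Lemma cont2_cont1_y g x y : cont2 g x y -> cont1 (fun t => g x t) y.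
Proof.
  intro H. apply (Lim_comp (locally y) (locally (x, y)) (fun t => (x, t))
    (fun p => g (fst p) (snd p)) (g x y)); [|exact H].
  intros P (d & Hd). exists d. intros t Ht. apply Hd. split; [apply ball_center|exact Ht].
Qed.

Lemma cont1_parts f t r : (1 <= r <= n)%nat -> cont1 f t ->
  continuous (fun t => fst (f t r)) t /\ continuous (fun t => snd (f t r)) t.
Proof.
  intros Hr H. split; apply filterlim_locally; intro eps;
  generalize (H eps (cond_pos eps)); apply filter_imp; intros s Hs;
  (eapply Rle_lt_trans; [|exact Hs]).
  - eapply Rle_trans; [|apply Cmod_le_Anorm; exact Hr].
    apply (Rabs_fst_le_Cmod (Asub (f s) (f t) r)).
  - eapply Rle_trans; [|apply Cmod_le_Anorm; exact Hr].
    apply (Rabs_snd_le_Cmod (Asub (f s) (f t) r)).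
Qed.

(** * Componentwise Riemann integrals *)

Definition is_CInt (f : R -> Cplx) (a b : R) (v : Cplx) : Prop :=
  is_RInt (fun t => fst (f t)) a b (fst v) /\ is_RInt (fun t => snd (f t)) a b (snd v).

Lemma is_CInt_Cadd f g a b v w : is_CInt f a b v -> is_CInt g a b w ->
  is_CInt (fun t => Cadd (f t) (g t)) a b (Cadd v w).
Proof. intros [H1 H2] [H3 H4]. split; apply (is_RInt_plus (V := R_NormedModule)); assumption. Qed.

Lemma is_CInt_Cmul z f a b v : is_CInt f a b v ->
  is_CInt (fun t => Cmul z (f t)) a b (Cmul z v).
Proof.
  intros [H1 H2]. split; simpl.
  - apply (is_RInt_minus (V := R_NormedModule)); apply (is_RInt_scal (V := R_NormedModule)); assumption.
  - apply (is_RInt_plus (V := R_NormedModule)); apply (is_RInt_scal (V := R_NormedModule)); assumption.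
Qed.

Lemma is_CInt_C0 a b : is_CInt (fun _ => C0) a b C0.
Proof.
  assert (H := is_RInt_const (V := R_NormedModule) a b 0).
  change (is_RInt (fun _ => 0) a b ((b - a) * 0)) in H. rewrite Rmult_0_r in H.
  split; exact H.
Qed.

Lemma is_CInt_Csum N f a b v : (forall r, (1 <= r <= N)%nat -> is_CInt (fun t => f t r) a b (v r)) ->
  is_CInt (fun t => Csum N (f t)) a b (Csum N v).
Proof.
  induction N as [|N IH]; intro H; simpl; [apply is_CInt_C0|].
  apply is_CInt_Cadd; [apply IH; intros; apply H; lia|apply H; lia].
Qed.

Lemma is_CInt_ext f g a b v : a <= b -> (forall t, a <= t <= b -> f t = g t) ->
  is_CInt f a b v -> is_CInt g a b v.
Proof.
  intros Hab E [H1 H2]. split; [revert H1|revert H2]; apply is_RInt_ext;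
  rewrite Rmin_left, Rmax_right by exact Hab; intros t Ht; rewrite E by lra; reflexivity.
Qed.

Definition is_AInt (f : R -> Alg) (a b : R) (v : Alg) : Prop :=
  forall r, (1 <= r <= n)%nat -> is_CInt (fun t => f t r) a b (v r).

Definition AInt (f : R -> Alg) (a b : R) : Alg :=
  fun r => (RInt (fun t => fst (f t r)) a b, RInt (fun t => snd (f t r)) a b).

Lemma AInt_unique f a b v : is_AInt f a b v -> AInt f a b == v.
Proof.
  intros H r Hr. destruct (H r Hr) as [H1 H2]. unfold AInt.
  apply (is_RInt_unique (V := R_CompleteNormedModule)) in H1.
  apply (is_RInt_unique (V := R_CompleteNormedModule)) in H2.
  apply injective_projections; assumption.
Qed.

Lemma AInt_correct f a b : a <= b -> (forall t, a <= t <= b -> cont1 f t) ->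
  is_AInt f a b (AInt f a b).
Proof.
  intros Hab Hc r Hr. split; apply (RInt_correct (V := R_CompleteNormedModule));
  apply (ex_RInt_continuous (V := R_CompleteNormedModule));
  rewrite Rmin_left, Rmax_right by exact Hab; intros t Ht; apply cont1_parts; auto.
Qed.

Lemma is_AInt_ext f g a b v : a <= b -> (forall t, a <= t <= b -> f t == g t) ->
  is_AInt f a b v -> is_AInt g a b v.
Proof.
  intros Hab E H r Hr. apply (is_CInt_ext (fun t => f t r)); auto.
  intros t Ht. apply E; auto.
Qed.

Lemma is_AInt_Aadd f g a b v w : is_AInt f a b v -> is_AInt g a b w ->
  is_AInt (fun t => Aadd (f t) (g t)) a b (Aadd v w).
Proof. intros H1 H2 r Hr. apply is_CInt_Cadd; auto. Qed.

Lemma is_AInt_Amul k f a b v : is_AInt f a b v ->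
  is_AInt (fun t => mul k (f t)) a b (mul k v).
Proof.
  intros H p Hp.
  assert (E : forall x : Alg, mul k x p = Csum n (fun s => Cmul (mulmat k p s) (x s)))
    by (intro; apply Amul_mulmat).
  rewrite E.
  replace (fun t => mul k (f t) p) with
    (fun t => Csum n (fun s => Cmul (mulmat k p s) (f t s))) by (extensionality t; auto).
  apply (is_CInt_Csum n (fun t s => Cmul (mulmat k p s) (f t s))).
  intros s Hs. apply is_CInt_Cmul, H, Hs.
Qed.

Lemma is_AInt_Asub f g a b v w : a <= b -> is_AInt f a b v -> is_AInt g a b w ->
  is_AInt (fun t => Asub (f t) (g t)) a b (Asub v w).
Proof.
  intros Hab H1 H2 r Hr. unfold Asub.
  replace (Copp (w r)) with (Cmul (Copp C1) (w r)) by ring.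
  apply (is_CInt_ext (fun t => Cadd (f t r) (Cmul (Copp C1) (g t r)))).
  - exact Hab.
  - intros; ring.
  - apply is_CInt_Cadd; [auto|]. apply is_CInt_Cmul; auto.
Qed.

Lemma is_AInt_const v a b : is_AInt (fun _ => v) a b (Ascal (b - a) v).
Proof. intros r Hr. split; apply (is_RInt_const (V := R_NormedModule)). Qed.

Lemma is_AInt_Chasles f a b c v w : is_AInt f a b v -> is_AInt f b c w ->
  is_AInt f a c (Aadd v w).
Proof.
  intros H1 H2 r Hr. destruct (H1 r Hr), (H2 r Hr).
  split; eapply (is_RInt_Chasles (V := R_NormedModule)); eassumption.
Qed.

(** The real estimate is applied to the [2 n] real components separately, whence the factor
    [2 * INR n]. *)
Lemma is_AInt_bound f a b v M : a <= b -> is_AInt f a b v ->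
  (forall t, a <= t <= b -> nrm (f t) <= M) -> nrm v <= 2 * INR n * ((b - a) * M).
Proof.
  intros Hab H HM. apply Anorm_le_parts. intros r Hr. destruct (H r Hr) as [H1 H2].
  split.
  - rewrite <- (is_RInt_unique (V := R_CompleteNormedModule) _ _ _ _ H1). apply abs_RInt_le_const; [exact Hab|eexists; exact H1|].
    intros t Ht. eapply Rle_trans; [apply Rabs_fst_le_Cmod|].
    eapply Rle_trans; [apply Cmod_le_Anorm; exact Hr|auto].
  - rewrite <- (is_RInt_unique (V := R_CompleteNormedModule) _ _ _ _ H2). apply abs_RInt_le_const; [exact Hab|eexists; exact H2|].
    intros t Ht. eapply Rle_trans; [apply Rabs_snd_le_Cmod|].
    eapply Rle_trans; [apply Cmod_le_Anorm; exact Hr|auto].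
Qed.

(** Identities of the real vector space structure hold in each coordinate for Leibniz equality.
    Products must be generalised before the call. *)
Ltac avec := let r := fresh in extensionality r; unfold Aadd, Asub, Aopp, Ascal, Azero; apply injective_projections;
  unfold Cadd, Copp, RCmul, C0, Cre, Cim; simpl; ring.

Lemma Amul_Ascal x a b : mul a (Ascal x b) == Ascal x (mul a b).
Proof. rewrite (Ascal_mul x b), (Ascal_mul x (mul a b)). ring. Qed.

Lemma Amul_Ascal_l x a b : mul (Ascal x a) b == Ascal x (mul a b).
Proof. rewrite (Ascal_mul x a), (Ascal_mul x (mul a b)). ring. Qed.

Lemma Lim_Ascal {T} (F : (T -> Prop) -> Prop) {FF : Filter F} x f v :
  Lim F f v -> Lim F (fun t => Ascal x (f t)) (Ascal x v).
Proof.
  intro H. apply (Lim_ext F (fun t => mul (Ascal x one) (f t)) _ (mul (Ascal x one) v)).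
  - apply filter_forall; intro; symmetry; apply Ascal_mul.
  - symmetry; apply Ascal_mul.
  - apply Lim_Amul; [exact FF|apply Lim_const; exact FF|exact H].
Qed.

Lemma cont2_Asub f g x y : cont2 f x y -> cont2 g x y -> cont2 (fun x y => Asub (f x y) (g x y)) x y.
Proof. intros H1 H2. apply (Lim_Asub (locally (x, y)) _ _ _ _ H1 H2). Qed.

Lemma cont2_Amul f g x y : cont2 f x y -> cont2 g x y -> cont2 (fun x y => mul (f x y) (g x y)) x y.
Proof. intros H1 H2. apply (Lim_Amul (locally (x, y)) _ _ _ _ H1 H2). Qed.

Lemma cont2_const v x y : cont2 (fun _ _ => v) x y.
Proof. apply Lim_const, locally_filter. Qed.

Lemma cont2_Ascal k f x y : cont2 f x y -> cont2 (fun x y => Ascal k (f x y)) x y.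
Proof. intro H. apply (Lim_Ascal (locally (x, y)) _ _ _ H). Qed.

Lemma cont2_shift s t g x y : cont2 g (x + s) (y + t) -> cont2 (fun x y => g (x + s) (y + t)) x y.
Proof.
  rewrite !cont2_iff. intros H eps He. destruct (H eps He) as (de & Hde & Hg).
  exists de; split; [exact Hde|]. intros x' y' Hx Hy.
  apply Hg; [replace (x' + s - (x + s)) with (x' - x) by ring|
             replace (y' + t - (y + t)) with (y' - y) by ring]; assumption.
Qed.

Lemma cont2_shift_x s g x y : cont2 g (x + s) y -> cont2 (fun x y => g (x + s) y) x y.
Proof.
  intro H. replace y with (y + 0) in H by ring. apply cont2_shift in H.
  replace (fun x y => g (x + s) y) with (fun x y => g (x + s) (y + 0)); [exact H|].
  extensionality p; extensionality q; f_equal; ring.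
Qed.

Lemma cont2_shift_y t g x y : cont2 g x (y + t) -> cont2 (fun x y => g x (y + t)) x y.
Proof.
  intro H. replace x with (x + 0) in H by ring. apply cont2_shift in H.
  replace (fun x y => g x (y + t)) with (fun x y => g (x + 0) (y + t)); [exact H|].
  extensionality p; extensionality q; f_equal; ring.
Qed.

Lemma cont1_Asub f g t : cont1 f t -> cont1 g t -> cont1 (fun t => Asub (f t) (g t)) t.
Proof. intros H1 H2. apply (Lim_Asub (locally t) _ _ _ _ H1 H2). Qed.

Lemma cont1_Amul f g t : cont1 f t -> cont1 g t -> cont1 (fun t => mul (f t) (g t)) t.
Proof. intros H1 H2. apply (Lim_Amul (locally t) _ _ _ _ H1 H2). Qed.

Lemma cont1_const v t : cont1 (fun _ => v) t.
Proof. apply Lim_const, locally_filter. Qed.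

(** * Goursat's theorem *)

Section Plane.

Variable e : Alg.

(* The integral of [g (dx + e dy)] along the boundary of [[a, b] x [c, d]]. *)
Definition rect_int (g : R -> R -> Alg) (a b c d : R) : Alg :=
  Asub (AInt (fun y => mul e (Asub (g b y) (g a y))) c d)
       (AInt (fun x => Asub (g x d) (g x c)) a b).

(** Relational like [is_RInt]: integrals combine linearly without integrability side conditions, and
    continuity is invoked only to produce a value. *)
Definition is_rect_int (g : R -> R -> Alg) (a b c d : R) (v : Alg) : Prop :=
  exists v1 v2, is_AInt (fun y => mul e (Asub (g b y) (g a y))) c d v1 /\
    is_AInt (fun x => Asub (g x d) (g x c)) a b v2 /\ v == Asub v1 v2.

Definition on_boundary (a b c d x y : R) : Prop :=
  a <= x <= b /\ c <= y <= d /\ (x = a \/ x = b \/ y = c \/ y = d).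

(** Continuity is asked at boundary points only, because the kernels of Cauchy's formula have a pole
    inside. *)
Definition contB (g : R -> R -> Alg) (a b c d : R) : Prop :=
  forall x y, on_boundary a b c d x y -> cont2 g x y.

Ltac obd := unfold on_boundary; repeat split; try lra; tauto.

Lemma rect_int_unique g a b c d v : is_rect_int g a b c d v -> rect_int g a b c d == v.
Proof.
  intros (v1 & v2 & H1 & H2 & E). unfold rect_int.
  rewrite (AInt_unique _ _ _ _ H1), (AInt_unique _ _ _ _ H2), E. reflexivity.
Qed.

Lemma rect_int_correct g a b c d : a <= b -> c <= d -> contB g a b c d ->
  is_rect_int g a b c d (rect_int g a b c d).
Proof.
  intros Hab Hcd Hg.
  exists (AInt (fun y => mul e (Asub (g b y) (g a y))) c d),
    (AInt (fun x => Asub (g x d) (g x c)) a b).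
  split; [|split; [|reflexivity]].
  - apply AInt_correct; [exact Hcd|]. intros y Hy.
    apply cont1_Amul; [apply cont1_const|].
    apply cont1_Asub; apply cont2_cont1_y, Hg; obd.
  - apply AInt_correct; [exact Hab|]. intros x Hx.
    apply cont1_Asub; [apply (cont2_cont1_x g x d)|apply (cont2_cont1_x g x c)]; apply Hg; obd.
Qed.

Lemma is_rect_int_Asub f g a b c d v w : a <= b -> c <= d ->
  is_rect_int f a b c d v -> is_rect_int g a b c d w ->
  is_rect_int (fun x y => Asub (f x y) (g x y)) a b c d (Asub v w).
Proof.
  intros Hab Hcd (v1 & v2 & H1 & H2 & E) (w1 & w2 & G1 & G2 & E').
  exists (Asub v1 w1), (Asub v2 w2). split; [|split].
  - eapply is_AInt_ext; [exact Hcd| |exact (is_AInt_Asub _ _ _ _ _ _ Hcd H1 G1)].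
    intros t _. cbv beta. ring.
  - eapply is_AInt_ext; [exact Hab| |exact (is_AInt_Asub _ _ _ _ _ _ Hab H2 G2)].
    intros t _. cbv beta. ring.
  - rewrite E, E'. ring.
Qed.

Lemma is_rect_int_Amul k g a b c d v : a <= b -> c <= d ->
  is_rect_int g a b c d v ->
  is_rect_int (fun x y => mul k (g x y)) a b c d (mul k v).
Proof.
  intros Hab Hcd (v1 & v2 & H1 & H2 & E).
  exists (mul k v1), (mul k v2). split; [|split].
  - eapply is_AInt_ext; [exact Hcd| |exact (is_AInt_Amul k _ _ _ _ H1)].
    intros t _. cbv beta. ring.
  - eapply is_AInt_ext; [exact Hab| |exact (is_AInt_Amul k _ _ _ _ H2)].
    intros t _. cbv beta. ring.
  - rewrite E. ring.
Qed.

Lemma is_rect_int_ext f g a b c d v : a <= b -> c <= d ->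
  (forall x y, on_boundary a b c d x y -> f x y == g x y) ->
  is_rect_int f a b c d v -> is_rect_int g a b c d v.
Proof.
  intros Hab Hcd Hfg (v1 & v2 & H1 & H2 & E).
  exists v1, v2. split; [|split; [|exact E]].
  - eapply is_AInt_ext; [exact Hcd| |exact H1].
    intros t Ht. cbv beta. rewrite (Hfg b t), (Hfg a t); [reflexivity|obd|obd].
  - eapply is_AInt_ext; [exact Hab| |exact H2].
    intros t Ht. cbv beta. rewrite (Hfg t c), (Hfg t d); [reflexivity|obd|obd].
Qed.

(** Only differences of [g] between opposite sides enter. The separate bounds serve thin rectangles:
    across the short side the difference is small, along the long side it is merely bounded but is
    multiplied by a short length. *)
Lemma rect_int_diff_bound2 : exists K, K > 0 /\ forall g a b c d M1 M2, a <= b -> c <= d ->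
  contB g a b c d ->
  (forall y, c <= y <= d -> nrm (Asub (g b y) (g a y)) <= M1) ->
  (forall x, a <= x <= b -> nrm (Asub (g x d) (g x c)) <= M2) ->
  nrm (rect_int g a b c d) <= K * (M1 * (d - c) + M2 * (b - a)).
Proof.
  destruct Amul_bounded as (K & HK & Hmul).
  pose proof (Anorm_ge0 n e) as He. pose proof (pos_INR n) as Hn.
  assert (HKe : 0 <= K * nrm e) by (apply Rmult_le_pos; lra).
  exists (2 * INR n * (K * nrm e + 1) + 1). split.
  { assert (0 <= INR n * (K * nrm e)) by (apply Rmult_le_pos; lra). nra. }
  intros g a b c d M1 M2 Hab Hcd Hg H1 H2.
  destruct (rect_int_correct g a b c d Hab Hcd Hg) as (v1 & v2 & I1 & I2 & E).
  rewrite E.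
  assert (HM1 : 0 <= M1) by (eapply Rle_trans; [apply Anorm_ge0|apply (H1 c); lra]).
  assert (HM2 : 0 <= M2) by (eapply Rle_trans; [apply Anorm_ge0|apply (H2 a); lra]).
  assert (B1 : nrm v1 <= 2 * INR n * ((d - c) * (K * (nrm e * M1)))).
  { apply (is_AInt_bound _ _ _ _ _ Hcd I1). intros y Hy.
    eapply Rle_trans; [apply Hmul|]. apply Rmult_le_compat_l; [lra|].
    apply Rmult_le_compat_l; [exact He|auto]. }
  assert (B2 : nrm v2 <= 2 * INR n * ((b - a) * M2)) by (apply (is_AInt_bound _ _ _ _ _ Hab I2); auto).
  eapply Rle_trans; [apply Anorm_Asub|].
  set (p := M1 * (d - c)). set (q := M2 * (b - a)).
  assert (Hp : 0 <= p) by (apply Rmult_le_pos; lra).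
  assert (Hq : 0 <= q) by (apply Rmult_le_pos; lra).
  replace (2 * INR n * ((d - c) * (K * (nrm e * M1)))) with (2 * (INR n * ((K * nrm e) * p)))
    in B1 by (unfold p; ring).
  replace (2 * INR n * ((b - a) * M2)) with (2 * (INR n * q)) in B2 by (unfold q; ring).
  assert (0 <= INR n * p) by (apply Rmult_le_pos; lra).
  assert (0 <= INR n * ((K * nrm e) * q)) by (repeat apply Rmult_le_pos; lra).
  lra.
Qed.

Lemma rect_int_diff_bound : exists K, K > 0 /\ forall g a b c d M, a <= b -> c <= d ->
  contB g a b c d ->
  (forall y, c <= y <= d -> nrm (Asub (g b y) (g a y)) <= M) ->
  (forall x, a <= x <= b -> nrm (Asub (g x d) (g x c)) <= M) ->
  nrm (rect_int g a b c d) <= K * (M * ((b - a) + (d - c))).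
Proof.
  destruct rect_int_diff_bound2 as (K & HK & H). exists K; split; [exact HK|].
  intros g a b c d M Hab Hcd Hg H1 H2.
  replace (M * (b - a + (d - c))) with (M * (d - c) + M * (b - a)) by ring. auto.
Qed.

Lemma rect_int_bound : exists K, K > 0 /\ forall g a b c d M, a <= b -> c <= d ->
  contB g a b c d ->
  (forall x y, on_boundary a b c d x y -> nrm (g x y) <= M) ->
  nrm (rect_int g a b c d) <= K * (M * ((b - a) + (d - c))).
Proof.
  destruct rect_int_diff_bound as (K & HK & H). exists (2 * K); split; [lra|].
  intros g a b c d M Hab Hcd Hg HM.
  replace (2 * K * (M * (b - a + (d - c)))) with (K * (2 * M * (b - a + (d - c)))) by ring.
  apply H; auto.
  - intros y Hy. eapply Rle_trans; [apply Anorm_Asub|].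
    assert (nrm (g b y) <= M) by (apply HM; obd). assert (nrm (g a y) <= M) by (apply HM; obd). lra.
  - intros x Hx. eapply Rle_trans; [apply Anorm_Asub|].
    assert (nrm (g x d) <= M) by (apply HM; obd). assert (nrm (g x c) <= M) by (apply HM; obd). lra.
Qed.

Lemma rect_int_split_x g a x b c d : a <= x <= b -> c <= d ->
  contB g a x c d -> contB g x b c d ->
  rect_int g a b c d == Aadd (rect_int g a x c d) (rect_int g x b c d).
Proof.
  intros Hx Hcd H1 H2.
  destruct (rect_int_correct g a x c d ltac:(lra) Hcd H1) as (v1 & v2 & I1 & I2 & E).
  destruct (rect_int_correct g x b c d ltac:(lra) Hcd H2) as (w1 & w2 & I3 & I4 & E').
  rewrite (rect_int_unique g a b c d (Asub (Aadd v1 w1) (Aadd v2 w2))).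
  - rewrite E, E'. ring.
  - exists (Aadd v1 w1), (Aadd v2 w2). split; [|split; [|reflexivity]].
    + eapply is_AInt_ext; [exact Hcd| |exact (is_AInt_Aadd _ _ _ _ _ _ I1 I3)].
      intros t _. cbv beta. ring.
    + exact (is_AInt_Chasles _ _ _ _ _ _ I2 I4).
Qed.

Lemma rect_int_split_y g a b c y d : a <= b -> c <= y <= d ->
  contB g a b c y -> contB g a b y d ->
  rect_int g a b c d == Aadd (rect_int g a b c y) (rect_int g a b y d).
Proof.
  intros Hab Hy H1 H2.
  destruct (rect_int_correct g a b c y Hab ltac:(lra) H1) as (v1 & v2 & I1 & I2 & E).
  destruct (rect_int_correct g a b y d Hab ltac:(lra) H2) as (w1 & w2 & I3 & I4 & E').
  rewrite (rect_int_unique g a b c d (Asub (Aadd v1 w1) (Aadd v2 w2))).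
  - rewrite E, E'. ring.
  - exists (Aadd v1 w1), (Aadd v2 w2). split; [|split; [|reflexivity]].
    + exact (is_AInt_Chasles _ _ _ _ _ _ I1 I3).
    + eapply is_AInt_ext; [exact Hab| |exact (is_AInt_Aadd _ _ _ _ _ _ I2 I4)].
      intros t _. cbv beta. ring.
Qed.

(** The function [w k] with [w = x + y e], that is, the model with constant derivative [k]. For
    [k = 1] it is the variable [w] itself. *)
Definition lin (k : Alg) (x y : R) : Alg := Aadd (Ascal x k) (Ascal y (mul e k)).

Lemma is_rect_int_lin k a b c d : a <= b -> c <= d -> is_rect_int (lin k) a b c d Azero.
Proof.
  intros Hab Hcd.
  exists (Ascal (d - c) (mul e (Ascal (b - a) k))), (Ascal (b - a) (Ascal (d - c) (mul e k))).
  split; [|split].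
  - eapply is_AInt_ext; [exact Hcd| |apply is_AInt_const].
    intros y _. cbv beta.
    replace (Asub (lin k b y) (lin k a y)) with (Ascal (b - a) k); [reflexivity|].
    unfold lin. generalize (mul e k); intro. avec.
  - eapply is_AInt_ext; [exact Hab| |apply is_AInt_const].
    intros x _. cbv beta.
    replace (Asub (lin k x d) (lin k x c)) with (Ascal (d - c) (mul e k)); [reflexivity|].
    unfold lin. generalize (mul e k); intro. avec.
  - rewrite Amul_Ascal. generalize (mul e k); intro k'.
    replace (Asub (Ascal (d - c) (Ascal (b - a) k')) (Ascal (b - a) (Ascal (d - c) k')))
      with Azero; [reflexivity|]. avec.
Qed.

(* [k] is the common value of the difference quotients along [1] and, up to the factor [e],
   along [e]: the Cauchy-Riemann condition. *)
Definition hasder (g : R -> R -> Alg) (x y : R) (k : Alg) : Prop :=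
  Lim (locally' 0) (fun t => Ascal (/ t) (Asub (g (x + t) y) (g x y))) k /\
  Lim (locally' 0) (fun t => Ascal (/ t) (Asub (g x (y + t)) (g x y))) (mul e k).

Lemma Lim_locally'_iff f v : Lim (locally' 0) f v <-> forall eps, eps > 0 ->
  exists de, de > 0 /\ forall t, t <> 0 -> Rabs t < de -> nrm (Asub (f t) v) < eps.
Proof.
  split.
  - intros H eps He. destruct (H eps He) as (d & Hd). exists d; split; [apply cond_pos|].
    intros t Ht Hlt. apply Hd; [|exact Ht]. unfold ball; simpl; unfold AbsRing_ball; simpl.
    unfold abs, minus, plus, opp; simpl. rewrite Ropp_0, Rplus_0_r. exact Hlt.
  - intros H eps He. destruct (H eps He) as (d & Hd0 & Hd).
    exists (mkposreal d Hd0). intros t Ht Hn. apply Hd; [exact Hn|].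
    unfold ball in Ht; simpl in Ht; unfold AbsRing_ball in Ht; simpl in Ht.
    unfold abs, minus, plus, opp in Ht; simpl in Ht. rewrite Ropp_0, Rplus_0_r in Ht. exact Ht.
Qed.

Lemma cont2_lin k x y : cont2 (lin k) x y.
Proof.
  rewrite cont2_iff. intros eps Heps.
  set (M := nrm k + nrm (mul e k) + 1).
  pose proof (Anorm_ge0 n k); pose proof (Anorm_ge0 n (mul e k)).
  assert (HM : M > 0) by (unfold M; lra).
  exists (eps / M / 2). split; [apply Rdiv_lt_0_compat; [apply Rdiv_lt_0_compat; lra|lra]|].
  intros x' y' H1 H2.
  replace (Asub (lin k x' y') (lin k x y)) with
    (Aadd (Ascal (x' - x) k) (Ascal (y' - y) (mul e k)))
    by (unfold lin; generalize (mul e k); intros; avec).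
  eapply Rle_lt_trans; [apply Anorm_Aadd|]. rewrite !Anorm_Ascal.
  apply Rle_lt_trans with (eps / M / 2 * nrm k + eps / M / 2 * nrm (mul e k)).
  - apply Rplus_le_compat; apply Rmult_le_compat_r; auto.
  - assert (EM : eps / M / 2 * M = eps / 2) by (field; lra).
    assert (0 < eps / M / 2) by (apply Rdiv_lt_0_compat; [apply Rdiv_lt_0_compat; lra|lra]).
    unfold M at 2 in EM. nra.
Qed.

(* Baire's theorem applied to the sets on which the difference quotients at scales below a
   fixed threshold agree up to [e1]: on a portion of [P] they are close to one constant [k],
   so that [g - lin k] is Lipschitz with a small constant along axis-parallel segments
   issuing from [P]. *)
Lemma portion_estimate g A B C D mu eta (P : R -> R -> Prop) :
  mu > 0 -> eta > 0 ->
  (forall x y, A - mu <= x <= B + mu -> C - mu <= y <= D + mu -> cont2 g x y) ->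
  (forall x y, A <= x <= B -> C <= y <= D -> exists k, hasder g x y k) ->
  (forall x y, P x y -> A <= x <= B /\ C <= y <= D) -> closed2 P ->
  (exists x y, P x y) ->
  exists x0 y0 delta, P x0 y0 /\ delta > 0 /\
    forall a b c d, subrect A B C D a b c d ->
      x0 - delta <= a -> b <= x0 + delta -> y0 - delta <= c -> d <= y0 + delta ->
      (exists y, c <= y <= d /\ P a y) -> (exists y, c <= y <= d /\ P b y) ->
      (exists x, a <= x <= b /\ P x c) -> (exists x, a <= x <= b /\ P x d) ->
      nrm (rect_int g a b c d) <= eta * ((b - a) + (d - c)) ^ 2.
Proof.
  intros Hmu Heta Hc Hd HP Hcl Hne.
  destruct rect_int_diff_bound as (KJ & HKJ & HJ).
  destruct Amul_bounded as (K & HK & Hmul).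
  pose proof (Anorm_ge0 n e) as He0.
  (* [L * e1] will be the Lipschitz constant of [g - lin k]: two errors in comparing quotients, and
     one more multiplied by [e]. The 3 in [e1] counts the segments parallel to one axis in the
     four-segment paths used at the end. *)
  set (L := 2 + K * nrm e). assert (HL : L >= 2) by (unfold L; nra).
  set (e1 := eta / (KJ * 3 * L)).
  assert (He1 : e1 > 0) by (apply Rdiv_lt_0_compat; nra).
  assert (Eeta : KJ * (3 * (L * e1)) = eta) by (unfold e1; field; lra).
  pose (Dx t x y := Asub (g (x + t) y) (g x y)).
  pose (Dy t x y := Asub (g x (y + t)) (g x y)).
  pose (rad N := mu / INR (S N)).
  assert (Hrad : forall N, 0 < rad N <= mu).
  { intro N. assert (HN : 0 < INR (S N)) by (apply lt_0_INR; lia).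
    assert (HN1 : 1 <= INR (S N)) by (rewrite S_INR; pose proof (pos_INR N); lra).
    unfold rad; split; [apply Rdiv_lt_0_compat; lra|].
    apply Rmult_le_reg_r with (INR (S N)); [lra|]. unfold Rdiv.
    rewrite Rmult_assoc, Rinv_l by lra. nra. }
  (* Differences of two quotients multiplied by [s * t]: horizontal at scale [s] against horizontal
     at [t], and vertical at [t] against [e] times horizontal at [s]. For fixed [s] and [t] these
     are continuous in the point, so failing the bound is an open condition. *)
  pose (Hx s t x y := Asub (Ascal t (Dx s x y)) (Ascal s (Dx t x y))).
  pose (Hy s t x y := Asub (Ascal s (Dy t x y)) (Ascal t (mul e (Dx s x y)))).
  pose (Aset N x y := forall s t, 0 < Rabs s < rad N -> 0 < Rabs t < rad N ->
    nrm (Hx s t x y) <= e1 * (Rabs s * Rabs t) /\ nrm (Hy s t x y) <= e1 * (Rabs s * Rabs t)).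
  assert (HcDx : forall t x y, A <= x <= B -> C <= y <= D -> Rabs t < mu -> cont2 (Dx t) x y).
  { intros t x y Hxx Hyy Ht. apply Rabs_def2 in Ht. apply cont2_Asub; [|apply Hc; lra].
    apply cont2_shift_x, Hc; lra. }
  assert (HcDy : forall t x y, A <= x <= B -> C <= y <= D -> Rabs t < mu -> cont2 (Dy t) x y).
  { intros t x y Hxx Hyy Ht. apply Rabs_def2 in Ht. apply cont2_Asub; [|apply Hc; lra].
    apply cont2_shift_y, Hc; lra. }
  assert (Hopen_norm : forall H x y M, cont2 H x y -> nrm (H x y) > M -> exists de, de > 0 /\
     forall x' y', Rabs (x' - x) <= de -> Rabs (y' - y) <= de -> nrm (H x' y') > M).
  { intros H x y M HH HM. rewrite cont2_iff in HH.
    destruct (HH (nrm (H x y) - M) ltac:(lra)) as (de & Hde & Hlt).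
    exists de; split; [exact Hde|]. intros x' y' H1 H2. specialize (Hlt x' y' H1 H2).
    assert (T : nrm (H x y) <= nrm (H x' y') + nrm (Asub (H x' y') (H x y))).
    { rewrite (Anorm_ext n (H x y) (Asub (H x' y') (Asub (H x' y') (H x y)))) by ring.
      apply Anorm_Asub. }
    lra. }
  assert (HB : exists N x y de, P x y /\ de > 0 /\
    forall x' y', P x' y' -> Rabs (x' - x) <= de -> Rabs (y' - y) <= de -> Aset N x' y').
  { apply baire_plane; [exact Hcl|exact Hne| |].
    - intros N x y Hp Hn. destruct (HP x y Hp) as [Hxx Hyy].
      assert (Hex : exists s t, (0 < Rabs s < rad N /\ 0 < Rabs t < rad N) /\
         (nrm (Hx s t x y) > e1 * (Rabs s * Rabs t) \/ nrm (Hy s t x y) > e1 * (Rabs s * Rabs t))).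
      { apply NNPP; intro HN. apply Hn. intros s t Hs Ht.
        split; apply Rnot_lt_le; intro; apply HN; exists s, t; auto. }
      destruct Hex as (s & t & [Hs Ht] & Hor). specialize (Hrad N).
      assert (Hop : exists de, de > 0 /\
        forall x' y', Rabs (x' - x) <= de -> Rabs (y' - y) <= de ->
         (nrm (Hx s t x' y') > e1 * (Rabs s * Rabs t) \/ nrm (Hy s t x' y') > e1 * (Rabs s * Rabs t))).
      { destruct Hor as [Ho|Ho].
        - destruct (Hopen_norm (Hx s t) x y (e1 * (Rabs s * Rabs t))) as (de & Hde & H); auto.
          + apply cont2_Asub; apply cont2_Ascal, HcDx; lra.
          + exists de; split; [exact Hde|]; intros; left; auto.
        - destruct (Hopen_norm (Hy s t) x y (e1 * (Rabs s * Rabs t))) as (de & Hde & H); auto.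
          + apply cont2_Asub; apply cont2_Ascal; [apply HcDy; lra|].
            apply cont2_Amul; [apply cont2_const|apply HcDx; lra].
          + exists de; split; [exact Hde|]; intros; right; auto. }
      destruct Hop as (de & Hde & H). exists de; split; [exact Hde|].
      intros x' y' H1 H2 HA. destruct (HA s t Hs Ht). destruct (H x' y' H1 H2); lra.
    - intros x y Hp. destruct (HP x y Hp) as [Hxx Hyy]. destruct (Hd x y Hxx Hyy) as (k & Hkx & Hky).
      assert (He1' : e1 / L > 0) by (apply Rdiv_lt_0_compat; lra).
      assert (EL : L * (e1 / L) = e1) by (field; lra).
      rewrite Lim_locally'_iff in Hkx, Hky.
      destruct (Hkx _ He1') as (d1 & Hd1 & Q1). destruct (Hky _ He1') as (d2 & Hd2 & Q2).
      assert (Hdm : 0 < Rmin d1 d2) by (apply Rmin_glb_lt; lra).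
      destruct (archimed_cor1 (Rmin d1 d2 / mu)) as (N & HN & HN0);
        [apply Rdiv_lt_0_compat; lra|].
      (* [rad] divides by [INR (S N)], hence the predecessor. *)
      exists (pred N). intros s t [Hs0 Hs] [Ht0 Ht].
      assert (HradN : rad (pred N) < Rmin d1 d2).
      { unfold rad. rewrite Nat.succ_pred_pos by exact HN0.
        apply (Rmult_lt_compat_r mu) in HN; [|lra]. unfold Rdiv in *.
        rewrite Rmult_assoc, Rinv_l in HN by lra. lra. }
      pose proof (Rmin_l d1 d2); pose proof (Rmin_r d1 d2).
      assert (Hsn : s <> 0) by (intro Z; rewrite Z, Rabs_R0 in Hs0; lra).
      assert (Htn : t <> 0) by (intro Z; rewrite Z, Rabs_R0 in Ht0; lra).
      assert (A1 := Q1 s Hsn ltac:(lra)). assert (A2 := Q1 t Htn ltac:(lra)).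
      assert (A3 := Q2 t Htn ltac:(lra)).
      fold (Dx s x y) in A1. fold (Dx t x y) in A2. fold (Dy t x y) in A3.
      set (p1 := Asub (Ascal (/ s) (Dx s x y)) k) in *.
      set (p2 := Asub (Ascal (/ t) (Dx t x y)) k) in *.
      set (p3 := Asub (Ascal (/ t) (Dy t x y)) (mul e k)) in *.
      assert (Hst : 0 < Rabs s * Rabs t) by nra.
      split.
      + replace (Hx s t x y) with (Ascal (s * t) (Asub p1 p2)).
        2:{ unfold Hx, p1, p2. generalize (Dx s x y), (Dx t x y); intros.
            extensionality r; unfold Asub, Ascal; apply injective_projections;
            unfold Cadd, Copp, RCmul, Cre, Cim; simpl; field; auto. }
        rewrite Anorm_Ascal, Rabs_mult.
        assert (nrm (Asub p1 p2) <= 2 * (e1 / L)).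
        { eapply Rle_trans; [apply Anorm_Asub|lra]. }
        assert (nrm (Asub p1 p2) <= e1) by nra. nra.
      + rewrite (Anorm_ext n _ (Ascal (s * t) (Asub p3 (mul e p1)))).
        2:{ assert (E3 : Ascal t (mul e (Dx s x y)) ==
                Aadd (Ascal (s * t) (mul e p1)) (Ascal (s * t) (mul e k))).
            { rewrite <- !Amul_Ascal.
              replace (Ascal t (Dx s x y)) with (Aadd (Ascal (s * t) p1) (Ascal (s * t) k)); [ring|].
              unfold p1. generalize (Dx s x y); intros.
              extensionality r; unfold Asub, Ascal, Aadd; apply injective_projections;
              unfold Cadd, Copp, RCmul, Cre, Cim; simpl; field; auto. }
            unfold Hy. rewrite E3. unfold p3. generalize (Dy t x y), (mul e k), (mul e p1); intros.
            replace (Asub (Ascal s a) (Aadd (Ascal (s * t) a1) (Ascal (s * t) a0))) with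
              (Ascal (s * t) (Asub (Asub (Ascal (/ t) a) a0) a1)); [reflexivity|].
            extensionality r; unfold Asub, Ascal, Aadd; apply injective_projections;
            unfold Cadd, Copp, RCmul, Cre, Cim; simpl; field; auto. }
        rewrite Anorm_Ascal, Rabs_mult.
        assert (nrm (Asub p3 (mul e p1)) <= L * (e1 / L)).
        { eapply Rle_trans; [apply Anorm_Asub|].
          assert (Hm := Hmul e p1). pose proof (Anorm_ge0 n p1) as Hp1.
          assert (Hep : nrm e * nrm p1 <= nrm e * (e1 / L)) by (apply Rmult_le_compat_l; lra).
          apply (Rmult_le_compat_l K) in Hep; [|lra].
          set (w := e1 / L) in *. replace (L * w) with (2 * w + K * (nrm e * w)) by (unfold L; ring).
          lra. }
        rewrite EL in *. nra. }
  destruct HB as (N & x0 & y0 & d1 & HP0 & Hd1 & HA).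
  destruct (HP _ _ HP0) as [Hx0 Hy0].
  destruct (Hrad N) as [Hr0 Hrmu].
  (* One fixed scale [s0] serves as reference. Its quotient at [(x0, y0)] is the constant [k];
     continuity keeps the quotient at scale [s0] within [e1] of [k] nearby, and membership in [Aset]
     compares all smaller scales with it. *)
  set (s0 := rad N / 2). assert (Hs0 : 0 < s0) by (unfold s0; lra).
  assert (Hs0r : rad N = 2 * s0) by (unfold s0; field).
  assert (Hs0a : Rabs s0 = s0) by (apply Rabs_pos_eq; lra).
  set (D0 := Dx s0 x0 y0).
  assert (HcD := HcDx s0 x0 y0 Hx0 Hy0 ltac:(lra)). rewrite cont2_iff in HcD.
  destruct (HcD (e1 * s0) ltac:(nra)) as (d2 & Hd2 & HD0). fold D0 in HD0.
  set (k := Ascal (/ s0) D0).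
  pose (G x y := Asub (g x y) (lin k x y)).
  (* With [delta <= s0 / 2] two points of the square differ by at most [s0 < rad N] in each
     coordinate, so that [HLip] applies to them. *)
  set (delta := Rmin (Rmin d1 d2) (s0 / 2)).
  assert (Hdelta : 0 < delta) by (repeat apply Rmin_glb_lt; lra).
  assert (Hdd1 : delta <= d1) by (eapply Rle_trans; [apply Rmin_l|apply Rmin_l]).
  assert (Hdd2 : delta <= d2) by (eapply Rle_trans; [apply Rmin_l|apply Rmin_r]).
  assert (Hdd3 : delta <= s0 / 2) by apply Rmin_r.
  exists x0, y0, delta. split; [exact HP0|]. split; [exact Hdelta|].
  assert (HLip : forall x y t, P x y -> Rabs (x - x0) <= delta -> Rabs (y - y0) <= delta ->
     Rabs t < rad N ->
     nrm (Asub (G (x + t) y) (G x y)) <= L * e1 * Rabs t /\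
     nrm (Asub (G x (y + t)) (G x y)) <= L * e1 * Rabs t).
  { intros x y t Hp Hxx Hyy Ht.
    assert (EGx : Asub (G (x + t) y) (G x y) = Asub (Dx t x y) (Ascal t k)).
    { unfold G, Dx, lin. generalize (g (x + t) y), (g x y), (mul e k); intros. avec. }
    assert (EGy : Asub (G x (y + t)) (G x y) = Asub (Dy t x y) (Ascal t (mul e k))).
    { unfold G, Dy, lin. generalize (g x (y + t)), (g x y), (mul e k); intros. avec. }
    rewrite EGx, EGy.
    destruct (Req_dec t 0) as [->|Htn].
    { unfold Dx, Dy. rewrite !Rplus_0_r, Rabs_R0, Rmult_0_r.
      generalize (mul e k), (g x y); intros a b.
      replace (Asub (Asub b b) (Ascal 0 k)) with Azero by avec.
      replace (Asub (Asub b b) (Ascal 0 a)) with Azero by avec.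
      rewrite Anorm_Azero; lra. }
    assert (Ht0 := Rabs_pos_lt _ Htn).
    destruct (HA x y Hp ltac:(lra) ltac:(lra) s0 t ltac:(lra) ltac:(lra)) as [B1 B2].
    rewrite Hs0a in B1, B2.
    specialize (HD0 x y ltac:(lra) ltac:(lra)).
    set (q := Asub (Dx s0 x y) D0) in *.
    pose proof (Anorm_ge0 n q) as Hq0.
    split.
    - replace (Asub (Dx t x y) (Ascal t k)) with
        (Ascal (/ s0) (Aadd (Aopp (Hx s0 t x y)) (Ascal t q))).
      2:{ unfold Hx, q, k. generalize (Dx t x y), (Dx s0 x y); intros.
          extensionality r; unfold Asub, Ascal, Aadd, Aopp; apply injective_projections;
          unfold Cadd, Copp, RCmul, Cre, Cim; simpl; field; lra. }
      rewrite Anorm_Ascal, Rabs_inv, Hs0a.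
      apply Rmult_le_reg_l with s0; [exact Hs0|].
      rewrite <- Rmult_assoc, Rinv_r, Rmult_1_l by lra.
      eapply Rle_trans; [apply Anorm_Aadd|]. rewrite Anorm_Aopp, Anorm_Ascal.
      assert (Rabs t * nrm q <= Rabs t * (e1 * s0)) by (apply Rmult_le_compat_l; lra).
      assert (0 <= e1 * (s0 * Rabs t)) by (apply Rmult_le_pos; nra).
      replace (s0 * (L * e1 * Rabs t)) with (L * (e1 * (s0 * Rabs t))) by ring.
      apply Rle_trans with (2 * (e1 * (s0 * Rabs t))); [lra|].
      apply Rmult_le_compat_r; lra.
    - rewrite (Anorm_ext n _ (Ascal (/ s0) (Aadd (Hy s0 t x y) (Ascal t (mul e q))))).
      2:{ assert (E3 : mul e q == Asub (mul e (Dx s0 x y)) (Ascal s0 (mul e k))).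
          { rewrite <- Amul_Ascal. unfold q.
            replace (Ascal s0 k) with D0; [ring|]. unfold k.
            extensionality r; unfold Ascal; apply injective_projections;
            unfold RCmul, Cre, Cim; simpl; field; lra. }
          rewrite E3. unfold Hy. generalize (Dy t x y), (mul e k), (mul e (Dx s0 x y)); intros.
          match goal with |- ?a == ?b => replace b with a; [reflexivity|] end.
          extensionality r; unfold Asub, Ascal, Aadd, Aopp; apply injective_projections;
          unfold Cadd, Copp, RCmul, Cre, Cim; simpl; field; lra. }
      rewrite Anorm_Ascal, Rabs_inv, Hs0a.
      apply Rmult_le_reg_l with s0; [exact Hs0|].
      rewrite <- Rmult_assoc, Rinv_r, Rmult_1_l by lra.
      eapply Rle_trans; [apply Anorm_Aadd|]. rewrite Anorm_Ascal.
      assert (Hm := Hmul e q).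
      assert (nrm (mul e q) <= K * (nrm e * (e1 * s0))).
      { eapply Rle_trans; [exact Hm|]. apply Rmult_le_compat_l; [lra|].
        apply Rmult_le_compat_l; lra. }
      assert (Rabs t * nrm (mul e q) <= Rabs t * (K * (nrm e * (e1 * s0))))
        by (apply Rmult_le_compat_l; lra).
      assert (0 <= e1 * (s0 * Rabs t)) by (apply Rmult_le_pos; nra).
      replace (s0 * (L * e1 * Rabs t)) with (L * (e1 * (s0 * Rabs t))) by ring.
      replace (Rabs t * (K * (nrm e * (e1 * s0)))) with ((K * nrm e) * (e1 * (s0 * Rabs t))) in * by ring.
      unfold L. lra. }
  assert (Hhor : forall x y x', P x y -> Rabs (x - x0) <= delta -> Rabs (y - y0) <= delta ->
     Rabs (x' - x0) <= delta -> nrm (Asub (G x' y) (G x y)) <= L * e1 * Rabs (x' - x)).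
  { intros x y x' Hp H1 H2 H3.
    destruct (HLip x y (x' - x) Hp H1 H2) as [H _].
    - apply Rabs_le_between in H1; apply Rabs_le_between in H3. apply Rabs_def1; lra.
    - replace (x + (x' - x)) with x' in H by ring. exact H. }
  assert (Hver : forall x y y', P x y -> Rabs (x - x0) <= delta -> Rabs (y - y0) <= delta ->
     Rabs (y' - y0) <= delta -> nrm (Asub (G x y') (G x y)) <= L * e1 * Rabs (y' - y)).
  { intros x y y' Hp H1 H2 H3.
    destruct (HLip x y (y' - y) Hp H1 H2) as [_ H].
    - apply Rabs_le_between in H2; apply Rabs_le_between in H3. apply Rabs_def1; lra.
    - replace (y + (y' - y)) with y' in H by ring. exact H. }
  intros a b c d Hsub Ha Hb Hc' Hd' (ya & Hya & Pa) (yb & Hyb & Pb) (xc & Hxc & Pc) (xd & Hxd & Pd).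
  unfold subrect in Hsub.
  assert (HcB : contB g a b c d) by (intros x y (H1 & H2 & _); apply Hc; lra).
  assert (HLe : 0 < L * e1) by nra.
  (* Passing from [g] to [G] changes nothing, as the integral of [lin k] is zero. *)
  assert (HG : rect_int g a b c d == rect_int G a b c d).
  { symmetry. apply rect_int_unique.
    destruct (is_rect_int_Asub g (lin k) a b c d _ _ ltac:(lra) ltac:(lra)
      (rect_int_correct g a b c d ltac:(lra) ltac:(lra) HcB)
      (is_rect_int_lin k a b c d ltac:(lra) ltac:(lra))) as (v1 & v2 & I1 & I2 & E).
    exists v1, v2. split; [exact I1|]. split; [exact I2|]. rewrite <- E. ring. }
  assert (HcBG : contB G a b c d).
  { intros x y Hb'. apply cont2_Asub; [apply HcB, Hb'|apply cont2_lin]. }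
  assert (Hbox : forall x, a <= x <= b -> Rabs (x - x0) <= delta) by (intros; apply Rabs_le; lra).
  assert (Hboy : forall y, c <= y <= d -> Rabs (y - y0) <= delta) by (intros; apply Rabs_le; lra).
  assert (Habs : forall p q lo hi, lo <= p <= hi -> lo <= q <= hi -> Rabs (p - q) <= hi - lo)
    by (intros; apply Rabs_le; lra).
  assert (Hw0 : 0 <= L * e1 * (b - a)) by (apply Rmult_le_pos; lra).
  assert (Hh0 : 0 <= L * e1 * (d - c)) by (apply Rmult_le_pos; lra).
  rewrite HG.
  replace (eta * (b - a + (d - c)) ^ 2) with
    (KJ * ((3 * (L * e1) * (b - a + (d - c))) * (b - a + (d - c)))) by (rewrite <- Eeta; ring).
  apply HJ; [lra|lra|exact HcBG| |].
  (* The path [(b, y)], [(b, yb)], [(a, yb)], [(a, ya)], [(a, y)]: the first two segments end at the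
     point [(b, yb)] of [P], the last two at [(a, ya)]. Only such segments are controlled, which is
     why every side must meet [P]. *)
  - intros y Hyy.
    assert (T1 := Hver b yb y Pb (Hbox b ltac:(lra)) (Hboy yb Hyb) (Hboy y Hyy)).
    assert (T2 := Hhor b yb a Pb (Hbox b ltac:(lra)) (Hboy yb Hyb) (Hbox a ltac:(lra))).
    assert (T3 := Hver a ya yb Pa (Hbox a ltac:(lra)) (Hboy ya Hya) (Hboy yb Hyb)).
    assert (T4 := Hver a ya y Pa (Hbox a ltac:(lra)) (Hboy ya Hya) (Hboy y Hyy)).
    assert (R1 := Habs y yb c d Hyy Hyb). assert (R2 := Habs a b a b ltac:(lra) ltac:(lra)).
    assert (R3 := Habs yb ya c d Hyb Hya). assert (R4 := Habs y ya c d Hyy Hya).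
    apply (Rmult_le_compat_l (L * e1)) in R1, R2, R3, R4; try lra.
    rewrite Anorm_sub_sym in T2, T4.
    eapply Rle_trans; [apply (Anorm_sub_triang n _ (G b yb))|].
    eapply Rle_trans; [apply Rplus_le_compat_l, (Anorm_sub_triang n _ (G a yb))|].
    eapply Rle_trans; [apply Rplus_le_compat_l, Rplus_le_compat_l, (Anorm_sub_triang n _ (G a ya))|].
    lra.
  - intros x Hxx.
    assert (T1 := Hhor xd d x Pd (Hbox xd Hxd) (Hboy d ltac:(lra)) (Hbox x Hxx)).
    assert (T2 := Hver xd d c Pd (Hbox xd Hxd) (Hboy d ltac:(lra)) (Hboy c ltac:(lra))).
    assert (T3 := Hhor xc c xd Pc (Hbox xc Hxc) (Hboy c ltac:(lra)) (Hbox xd Hxd)).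
    assert (T4 := Hhor xc c x Pc (Hbox xc Hxc) (Hboy c ltac:(lra)) (Hbox x Hxx)).
    assert (R1 := Habs x xd a b Hxx Hxd). assert (R2 := Habs c d c d ltac:(lra) ltac:(lra)).
    assert (R3 := Habs xd xc a b Hxd Hxc). assert (R4 := Habs x xc a b Hxx Hxc).
    apply (Rmult_le_compat_l (L * e1)) in R1, R2, R3, R4; try lra.
    rewrite Anorm_sub_sym in T2, T4.
    eapply Rle_trans; [apply (Anorm_sub_triang n _ (G xd d))|].
    eapply Rle_trans; [apply Rplus_le_compat_l, (Anorm_sub_triang n _ (G xd c))|].
    eapply Rle_trans; [apply Rplus_le_compat_l, Rplus_le_compat_l, (Anorm_sub_triang n _ (G xc c))|].
    lra.
Qed.

Definition open2 (U : R -> R -> Prop) : Prop :=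
  forall x y, U x y -> exists de, de > 0 /\
    forall x' y', Rabs (x' - x) <= de -> Rabs (y' - y) <= de -> U x' y'.

Lemma open2_margin U a b c d : open2 U -> a <= b -> c <= d ->
  (forall x y, a <= x <= b -> c <= y <= d -> U x y) ->
  exists mu, mu > 0 /\ forall x y, a - mu <= x <= b + mu -> c - mu <= y <= d + mu -> U x y.
Proof.
  intros HU Hab Hcd Hin.
  destruct (uniform_on_rectangle (fun x y de =>
    forall x' y', Rabs (x' - x) <= de -> Rabs (y' - y) <= de -> U x' y') a b c d)
    as (mu & Hmu & H); auto.
  - intros x y de de' Hde HQ x' y' H1 H2. apply HQ; lra.
  - intros x y Hx Hy. destruct (HU x y (Hin x y Hx Hy)) as (de & Hde & H).
    exists (de / 2); split; [lra|]. intros x' y' _ _ H1 H2 x'' y'' H3 H4.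
    apply H; [replace (x'' - x) with ((x'' - x') + (x' - x)) by ring|
              replace (y'' - y) with ((y'' - y') + (y' - y)) by ring];
      (eapply Rle_trans; [apply Rabs_triang|lra]).
  - exists mu; split; [exact Hmu|]. intros x y Hx Hy.
    (* The nearest point of the rectangle, by clamping each coordinate. *)
    apply (H (Rmax a (Rmin x b)) (Rmax c (Rmin y d)));
    unfold Rmax, Rmin; repeat destruct Rle_dec; try lra; apply Rabs_le; lra.
Qed.

Lemma cont2_bounded g a b c d : a <= b -> c <= d ->
  (forall x y, a <= x <= b -> c <= y <= d -> cont2 g x y) ->
  exists M, M > 0 /\ forall x y, a <= x <= b -> c <= y <= d -> nrm (g x y) <= M.
Proof.
  intros Hab Hcd Hc.
  destruct (uniform_on_rectangle (fun x y de => nrm (g x y) * de <= 1) a b c d)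
    as (de & Hde & H); auto.
  - intros x y de de' Hde H. pose proof (Anorm_ge0 n (g x y)). nra.
  - intros x y Hx Hy. assert (H := Hc x y Hx Hy). rewrite cont2_iff in H.
    destruct (H 1 Rlt_0_1) as (de & Hde & Hg).
    pose proof (Anorm_ge0 n (g x y)) as H0.
    set (e0 := / (1 + nrm (g x y))).
    assert (He0 : 0 < e0) by (apply Rinv_0_lt_compat; lra).
    assert (E : (1 + nrm (g x y)) * e0 = 1) by (unfold e0; field; lra).
    exists (Rmin de e0); split; [apply Rmin_glb_lt; lra|].
    pose proof (Rmin_l de e0); pose proof (Rmin_r de e0).
    intros x' y' _ _ Hx' Hy'. specialize (Hg x' y' ltac:(lra) ltac:(lra)).
    assert (nrm (g x' y') <= 1 + nrm (g x y)).
    { rewrite (Anorm_ext n (g x' y') (Aadd (Asub (g x' y') (g x y)) (g x y))) by ring.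
      eapply Rle_trans; [apply Anorm_Aadd|lra]. }
    assert (0 < Rmin de e0) by (apply Rmin_glb_lt; lra).
    apply Rle_trans with ((1 + nrm (g x y)) * e0); [|lra].
    apply Rmult_le_compat; try lra. apply Anorm_ge0.
  - exists (/ de); split; [apply Rinv_0_lt_compat; lra|]. intros x y Hx Hy.
    specialize (H x y Hx Hy). apply (Rmult_le_reg_r de); [lra|]. rewrite Rinv_l; lra.
Qed.

Lemma cont2_uniform g a b c d eps : a <= b -> c <= d -> eps > 0 ->
  (forall x y, a <= x <= b -> c <= y <= d -> cont2 g x y) ->
  exists de, de > 0 /\ forall x y, a <= x <= b -> c <= y <= d ->
    forall x' y', Rabs (x' - x) <= de -> Rabs (y' - y) <= de ->
      nrm (Asub (g x' y') (g x y)) <= eps.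
Proof.
  intros Hab Hcd He Hc.
  apply (uniform_on_rectangle (fun x y de => forall x' y',
    Rabs (x' - x) <= de -> Rabs (y' - y) <= de -> nrm (Asub (g x' y') (g x y)) <= eps) a b c d); auto.
  - intros x y de de' Hde HQ x' y' H1 H2. apply HQ; lra.
  - intros x y Hx Hy. assert (H := Hc x y Hx Hy). rewrite cont2_iff in H.
    destruct (H (eps / 2)) as (de & Hde & Hg); [lra|].
    exists (de / 2); split; [lra|]. intros x' y' _ _ H1 H2 x'' y'' H3 H4.
    assert (B1 := Hg x' y' ltac:(lra) ltac:(lra)).
    assert (B2 : nrm (Asub (g x'' y'') (g x y)) < eps / 2).
    { apply Hg; [replace (x'' - x) with ((x'' - x') + (x' - x)) by ring|
              replace (y'' - y) with ((y'' - y') + (y' - y)) by ring];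
      (eapply Rle_trans; [apply Rabs_triang|lra]). }
    rewrite Anorm_sub_sym in B1.
    eapply Rle_trans; [apply (Anorm_sub_triang n _ (g x y))|lra].
Qed.

Lemma rect_int_thin g A B C D eps : eps > 0 -> A <= B -> C <= D ->
  (forall x y, A <= x <= B -> C <= y <= D -> cont2 g x y) ->
  exists delta, delta > 0 /\ forall a b c d, subrect A B C D a b c d ->
    b - a < delta \/ d - c < delta -> nrm (rect_int g a b c d) < eps.
Proof.
  intros He HAB HCD Hc.
  destruct rect_int_diff_bound2 as (K & HK & HJ).
  destruct (cont2_bounded g A B C D HAB HCD Hc) as (M & HM & HgM).
  set (S := (B - A) + (D - C) + 1). assert (HS : S >= 1) by (unfold S; lra).
  set (om := eps / (4 * K * S)). assert (HKS : 0 < 4 * K * S) by nra.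
  assert (Hom : om > 0) by (apply Rdiv_lt_0_compat; lra).
  assert (Eom : K * (om * S) = eps / 4) by (unfold om; field; lra).
  destruct (cont2_uniform g A B C D om HAB HCD Hom Hc) as (d1 & Hd1 & Hu).
  set (d2 := eps / (8 * K * M)). assert (HKM : 0 < 8 * K * M) by nra.
  assert (Hd2 : d2 > 0) by (apply Rdiv_lt_0_compat; lra).
  assert (Ed2 : K * (2 * M * d2) = eps / 4) by (unfold d2; field; lra).
  exists (Rmin d1 d2); split; [apply Rmin_glb_lt; lra|].
  pose proof (Rmin_l d1 d2) as L1; pose proof (Rmin_r d1 d2) as L2.
  intros a b c d Hs Hor. unfold subrect in Hs.
  assert (HcB : contB g a b c d) by (intros x y (H1 & H2 & _); apply Hc; lra).
  assert (Htriv : forall p q p' q', A <= p <= B -> C <= q <= D -> A <= p' <= B -> C <= q' <= D ->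
     nrm (Asub (g p q) (g p' q')) <= 2 * M).
  { intros. eapply Rle_trans; [apply Anorm_Asub|].
    assert (nrm (g p q) <= M) by auto. assert (nrm (g p' q') <= M) by auto. lra. }
  destruct Hor as [Hw|Hh].
  - apply Rle_lt_trans with (K * (om * (d - c) + 2 * M * (b - a))).
    + apply HJ; auto; try lra.
      * intros y Hy. apply Hu; try lra; [rewrite Rabs_pos_eq; lra|].
        replace (y - y) with 0 by ring. rewrite Rabs_R0; lra.
      * intros x Hx. apply Htriv; lra.
    + assert (om * (d - c) <= om * S) by (apply Rmult_le_compat_l; unfold S; lra).
      assert (2 * M * (b - a) <= 2 * M * d2) by (apply Rmult_le_compat_l; lra).
      apply Rle_lt_trans with (K * (om * S + 2 * M * d2)); [apply Rmult_le_compat_l; lra|lra].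
  - apply Rle_lt_trans with (K * (2 * M * (d - c) + om * (b - a))).
    + apply HJ; auto; try lra.
      * intros y Hy. apply Htriv; lra.
      * intros x Hx. apply Hu; try lra; [|rewrite Rabs_pos_eq; lra].
        replace (x - x) with 0 by ring. rewrite Rabs_R0; lra.
    + assert (om * (b - a) <= om * S) by (apply Rmult_le_compat_l; unfold S; lra).
      assert (2 * M * (d - c) <= 2 * M * d2) by (apply Rmult_le_compat_l; lra).
      apply Rle_lt_trans with (K * (om * S + 2 * M * d2)); [apply Rmult_le_compat_l; lra|lra].
Qed.

(* Goursat's theorem for functions that need not be Frechet differentiable, in the spirit of
   Looman and Menchoff. *)
Lemma goursat U g A B C D : open2 U -> A <= B -> C <= D ->
  (forall x y, U x y -> cont2 g x y /\ exists k, hasder g x y k) ->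
  (forall x y, A <= x <= B -> C <= y <= D -> U x y) ->
  rect_int g A B C D == Azero.
Proof.
  intros HU HAB HCD Hg Hin.
  destruct (open2_margin U A B C D HU HAB HCD Hin) as (mu & Hmu & Hmar).
  assert (Hc : forall x y, A <= x <= B -> C <= y <= D -> cont2 g x y) by (intros; apply Hg; auto).
  (* Rectangle functions were taken real, so the vanishing is shown for the real and the imaginary
     part of each coordinate; the norm dominates all of them. *)
  assert (Hzero : forall part : Cplx -> R, part C0 = 0 ->
    (forall z w, part (Cadd z w) = part z + part w) ->
    (forall z, Rabs (part z) <= Cmod z) ->
    forall r, (1 <= r <= n)%nat -> part (rect_int g A B C D r) = 0).
  { intros part Hp0 Hpadd Hpnorm r Hr.
    assert (Hle : forall a, Rabs (part (a r)) <= nrm a).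
    { intro a. eapply Rle_trans; [apply Hpnorm|apply Cmod_le_Anorm, Hr]. }
    apply (rectangle_function_zero (fun a b c d => part (rect_int g a b c d r)) A B C D);
      [| | | |unfold subrect; lra].
    - intros a x b c d Hs Hx. unfold subrect in Hs.
      rewrite (rect_int_split_x g a x b c d) by
        (try lra; try exact Hr; intros p q (H1 & H2 & _); apply Hc; lra).
      apply Hpadd.
    - intros a b c y d Hs Hy. unfold subrect in Hs.
      rewrite (rect_int_split_y g a b c y d) by
        (try lra; try exact Hr; intros p q (H1 & H2 & _); apply Hc; lra).
      apply Hpadd.
    - intros eps He. destruct (rect_int_thin g A B C D eps He HAB HCD Hc) as (de & Hde & H).
      exists de; split; [exact Hde|]. intros a b c d Hs Hor.
      eapply Rle_lt_trans; [apply Hle|]. apply H; assumption.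
    - intros eta P Heta HP Hcl Hne.
      destruct (portion_estimate g A B C D mu eta P) as (x0 & y0 & de & HP0 & Hde & H); auto.
      + intros; apply Hg; auto.
      + intros; apply Hg; auto.
      + exists x0, y0, de. split; [exact HP0|]. split; [exact Hde|]. intros.
        eapply Rle_trans; [apply Hle|]. apply H; assumption. }
  intros r Hr. unfold Azero, C0. apply injective_projections; simpl.
  - apply (Hzero fst); auto. apply Rabs_fst_le_Cmod.
  - apply (Hzero snd); auto. apply Rabs_snd_le_Cmod.
Qed.

(** * Cauchy's formula *)

Definition Aunitp (a : Alg) : Prop := exists b, mul a b == one.
(** Total by choice: an inverse for a unit, determined up to [Aeq n], and an arbitrary element
    otherwise. *)
Definition Ainv (a : Alg) : Alg := epsilon (inhabits Azero) (fun b => mul a b == one).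

Lemma Ainv_r a : Aunitp a -> mul a (Ainv a) == one.
Proof. intro H. exact (epsilon_spec (inhabits Azero) (fun b => mul a b == one) H). Qed.

Lemma Ainv_unique a b : mul a b == one -> b == Ainv a.
Proof.
  intro H. assert (H' := Ainv_r a (ex_intro _ b H)).
  transitivity (mul b (mul a (Ainv a))); [rewrite H'; ring|].
  transitivity (mul (mul a b) (Ainv a)); [ring|]. rewrite H. ring.
Qed.

(** The resolvent identity, from which bounds, continuity and differentiability of the inverse
    follow. *)
Lemma Ainv_sub a b : Aunitp a -> Aunitp b ->
  Asub (Ainv a) (Ainv b) == mul (mul (Ainv a) (Ainv b)) (Asub b a).
Proof.
  intros Ha Hb. apply Ainv_r in Ha. apply Ainv_r in Hb.
  transitivity (Asub (mul (mul b (Ainv b)) (Ainv a)) (mul (mul a (Ainv a)) (Ainv b))).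
  - rewrite Ha, Hb. ring.
  - ring.
Qed.

Lemma Ainv_Ascal c a : c <> 0 -> Aunitp a -> Ainv (Ascal c a) == Ascal (/ c) (Ainv a).
Proof.
  intros Hc Ha. symmetry. apply Ainv_unique.
  rewrite Amul_Ascal, Amul_Ascal_l, (Ainv_r a Ha).
  replace (Ascal (/ c) (Ascal c one)) with one; [reflexivity|].
  extensionality r. unfold Ascal. apply injective_projections;
    unfold RCmul, Cre, Cim; simpl; field; exact Hc.
Qed.

(** In [b^-1 = a^-1 + b^-1 a^-1 (a - b)] the last term is at most half of the norm of [b^-1] once
    [b] is close to [a], and is absorbed on the left. *)
Lemma Ainv_locally_bounded a : Aunitp a -> exists de M, de > 0 /\ M > 0 /\
  forall b, Aunitp b -> nrm (Asub b a) <= de -> nrm (Ainv b) <= M.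
Proof.
  intros Ha. destruct Amul_bounded as (K & HK & Hmul).
  pose proof (Anorm_ge0 n (Ainv a)) as H0.
  set (q := nrm (Ainv a)) in *.
  assert (Hden : 0 < 2 * K * K * (q + 1)) by (repeat apply Rmult_lt_0_compat; lra).
  exists (/ (2 * K * K * (q + 1))), (2 * q + 1).
  split; [apply Rinv_0_lt_compat; exact Hden|]. split; [lra|].
  intros b Hb Hd.
  assert (E : Ainv b == Aadd (Ainv a) (mul (mul (Ainv b) (Ainv a)) (Asub a b))).
  { rewrite <- (Ainv_sub b a Hb Ha). ring. }
  set (p := nrm (Ainv b)). assert (Hp : 0 <= p) by apply Anorm_ge0.
  assert (HB : p <= q + K * (K * (p * q) * nrm (Asub a b))).
  { unfold p at 1. rewrite E. eapply Rle_trans; [apply Anorm_Aadd|].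
    apply Rplus_le_compat_l. eapply Rle_trans; [apply Hmul|].
    apply Rmult_le_compat_l; [lra|]. apply Rmult_le_compat_r; [apply Anorm_ge0|apply Hmul]. }
  rewrite Anorm_sub_sym in HB.
  set (d := nrm (Asub b a)) in *. assert (Hd0 : 0 <= d) by apply Anorm_ge0.
  assert (Hd1 : d * (2 * K * K * (q + 1)) <= 1).
  { apply (Rmult_le_compat_r (2 * K * K * (q + 1))) in Hd; [|lra]. rewrite Rinv_l in Hd; lra. }
  assert (Hd2 : K * (K * q * d) <= 1 / 2).
  { assert (0 <= K * K * d) by (repeat apply Rmult_le_pos; lra). lra. }
  replace (K * (K * (p * q) * d)) with (p * (K * (K * q * d))) in HB by ring.
  assert (p * (K * (K * q * d)) <= p * (1 / 2)) by (apply Rmult_le_compat_l; lra). lra.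
Qed.

(** * The inverse of x + y e and its integrals *)

Hypothesis Him : forall p, (1 <= p <= m)%nat -> snd (e p) <> 0.

Definition w (x y : R) : Alg := lin one x y.
Definition V (x y : R) : Alg := Ainv (w x y).

Lemma w_char x y p : (1 <= p <= m)%nat ->
  w x y p = (x + y * fst (e p), y * snd (e p)).
Proof.
  intro Hp. unfold w, lin, Aadd, Ascal. rewrite Amul_char by exact Hp.
  unfold Aunit. destruct (Nat.leb_spec p m); [|lia].
  unfold Cadd, RCmul, Cmul, C1, Cre, Cim; simpl. f_equal; ring.
Qed.

Lemma w_unit x y : x <> 0 \/ y <> 0 -> Aunitp (w x y).
Proof.
  intro Hxy. apply Ainverse_exists. intros p Hp. rewrite w_char by exact Hp.
  intro E. injection E; intros E2 E1. specialize (Him p Hp).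
  destruct (Rmult_integral _ _ E2) as [Z|Z]; [|tauto].
  subst y. destruct Hxy as [Hx|Hy]; [apply Hx; lra|lra].
Qed.

Lemma V_r x y : x <> 0 \/ y <> 0 -> mul (w x y) (V x y) == one.
Proof. intro H. apply Ainv_r, w_unit, H. Qed.

Lemma w_sub x y x' y' : Asub (w x' y') (w x y) = w (x' - x) (y' - y).
Proof. unfold w, lin. generalize (mul e one); intros. avec. Qed.

(** [V] is homogeneous of degree -1, so it is enough to bound it on two adjacent sides of the unit
    square; scaling by a negative factor reaches the other two. *)
Lemma V_bound : exists K, K > 0 /\ forall x y, x <> 0 \/ y <> 0 ->
  nrm (V x y) * Rmax (Rabs x) (Rabs y) <= K.
Proof.
  assert (Hseg : forall A B C D, A <= B -> C <= D ->
    (forall x y, A <= x <= B -> C <= y <= D -> x <> 0 \/ y <> 0) ->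
    exists M, M > 0 /\ forall x y, A <= x <= B -> C <= y <= D -> nrm (V x y) <= M).
  { intros A B C D HAB HCD Hne.
    destruct (uniform_on_rectangle (fun x y de => nrm (V x y) * de <= 1) A B C D)
      as (de & Hde & H); auto.
    - intros x y de de' Hde H. pose proof (Anorm_ge0 n (V x y)). nra.
    - intros x y Hx Hy.
      destruct (Ainv_locally_bounded (w x y) (w_unit x y (Hne x y Hx Hy)))
        as (d1 & M & Hd1 & HM & HV).
      assert (Hcw := cont2_lin one x y). rewrite cont2_iff in Hcw.
      destruct (Hcw d1 Hd1) as (d2 & Hd2 & Hw).
      assert (HiM : 0 < / M) by (apply Rinv_0_lt_compat; lra).
      assert (Hmin : 0 < Rmin d2 (/ M)) by (apply Rmin_glb_lt; lra).
      pose proof (Rmin_l d2 (/ M)) as L1; pose proof (Rmin_r d2 (/ M)) as L2.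
      exists (Rmin d2 (/ M)); split; [exact Hmin|].
      intros x' y' Hx' Hy' H1 H2.
      assert (HB : nrm (V x' y') <= M).
      { apply HV; [apply w_unit; auto|]. apply Rlt_le, Hw; lra. }
      apply Rle_trans with (M * / M); [|rewrite Rinv_r; lra].
      apply Rmult_le_compat; try lra. apply Anorm_ge0.
    - exists (/ de); split; [apply Rinv_0_lt_compat; lra|]. intros x y Hx Hy.
      specialize (H x y Hx Hy). apply (Rmult_le_reg_r de); [lra|]. rewrite Rinv_l; lra. }
  destruct (Hseg 1 1 (-1) 1 ltac:(lra) ltac:(lra) ltac:(intros; left; lra)) as (M1 & HM1 & B1).
  destruct (Hseg (-1) 1 1 1 ltac:(lra) ltac:(lra) ltac:(intros; right; lra)) as (M2 & HM2 & B2).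
  assert (Hhom : forall c x y, c <> 0 -> x <> 0 \/ y <> 0 ->
     nrm (V (c * x) (c * y)) * Rabs c = nrm (V x y)).
  { intros c x y Hc Hxy. unfold V.
    replace (w (c * x) (c * y)) with (Ascal c (w x y))
      by (unfold w, lin; generalize (mul e one); intros; avec).
    rewrite (Ainv_Ascal c _ Hc (w_unit x y Hxy)), Anorm_Ascal, Rabs_inv.
    field. apply Rabs_no_R0, Hc. }
  exists (M1 + M2); split; [lra|]. intros x y Hxy.
  destruct (Rle_dec (Rabs y) (Rabs x)) as [Hle|Hle].
  - rewrite Rmax_left by exact Hle.
    assert (Hx : x <> 0).
    { intro Z. subst x. rewrite Rabs_R0 in Hle. destruct Hxy as [|Hy]; [tauto|].
      apply Rabs_pos_lt in Hy; lra. }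
    assert (E := Hhom x 1 (y / x) Hx ltac:(left; lra)).
    replace (x * (y / x)) with y in E by (field; exact Hx). rewrite Rmult_1_r in E.
    rewrite E. apply Rle_trans with M1; [|lra]. apply B1; [lra|].
    apply Rabs_le_between. unfold Rdiv. rewrite Rabs_mult, Rabs_inv.
    apply Rabs_pos_lt in Hx. apply (Rmult_le_reg_r (Rabs x)); [exact Hx|].
    rewrite Rmult_assoc, Rinv_l; lra.
  - apply Rnot_le_lt in Hle. rewrite Rmax_right by lra.
    assert (Hy : y <> 0).
    { intro Z. subst y. rewrite Rabs_R0 in Hle. pose proof (Rabs_pos x); lra. }
    assert (E := Hhom y (x / y) 1 Hy ltac:(right; lra)).
    replace (y * (x / y)) with x in E by (field; exact Hy). rewrite Rmult_1_r in E.
    rewrite E. apply Rle_trans with M2; [|lra]. apply B2; [|lra].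
    apply Rabs_le_between. unfold Rdiv. rewrite Rabs_mult, Rabs_inv.
    apply Rabs_pos_lt in Hy. apply (Rmult_le_reg_r (Rabs y)); [exact Hy|].
    rewrite Rmult_assoc, Rinv_l; lra.
Qed.

Lemma punctured_open x y : x <> 0 \/ y <> 0 -> exists de, de > 0 /\
  forall x' y', Rabs (x' - x) <= de -> Rabs (y' - y) <= de -> x' <> 0 \/ y' <> 0.
Proof.
  intros [H|H]; apply Rabs_pos_lt in H.
  - exists (Rabs x / 2); split; [lra|]. intros x' y' H1 _. left. intro Z. subst x'.
    rewrite Rminus_0_l, Rabs_Ropp in H1. lra.
  - exists (Rabs y / 2); split; [lra|]. intros x' y' _ H1. right. intro Z. subst y'.
    rewrite Rminus_0_l, Rabs_Ropp in H1. lra.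
Qed.

Lemma cont2_V x y : x <> 0 \/ y <> 0 -> cont2 V x y.
Proof.
  intro Hxy. destruct Amul_bounded as (K & HK & Hmul).
  destruct (Ainv_locally_bounded _ (w_unit x y Hxy)) as (d1 & M & Hd1 & HM & HV).
  destruct (punctured_open x y Hxy) as (d0 & Hd0 & Hpun).
  assert (Hcw := cont2_lin one x y). rewrite cont2_iff in Hcw.
  rewrite cont2_iff. intros eps He.
  assert (HKM : 0 < K * (K * (M * M))) by (repeat apply Rmult_lt_0_compat; lra).
  set (d2 := Rmin d1 (eps / (K * (K * (M * M))))).
  assert (Hd2 : d2 > 0) by (apply Rmin_glb_lt; [lra|apply Rdiv_lt_0_compat; lra]).
  destruct (Hcw d2 Hd2) as (d3 & Hd3 & Hw).
  exists (Rmin d0 d3); split; [apply Rmin_glb_lt; lra|].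
  pose proof (Rmin_l d0 d3) as L1; pose proof (Rmin_r d0 d3) as L2.
  intros x' y' H1 H2.
  assert (Hxy' : x' <> 0 \/ y' <> 0) by (apply Hpun; lra).
  specialize (Hw x' y' ltac:(lra) ltac:(lra)).
  change (nrm (Asub (w x' y') (w x y)) < d2) in Hw.
  assert (Hw1 : nrm (Asub (w x' y') (w x y)) < d1) by (eapply Rlt_le_trans; [exact Hw|apply Rmin_l]).
  assert (Hw2 : nrm (Asub (w x' y') (w x y)) < eps / (K * (K * (M * M))))
    by (eapply Rlt_le_trans; [exact Hw|apply Rmin_r]).
  unfold V. rewrite (Ainv_sub _ _ (w_unit _ _ Hxy') (w_unit _ _ Hxy)).
  assert (B1 : nrm (Ainv (w x' y')) <= M) by (apply HV; [apply w_unit; auto|lra]).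
  assert (B2 : nrm (Ainv (w x y)) <= M).
  { apply HV; [apply w_unit; auto|]. rewrite (Anorm_ext n _ Azero) by ring.
    rewrite Anorm_Azero; lra. }
  eapply Rle_lt_trans; [apply Hmul|]. rewrite (Anorm_sub_sym n (w x y)).
  apply Rle_lt_trans with (K * (K * (M * M) * nrm (Asub (w x' y') (w x y)))).
  - apply Rmult_le_compat_l; [lra|]. apply Rmult_le_compat_r; [apply Anorm_ge0|].
    eapply Rle_trans; [apply Hmul|]. apply Rmult_le_compat_l; [lra|].
    apply Rmult_le_compat; auto; apply Anorm_ge0.
  - apply (Rmult_lt_compat_l (K * (K * (M * M)))) in Hw2; [|exact HKM].
    replace (K * (K * (M * M)) * (eps / (K * (K * (M * M))))) with eps in Hw2 by (field; lra).
    lra.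
Qed.

Local Instance locally'_filter0 : Filter (locally' 0).
Proof. apply within_filter, locally_filter. Qed.

Lemma cont2_Lim_x g x y : cont2 g x y -> Lim (locally' 0) (fun t => g (x + t) y) (g x y).
Proof.
  rewrite cont2_iff, Lim_locally'_iff. intros H eps He. destruct (H eps He) as (de & Hde & Hg).
  exists de; split; [exact Hde|]. intros t _ Ht. apply Hg.
  - replace (x + t - x) with t by ring. lra.
  - replace (y - y) with 0 by ring. rewrite Rabs_R0. lra.
Qed.

Lemma cont2_Lim_y g x y : cont2 g x y -> Lim (locally' 0) (fun t => g x (y + t)) (g x y).
Proof.
  rewrite cont2_iff, Lim_locally'_iff. intros H eps He. destruct (H eps He) as (de & Hde & Hg).
  exists de; split; [exact Hde|]. intros t _ Ht. apply Hg.
  - replace (x - x) with 0 by ring. rewrite Rabs_R0. lra.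
  - replace (y + t - y) with t by ring. lra.
Qed.

Lemma hasder_Amul f g x y k l : hasder f x y k -> hasder g x y l -> cont2 g x y ->
  hasder (fun x y => mul (f x y) (g x y)) x y (Aadd (mul k (g x y)) (mul (f x y) l)).
Proof.
  intros [F1 F2] [G1 G2] Hg.
  assert (Alge : forall t a a' b b',
    Ascal (/ t) (Asub (mul a' b') (mul a b)) ==
    Aadd (mul (Ascal (/ t) (Asub a' a)) b') (mul a (Ascal (/ t) (Asub b' b)))).
  { intros. rewrite Amul_Ascal, Amul_Ascal_l, (Ascal_mul _ (Asub (mul a' b') (mul a b))),
      (Ascal_mul _ (mul (Asub a' a) b')), (Ascal_mul _ (mul a (Asub b' b))). ring. }
  split.
  - apply (Lim_ext (locally' 0) (fun t => Aadd
      (mul (Ascal (/ t) (Asub (f (x + t) y) (f x y))) (g (x + t) y))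
      (mul (f x y) (Ascal (/ t) (Asub (g (x + t) y) (g x y))))) _
      (Aadd (mul k (g x y)) (mul (f x y) l))).
    + apply filter_forall. intro t. symmetry. apply Alge.
    + reflexivity.
    + apply Lim_Aadd; [apply locally'_filter0| |]; apply Lim_Amul;
        try apply locally'_filter0; auto.
      * apply cont2_Lim_x, Hg.
      * apply Lim_const, locally'_filter0.
  - apply (Lim_ext (locally' 0) (fun t => Aadd
      (mul (Ascal (/ t) (Asub (f x (y + t)) (f x y))) (g x (y + t)))
      (mul (f x y) (Ascal (/ t) (Asub (g x (y + t)) (g x y))))) _
      (Aadd (mul (mul e k) (g x y)) (mul (f x y) (mul e l)))).
    + apply filter_forall. intro t. symmetry. apply Alge.
    + ring.
    + apply Lim_Aadd; [apply locally'_filter0| |]; apply Lim_Amul;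
        try apply locally'_filter0; auto.
      * apply cont2_Lim_y, Hg.
      * apply Lim_const, locally'_filter0.
Qed.

(** By the resolvent identity the quotients are [- V' V] and [- e V' V], with [V'] the value at the
    displaced point; continuity of [V] finishes. *)
Lemma hasder_V x y : x <> 0 \/ y <> 0 -> hasder V x y (Aopp (mul (V x y) (V x y))).
Proof.
  intro Hxy. destruct (punctured_open x y Hxy) as (d0 & Hd0 & Hpun).
  assert (Hnear : locally' 0 (fun t => t <> 0 /\ (x + t <> 0 \/ y <> 0) /\ (x <> 0 \/ y + t <> 0))).
  { exists (mkposreal d0 Hd0).
    change (forall t : R, ball 0 (mkposreal d0 Hd0) t -> t <> 0 ->
      t <> 0 /\ (x + t <> 0 \/ y <> 0) /\ (x <> 0 \/ y + t <> 0)). intros t Ht Hn.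
    unfold ball in Ht; simpl in Ht; unfold AbsRing_ball in Ht; simpl in Ht.
    unfold abs, minus, plus, opp in Ht; simpl in Ht. rewrite Ropp_0, Rplus_0_r in Ht.
    split; [exact Hn|]. split; apply Hpun.
    - replace (x + t - x) with t by ring. lra.
    - replace (y - y) with 0 by ring. rewrite Rabs_R0; lra.
    - replace (x - x) with 0 by ring. rewrite Rabs_R0; lra.
    - replace (y + t - y) with t by ring. lra. }
  assert (Hscal : forall t a, t <> 0 -> Ascal (/ t) (Ascal (- t) a) = Aopp a).
  { intros t a Ht. extensionality r. unfold Ascal, Aopp. apply injective_projections;
    unfold RCmul, Copp, Cre, Cim; simpl; field; exact Ht. }
  assert (Hc := cont2_V x y Hxy).
  split.
  - apply (Lim_ext (locally' 0) (fun t => mul (Aopp one) (mul (V (x + t) y) (V x y))) _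
      (mul (Aopp one) (mul (V x y) (V x y)))).
    + revert Hnear. apply filter_imp. intros t (Ht & H1 & H2). unfold V.
      rewrite (Ainv_sub _ _ (w_unit _ _ H1) (w_unit _ _ Hxy)).
      replace (Asub (w x y) (w (x + t) y)) with (Ascal (- t) one)
        by (unfold w, lin; generalize (mul e one); intros; avec).
      rewrite Amul_Ascal, Hscal by exact Ht. ring.
    + ring.
    + repeat (apply Lim_Amul; [apply locally'_filter0| |]);
        try (apply Lim_const, locally'_filter0). apply cont2_Lim_x, Hc.
  - apply (Lim_ext (locally' 0) (fun t => mul (Aopp e) (mul (V x (y + t)) (V x y))) _
      (mul (Aopp e) (mul (V x y) (V x y)))).
    + revert Hnear. apply filter_imp. intros t (Ht & H1 & H2). unfold V.
      rewrite (Ainv_sub _ _ (w_unit _ _ H2) (w_unit _ _ Hxy)).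
      replace (Asub (w x y) (w x (y + t))) with (Ascal (- t) (mul e one))
        by (unfold w, lin; generalize (mul e one); intros; avec).
      rewrite Amul_Ascal, Hscal by exact Ht. ring.
    + ring.
    + repeat (apply Lim_Amul; [apply locally'_filter0| |]);
        try (apply Lim_const, locally'_filter0). apply cont2_Lim_y, Hc.
Qed.

Lemma hasder_shift s g x y k : hasder g (x - s) y k -> hasder (fun x y => g (x - s) y) x y k.
Proof.
  intros [H1 H2]. split; [|exact H2].
  assert (E : forall t, x - s + t = x + t - s) by (intro; ring).
  apply (Lim_ext (locally' 0) (fun t => Ascal (/ t) (Asub (g (x - s + t) y) (g (x - s) y))) _ k).
  - apply filter_forall. intro t. rewrite E. reflexivity.
  - reflexivity.
  - exact H1.
Qed.

Lemma is_AInt_shift s f a b v : is_AInt f a b v ->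
  is_AInt (fun x => f (x - s)) (a + s) (b + s) v.
Proof.
  assert (H1 : forall (h : R -> R) (l : R), is_RInt h a b l ->
    is_RInt (fun x => h (x - s)) (a + s) (b + s) l).
  { intros h l H.
    assert (H' : is_RInt h (1 * (a + s) + - s) (1 * (b + s) + - s) l).
    { replace (1 * (a + s) + - s) with a by ring. replace (1 * (b + s) + - s) with b by ring.
      exact H. }
    apply (is_RInt_comp_lin (V := R_NormedModule)) in H'.
    apply (is_RInt_ext (V := R_NormedModule) (fun y => scal 1 (h (1 * y + - s)))); [|exact H'].
    intros x _. unfold scal; simpl; unfold mult; simpl. rewrite !Rmult_1_l. reflexivity. }
  intros H r Hr. destruct (H r Hr) as [F1 F2].
  split; [apply (H1 (fun x => fst (f x r)))|apply (H1 (fun x => snd (f x r)))]; assumption.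
Qed.

(** The kernel [(w - s)^-1]. Poles on the real axis are enough, since only the derivative along [1]
    at the centre is to be recovered. *)
Definition Vs (s x y : R) : Alg := V (x - s) y.

Lemma cont2_Vs s x y : x <> s \/ y <> 0 -> cont2 (Vs s) x y.
Proof.
  intro H. apply (cont2_shift_x (- s) V x y). apply cont2_V.
  destruct H as [H|H]; [left|right; exact H]. intro Z. apply H. lra.
Qed.

Lemma hasder_Vs s x y : x <> s \/ y <> 0 -> exists k, hasder (Vs s) x y k.
Proof.
  intro H. eexists. apply (hasder_shift s V). apply hasder_V.
  destruct H as [H|H]; [left|right; exact H]. intro Z. apply H. lra.
Qed.

(** Around the small square the large one splits into a left and a right slab and two middle pieces.
    None of them contains the pole, so Goursat's theorem in the punctured set removes all four. *)
Lemma rect_int_cut U F s rho sg : open2 U ->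
  (forall x y, - rho <= x <= rho -> - rho <= y <= rho -> U x y) ->
  (forall x y, U x y -> x <> s \/ y <> 0 -> cont2 F x y /\ exists k, hasder F x y k) ->
  0 < sg -> - rho <= s - sg -> s + sg <= rho ->
  rect_int F (- rho) rho (- rho) rho == rect_int F (s - sg) (s + sg) (- sg) sg.
Proof.
  intros HU Hin HF Hsg Hs1 Hs2.
  assert (HU' : open2 (fun x y => U x y /\ (x <> s \/ y <> 0))).
  { intros x y [Hx Hne]. destruct (HU x y Hx) as (d1 & Hd1 & H1).
    destruct (punctured_open (x - s) y) as (d2 & Hd2 & H2).
    { destruct Hne as [H|H]; [left; lra|right; exact H]. }
    exists (Rmin d1 d2); split; [apply Rmin_glb_lt; lra|].
    pose proof (Rmin_l d1 d2) as L1; pose proof (Rmin_r d1 d2) as L2.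
    intros x' y' Hx' Hy'. split; [apply H1; lra|].
    destruct (H2 (x' - s) y') as [H|H]; [|lra|left; lra|right; exact H].
    replace (x' - s - (x - s)) with (x' - x) by ring. lra. }
  assert (HB : forall a b c d, - rho <= a -> b <= rho -> - rho <= c -> d <= rho ->
     (forall x y, on_boundary a b c d x y -> x <> s \/ y <> 0) -> contB F a b c d).
  { intros a b c d Ha Hb Hc Hd Hne x y Hxy. apply HF; [|apply Hne, Hxy].
    destruct Hxy as (Hx & Hy & _). apply Hin; lra. }
  assert (HZ : forall a b c d, - rho <= a <= b -> b <= rho -> - rho <= c <= d -> d <= rho ->
     (forall x y, a <= x <= b -> c <= y <= d -> x <> s \/ y <> 0) ->
     rect_int F a b c d == Azero).
  { intros a b c d Ha Hb Hc Hd Hne.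
    apply (goursat (fun x y => U x y /\ (x <> s \/ y <> 0))); auto; try lra.
    - intros x y [Hx Hn]. apply HF; assumption.
    - intros x y Hx Hy. split; [apply Hin; lra|auto]. }
  assert (Hbd : forall a b c d, a <> s -> b <> s -> c <> 0 -> d <> 0 ->
     forall x y, on_boundary a b c d x y -> x <> s \/ y <> 0).
  { intros a b c d H1 H2 H3 H4 x y (_ & _ & [-> | [-> | [-> | ->]]]); auto. }
  rewrite (rect_int_split_x F (- rho) (s - sg) rho (- rho) rho);
    [|lra|lra|apply HB; try lra; apply Hbd; lra|apply HB; try lra; apply Hbd; lra].
  rewrite (rect_int_split_x F (s - sg) (s + sg) rho (- rho) rho);
    [|lra|lra|apply HB; try lra; apply Hbd; lra|apply HB; try lra; apply Hbd; lra].
  rewrite (rect_int_split_y F (s - sg) (s + sg) (- rho) (- sg) rho);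
    [|lra|lra|apply HB; try lra; apply Hbd; lra|apply HB; try lra; apply Hbd; lra].
  rewrite (rect_int_split_y F (s - sg) (s + sg) (- sg) sg rho);
    [|lra|lra|apply HB; try lra; apply Hbd; lra|apply HB; try lra; apply Hbd; lra].
  rewrite (HZ (- rho) (s - sg) (- rho) rho); [|lra|lra|lra|lra|intros; left; lra].
  rewrite (HZ (s + sg) rho (- rho) rho); [|lra|lra|lra|lra|intros; left; lra].
  rewrite (HZ (s - sg) (s + sg) (- rho) (- sg)); [|lra|lra|lra|lra|intros; right; lra].
  rewrite (HZ (s - sg) (s + sg) sg rho); [|lra|lra|lra|lra|intros; right; lra].
  ring.
Qed.

(** The counterpart of [2 pi i]. Under [f_p] it is the integral of [dz / z] along a parallelogram
    around the origin, whose orientation depends on the sign of [Im f_p(e)]. *)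
Definition period (rho : R) : Alg := rect_int V (- rho) rho (- rho) rho.

Lemma contB_V rho : 0 < rho -> contB V (- rho) rho (- rho) rho.
Proof.
  intros Hr x y (_ & _ & H). apply cont2_V.
  destruct H as [-> | [-> | [-> | ->]]]; [left|left|right|right]; lra.
Qed.

(** In the character [f_p], [V] is the reciprocal of [x + y f_p(e)]. The real part of [f_p(e)]
    survives only in [N], which makes the signs on the four sides visible. *)
Lemma V_im x y p : (1 <= p <= m)%nat -> x <> 0 \/ y <> 0 ->
  let N := (x + y * fst (e p)) * (x + y * fst (e p)) + (y * snd (e p)) * (y * snd (e p)) in
  0 < N /\ snd (V x y p) = - y * snd (e p) / N /\
  snd (mul e (V x y) p) = snd (e p) * x / N.
Proof.
  intros Hp Hxy N. assert (Hpn : (1 <= p <= n)%nat) by (destruct Halg; lia).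
  assert (Himp := Him p Hp).
  assert (HN : 0 < N).
  { unfold N. destruct (Req_dec y 0) as [->|Hy].
    - destruct Hxy as [Hx|Hx]; [|lra]. apply Rlt_0_sqr in Hx. unfold Rsqr in Hx. lra.
    - assert (Hyq : y * snd (e p) <> 0) by (apply Rmult_integral_contrapositive; auto).
      apply Rlt_0_sqr in Hyq. unfold Rsqr in Hyq.
      pose proof (Rle_0_sqr (x + y * fst (e p))) as Hs. unfold Rsqr in Hs. lra. }
  split; [exact HN|].
  assert (E := V_r x y Hxy p Hpn). rewrite !Amul_char in * by exact Hp.
  rewrite w_char in E by exact Hp. unfold Aunit in E. destruct (Nat.leb_spec p m); [|lia].
  unfold Cmul, C1, Cre, Cim in *. simpl in *. injection E; intros E2 E1.
  set (r := fst (V x y p)) in *. set (i := snd (V x y p)) in *.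
  set (a := fst (e p)) in *. set (q := snd (e p)) in *.
  assert (Ei : i = - y * q / N).
  { apply (Rmult_eq_reg_r N); [|lra]. unfold Rdiv. rewrite Rmult_assoc, Rinv_l, Rmult_1_r by lra.
    unfold N.
    transitivity ((x + y * a) * ((x + y * a) * i + y * q * r) -
      y * q * ((x + y * a) * r - y * q * i)); [ring|]. rewrite E1, E2. ring. }
  assert (Er : r = (x + y * a) / N).
  { apply (Rmult_eq_reg_r N); [|lra]. unfold Rdiv. rewrite Rmult_assoc, Rinv_l, Rmult_1_r by lra.
    unfold N.
    transitivity ((x + y * a) * ((x + y * a) * r - y * q * i) +
      y * q * ((x + y * a) * i + y * q * r)); [ring|]. rewrite E1, E2. ring. }
  split; [exact Ei|]. rewrite Ei, Er. field. lra.
Qed.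

(* The imaginary part of [f_p (period)] is an integral of a function of the sign of [Im f_p e]. *)
Lemma period_unit rho : 0 < rho -> Aunitp (period rho).
Proof.
  intro Hr. apply Ainverse_exists. intros p Hp Hz.
  assert (Hpn : (1 <= p <= n)%nat) by (destruct Halg; lia).
  assert (Hq := Him p Hp). set (q := snd (e p)) in *.
  assert (Hqq : 0 < q * q) by (apply Rlt_0_sqr in Hq; exact Hq).
  assert (HcB := contB_V rho Hr).
  assert (Hz2 : snd (period rho p) = 0) by (rewrite Hz; reflexivity).
  assert (Hpos : forall f, (forall t, - rho <= t <= rho -> cont1 f t) ->
     (forall t, - rho < t < rho -> 0 < q * snd (f t p)) ->
     0 < q * snd (AInt f (- rho) rho p)).
  { intros f Hf Hfp. unfold AInt; simpl.
    assert (Hc : forall t, - rho <= t <= rho -> continuous (fun t => snd (f t p)) t)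
      by (intros t Ht; apply (cont1_parts f t p Hpn); auto).
    change (0 < scal q (RInt (fun t => snd (f t p)) (- rho) rho)).
    rewrite <- (RInt_scal (V := R_CompleteNormedModule)).
    - apply RInt_gt_0; [lra|exact Hfp|]. intros t Ht.
      apply (continuous_scal_r (V := R_NormedModule) q). apply Hc, Ht.
    - apply (ex_RInt_continuous (V := R_CompleteNormedModule)).
      rewrite Rmin_left, Rmax_right by lra. exact Hc. }
  assert (P1 : 0 < q * snd (AInt (fun y => mul e (Asub (V rho y) (V (- rho) y))) (- rho) rho p)).
  { apply Hpos.
    - intros t Ht. apply cont1_Amul; [apply cont1_const|].
      apply cont1_Asub; apply cont2_cont1_y, cont2_V; left; lra.
    - intros t Ht.
      assert (E : mul e (Asub (V rho t) (V (- rho) t)) == Asub (mul e (V rho t)) (mul e (V (- rho) t)))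
        by ring.
      rewrite (E p Hpn). unfold Asub, Cadd, Copp, Cim; simpl.
      destruct (V_im rho t p Hp) as (N1 & _ & ->); [left; lra|].
      destruct (V_im (- rho) t p Hp) as (N2 & _ & ->); [left; lra|].
      fold q in N1, N2 |- *.
            set (A1 := (rho + _) * _ + _) in *. set (A2 := (- rho + _) * _ + _) in *.
      replace (q * (q * rho / A1 + - (q * - rho / A2))) with (q * q * rho * (/ A1 + / A2))
        by (field; lra).
      apply Rinv_0_lt_compat in N1. apply Rinv_0_lt_compat in N2.
      apply Rmult_lt_0_compat; [apply Rmult_lt_0_compat; lra|lra]. }
  (* Bottom minus top, the reverse of the order in [rect_int]: here the imaginary part has the sign
     of [q]. The minus sign in [rect_int] makes both pairs of sides contribute with the same
     sign. *)
  assert (P2 : 0 < q * snd (AInt (fun x => Asub (V x (- rho)) (V x rho)) (- rho) rho p)).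
  { apply Hpos.
    - intros t Ht. apply cont1_Asub;
        [apply (cont2_cont1_x V t (- rho))|apply (cont2_cont1_x V t rho)]; apply cont2_V; right; lra.
    - intros t Ht. unfold Asub, Cadd, Copp, Cim; simpl.
      destruct (V_im t rho p Hp) as (N1 & -> & _); [right; lra|].
      destruct (V_im t (- rho) p Hp) as (N2 & -> & _); [right; lra|].
      fold q in N1, N2 |- *.
      set (A1 := (t + rho * _) * _ + _) in *. set (A2 := (t + - rho * _) * _ + _) in *.
      replace (q * (- - rho * q / A2 + - (- rho * q / A1))) with (q * q * rho * (/ A1 + / A2))
        by (field; lra).
      apply Rinv_0_lt_compat in N1. apply Rinv_0_lt_compat in N2.
      apply Rmult_lt_0_compat; [apply Rmult_lt_0_compat; lra|lra]. }
  assert (E : AInt (fun x => Asub (V x (- rho)) (V x rho)) (- rho) rho ==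
    Aopp (AInt (fun x => Asub (V x rho) (V x (- rho))) (- rho) rho)).
  { assert (Hc : forall t, - rho <= t <= rho -> cont1 (fun x => Asub (V x rho) (V x (- rho))) t).
    { intros t Ht. apply cont1_Asub;
        [apply (cont2_cont1_x V t rho)|apply (cont2_cont1_x V t (- rho))]; apply cont2_V; right; lra. }
    rewrite (AInt_unique _ _ _ (mul (Aopp one)
      (AInt (fun x => Asub (V x rho) (V x (- rho))) (- rho) rho))); [ring|].
    eapply is_AInt_ext; [lra| |apply is_AInt_Amul, AInt_correct; [lra|exact Hc]].
    intros t _. cbv beta. ring. }
  rewrite (E p Hpn) in P2. unfold period, rect_int in Hz2. clear E Hpos.
  revert P1 P2 Hz2.
  generalize (AInt (fun y => mul e (Asub (V rho y) (V (- rho) y))) (- rho) rho),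
    (AInt (fun x => Asub (V x rho) (V x (- rho))) (- rho) rho).
  unfold Asub, Aopp, Cadd, Copp, Cim; simpl. intros a1 a2 P1 P2 Hz2.
  replace (snd (a1 p)) with (snd (a2 p)) in P1 by lra. lra.
Qed.

Lemma rect_int_Vs s a b c d v : c <= d -> is_rect_int V a b c d v ->
  is_rect_int (Vs s) (a + s) (b + s) c d v.
Proof.
  intros Hcd (v1 & v2 & H1 & H2 & E).
  exists v1, v2. split; [|split; [|exact E]].
  - eapply is_AInt_ext; [exact Hcd| |exact H1]. intros y _. cbv beta. unfold Vs.
    replace (b + s - s) with b by ring. replace (a + s - s) with a by ring. reflexivity.
  - exact (is_AInt_shift s _ _ _ _ H2).
Qed.

Lemma square_boundary rho s x y : - rho < s < rho ->
  on_boundary (- rho) rho (- rho) rho x y -> x <> s \/ y <> 0.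
Proof.
  intros Hs (_ & _ & [-> | [-> | [-> | ->]]]); [left|left|right|right]; lra.
Qed.

Lemma Vs_bound K s x y r : 0 < r -> (forall x y, x <> 0 \/ y <> 0 ->
    nrm (V x y) * Rmax (Rabs x) (Rabs y) <= K) ->
  r <= Rabs (x - s) \/ r <= Rabs y -> nrm (Vs s x y) <= K / r.
Proof.
  intros Hr HK Hor.
  assert (Hm : r <= Rmax (Rabs (x - s)) (Rabs y)).
  { destruct Hor as [H|H]; (eapply Rle_trans; [exact H|]); [apply Rmax_l|apply Rmax_r]. }
  assert (Hne : x - s <> 0 \/ y <> 0).
  { destruct Hor as [H|H]; [left|right]; intro Z; rewrite Z, Rabs_R0 in H; lra. }
  specialize (HK _ _ Hne). apply (Rmult_le_reg_r r); [exact Hr|].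
  unfold Rdiv. rewrite Rmult_assoc, Rinv_l, Rmult_1_r by lra.
  eapply Rle_trans; [|exact HK]. apply Rmult_le_compat_l; [apply Anorm_ge0|exact Hm].
Qed.

Lemma boundary_far rho s x y : - rho < s < rho -> on_boundary (- rho) rho (- rho) rho x y ->
  rho - Rabs s <= Rabs (x - s) \/ rho - Rabs s <= Rabs y.
Proof.
  intros Hs (_ & _ & [-> | [-> | [-> | ->]]]); [left|left|right|right];
    unfold Rabs; repeat destruct Rcase_abs; lra.
Qed.

(** Both integrals shrink to squares of the same half-side [sg] around their poles, and these are
    translates of one another. *)
Lemma rect_int_Vs_period rho s : - rho < s < rho ->
  rect_int (Vs s) (- rho) rho (- rho) rho == period rho.
Proof.
  intro Hs. set (sg := Rmin (rho - s) (rho + s)).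
  assert (Hsg : 0 < sg) by (apply Rmin_glb_lt; lra).
  pose proof (Rmin_l (rho - s) (rho + s)) as L1; pose proof (Rmin_r (rho - s) (rho + s)) as L2.
  fold sg in L1, L2.
  assert (HT : open2 (fun _ _ => True)) by (intros x y _; exists 1; split; [lra|auto]).
  rewrite (rect_int_cut (fun _ _ => True) (Vs s) s rho sg HT); auto; try lra.
  2:{ intros x y _ H. split; [apply cont2_Vs, H|apply hasder_Vs, H]. }
  assert (E0 : Vs 0 = V) by (extensionality x; extensionality y; unfold Vs; f_equal; ring).
  unfold period. rewrite <- E0.
  rewrite (rect_int_cut (fun _ _ => True) (Vs 0) 0 rho sg HT); auto; try lra.
  2:{ intros x y _ H. split; [apply cont2_Vs, H|apply hasder_Vs, H]. }
  rewrite E0. replace (0 - sg) with (- sg) by ring. replace (0 + sg) with sg by ring.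
  apply rect_int_unique. replace (s - sg) with (- sg + s) by ring.
  replace (s + sg) with (sg + s) by ring.
  apply rect_int_Vs; [lra|]. apply rect_int_correct; try lra. apply contB_V, Hsg.
Qed.

Lemma hasder_Asub_const f v x y k : hasder f x y k -> hasder (fun x y => Asub (f x y) v) x y k.
Proof.
  assert (E : forall a b, Asub (Asub a v) (Asub b v) = Asub a b) by (intros; avec).
  intros [K1 K2]. split; [revert K1|revert K2]; apply Lim_ext;
    try apply locally'_filter0; try reflexivity;
    apply filter_forall; intro t; rewrite E; reflexivity.
Qed.

(** After subtracting the value at the pole, the integral shrinks to a square of half-side [sg]. The
    kernel grows like [1 / sg], the length decreases like [sg], and continuity of [f] makes the
    product small. *)
Lemma cauchy_formula U f rho s : open2 U ->
  (forall x y, - rho <= x <= rho -> - rho <= y <= rho -> U x y) ->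
  (forall x y, U x y -> cont2 f x y /\ exists k, hasder f x y k) ->
  - rho < s < rho ->
  rect_int (fun x y => mul (f x y) (Vs s x y)) (- rho) rho (- rho) rho ==
  mul (period rho) (f s 0).
Proof.
  intros HU Hin Hf Hs.
  assert (HcB : contB f (- rho) rho (- rho) rho) by (intros x y (Hx & Hy & _); apply Hf; auto).
  assert (HcVs : contB (Vs s) (- rho) rho (- rho) rho)
    by (intros x y H; apply cont2_Vs, (square_boundary rho); auto).
  assert (HcF : contB (fun x y => mul (f x y) (Vs s x y)) (- rho) rho (- rho) rho)
    by (intros x y H; apply cont2_Amul; [apply HcB|apply HcVs]; exact H).
  pose (H x y := mul (Asub (f x y) (f s 0)) (Vs s x y)).
  assert (E : rect_int H (- rho) rho (- rho) rho ==
    Asub (rect_int (fun x y => mul (f x y) (Vs s x y)) (- rho) rho (- rho) rho)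
         (mul (f s 0) (period rho))).
  { rewrite <- (rect_int_Vs_period rho s Hs).
    apply rect_int_unique.
    eapply is_rect_int_ext; [lra|lra| |apply is_rect_int_Asub; [lra|lra| |]].
    2:{ apply rect_int_correct; [lra|lra|exact HcF]. }
    2:{ apply (is_rect_int_Amul (f s 0) (Vs s)); [lra|lra|].
        apply rect_int_correct; [lra|lra|exact HcVs]. }
    intros x y _. cbv beta. unfold H. ring. }
  assert (Z : rect_int H (- rho) rho (- rho) rho == Azero).
  { destruct Amul_bounded as (K & HK & Hmul). destruct rect_int_bound as (KJ & HKJ & HJ).
    destruct V_bound as (Ci & HCi & HV).
    apply Anorm_small. intros eps He.
    (* The half-perimeter [4 * sg] cancels [Ci / sg], leaving the bound [4 * KJ * K * Ci * eta],
       which is [eps]. *)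
    assert (HD : 0 < 4 * KJ * K * Ci) by (repeat apply Rmult_lt_0_compat; lra).
    assert (Heta : eps / (4 * KJ * K * Ci) > 0) by (apply Rdiv_lt_0_compat; lra).
    set (eta := eps / (4 * KJ * K * Ci)) in *.
    assert (Hin0 : U s 0) by (apply Hin; lra).
    destruct (Hf s 0 Hin0) as [Hc0 _]. rewrite cont2_iff in Hc0.
    destruct (Hc0 eta Heta) as (de & Hde & Hclose).
    set (sg := Rmin de (Rmin (rho - s) (rho + s))).
    assert (Hsg : 0 < sg) by (repeat apply Rmin_glb_lt; lra).
    assert (L0 : sg <= de) by apply Rmin_l.
    assert (L1 : sg <= rho - s) by (eapply Rle_trans; [apply Rmin_r|apply Rmin_l]).
    assert (L2 : sg <= rho + s) by (eapply Rle_trans; [apply Rmin_r|apply Rmin_r]).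
    rewrite (rect_int_cut U H s rho sg); auto; try lra.
    2:{ intros x y Hxy Hne. destruct (Hf x y Hxy) as (Hc & k & Hk).
        destruct (hasder_Vs s x y Hne) as (l & Hl). split.
        - apply cont2_Amul; [apply cont2_Asub; [exact Hc|apply cont2_const]|apply cont2_Vs, Hne].
        - eexists. apply hasder_Amul; [|exact Hl|apply cont2_Vs, Hne].
          apply hasder_Asub_const, Hk. }
    apply Rle_trans with (KJ * (K * (eta * (Ci / sg)) * ((s + sg - (s - sg)) + (sg - - sg)))).
    - apply HJ; try lra.
      + intros x y (Hx & Hy & Hb).
        assert (Hne : x <> s \/ y <> 0)
          by (destruct Hb as [-> | [-> | [-> | ->]]]; [left|left|right|right]; lra).
        apply cont2_Amul; [|apply cont2_Vs, Hne].
        apply cont2_Asub; [|apply cont2_const]. apply Hf, Hin; lra.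
      + intros x y (Hx & Hy & Hb). unfold H. eapply Rle_trans; [apply Hmul|].
        apply Rmult_le_compat_l; [lra|]. apply Rmult_le_compat; try apply Anorm_ge0.
        * apply Rlt_le, Hclose; [apply Rabs_le; lra|apply Rabs_le; lra].
        * apply Vs_bound; [exact Hsg|exact HV|].
          destruct Hb as [-> | [-> | [-> | ->]]]; [left|left|right|right];
            unfold Rabs; destruct Rcase_abs; lra.
    - right. unfold eta. field. repeat split; try lra. }
  rewrite Z in E. apply Aeq_of_sub. rewrite E. ring.
Qed.

(** Cauchy's formula at the poles [s] and [0] is subtracted and divided by [s]. The kernels satisfy
    [(Vs s - V) / s - V^2 = s (Vs s) V^2], so the error is of order [s], uniformly on the
    boundary. *)
Lemma derivative_formula U f rho k : open2 U -> 0 < rho ->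
  (forall x y, - rho <= x <= rho -> - rho <= y <= rho -> U x y) ->
  (forall x y, U x y -> cont2 f x y /\ exists k, hasder f x y k) ->
  hasder f 0 0 k ->
  mul (period rho) k ==
  rect_int (fun x y => mul (f x y) (mul (V x y) (V x y))) (- rho) rho (- rho) rho.
Proof.
  intros HU Hrho Hin Hf [Hk _].
  set (I := rect_int _ _ _ _ _).
  destruct Amul_bounded as (K & HK & Hmul). destruct rect_int_bound as (KJ & HKJ & HJ).
  destruct V_bound as (Ci & HCi & HV).
  assert (HcB : contB f (- rho) rho (- rho) rho) by (intros x y (Hx & Hy & _); apply Hf; auto).
  assert (HcV := contB_V rho Hrho).
  destruct (cont2_bounded f (- rho) rho (- rho) rho ltac:(lra) ltac:(lra)) as (M & HM & HfM).
  { intros x y Hx Hy. apply Hf; auto. }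
  (* For [s <= rho / 2] both poles keep distance [rho / 2] from the boundary. [B] bounds the product
     of [f] with three kernels, with one factor [K] for each multiplication. *)
  set (B0 := Ci / (rho / 2)). assert (HB0 : 0 < B0) by (apply Rdiv_lt_0_compat; lra).
  set (B := K * (M * (K * (B0 * (K * (B0 * B0)))))).
  assert (HB : 0 < B) by (unfold B; repeat (first [lra | apply Rmult_lt_0_compat])).
  assert (E0 : Vs 0 = V) by (extensionality x; extensionality y; unfold Vs; f_equal; ring).
  assert (Hmain : forall s, 0 < s <= rho / 2 ->
     nrm (Asub (mul (period rho) (Ascal (/ s) (Asub (f (0 + s) 0) (f 0 0)))) I) <=
     s * (KJ * (B * (4 * rho)))).
  { intros s Hs.
    assert (HcVs : contB (Vs s) (- rho) rho (- rho) rho)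
      by (intros x y Hb; apply cont2_Vs, (square_boundary rho); auto; lra).
    assert (I1 := rect_int_correct (fun x y => mul (f x y) (Vs s x y)) (- rho) rho (- rho) rho
      ltac:(lra) ltac:(lra) ltac:(intros x y Hb; apply cont2_Amul; [apply HcB|apply HcVs]; exact Hb)).
    assert (I2 := rect_int_correct (fun x y => mul (f x y) (V x y)) (- rho) rho (- rho) rho
      ltac:(lra) ltac:(lra) ltac:(intros x y Hb; apply cont2_Amul; [apply HcB|apply HcV]; exact Hb)).
    assert (I3 : is_rect_int (fun x y => mul (f x y) (mul (V x y) (V x y))) (- rho) rho (- rho) rho I).
    { apply rect_int_correct; [lra|lra|]. intros x y Hb.
      apply cont2_Amul; [apply HcB, Hb|apply cont2_Amul; apply HcV, Hb]. }
    assert (C1' := cauchy_formula U f rho s HU Hin Hf ltac:(lra)).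
    assert (C2' := cauchy_formula U f rho 0 HU Hin Hf ltac:(lra)).
    rewrite E0 in C2'.
    pose (F x y := Ascal s (mul (f x y) (mul (Vs s x y) (mul (V x y) (V x y))))).
    assert (HcF : contB F (- rho) rho (- rho) rho).
    { intros x y Hb. apply cont2_Ascal, cont2_Amul; [apply HcB, Hb|].
      apply cont2_Amul; [apply HcVs, Hb|apply cont2_Amul; apply HcV, Hb]. }
    assert (Hrr : - rho <= rho) by lra.
    assert (I4 := is_rect_int_Asub _ _ _ _ _ _ _ _ Hrr Hrr
      (is_rect_int_Amul (Ascal (/ s) one) _ _ _ _ _ _ Hrr Hrr
        (is_rect_int_Asub _ _ _ _ _ _ _ _ Hrr Hrr I1 I2)) I3).
    assert (I5 : is_rect_int F (- rho) rho (- rho) rho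
      (Asub (mul (period rho) (Ascal (/ s) (Asub (f (0 + s) 0) (f 0 0)))) I)).
    { rewrite Rplus_0_l.
      eapply is_rect_int_ext in I4; [|lra|lra|].
      - destruct I4 as (v1 & v2 & J1 & J2 & J3). exists v1, v2.
        split; [exact J1|]. split; [exact J2|]. rewrite <- J3, C1', C2'.
        rewrite (Ascal_mul (/ s) (Asub (f s 0) (f 0 0))). ring.
      - intros x y Hb. cbv beta.
        assert (H1 : x - s <> 0 \/ y <> 0).
        { destruct (square_boundary rho s x y ltac:(lra) Hb); [left; lra|right; assumption]. }
        assert (H2 : x <> 0 \/ y <> 0) by (apply (square_boundary rho 0 x y); [lra|exact Hb]).
        assert (Ediff : Asub (Vs s x y) (V x y) == Ascal s (mul (Vs s x y) (V x y))).
        { unfold Vs, V. rewrite (Ainv_sub _ _ (w_unit _ _ H1) (w_unit _ _ H2)).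
          rewrite w_sub. replace (x - (x - s)) with s by ring. replace (y - y) with 0 by ring.
          replace (w s 0) with (Ascal s one) by (unfold w, lin; generalize (mul e one); intros; avec).
          rewrite Amul_Ascal. f_equiv. ring. }
        assert (Eq : mul (Ascal (/ s) one) (Asub (mul (f x y) (Vs s x y)) (mul (f x y) (V x y))) ==
           mul (f x y) (mul (Vs s x y) (V x y))).
        { transitivity (mul (f x y) (mul (Ascal (/ s) one) (Asub (Vs s x y) (V x y)))); [ring|].
          rewrite Ediff, <- (Ascal_mul (/ s)).
          replace (Ascal (/ s) (Ascal s (mul (Vs s x y) (V x y)))) with (mul (Vs s x y) (V x y));
            [reflexivity|].
          generalize (mul (Vs s x y) (V x y)); intros.
          extensionality r. unfold Ascal. apply injective_projections;
            unfold RCmul, Cre, Cim; simpl; field; lra. }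
        rewrite Eq. unfold F.
        transitivity (mul (mul (f x y) (V x y)) (Asub (Vs s x y) (V x y))); [ring|].
        rewrite Ediff, Amul_Ascal. f_equiv. ring. }
    rewrite <- (rect_int_unique _ _ _ _ _ _ I5).
    replace (s * (KJ * (B * (4 * rho)))) with (KJ * (s * B * ((rho - - rho) + (rho - - rho)))) by ring.
    apply HJ; [lra|lra|exact HcF|].
    intros x y Hb. unfold F. rewrite Anorm_Ascal, Rabs_pos_eq by lra.
    apply Rmult_le_compat_l; [lra|].
    assert (Hx := Hb). destruct Hx as (Hx & Hy & _).
    assert (N1 : nrm (Vs s x y) <= B0).
    { apply Vs_bound; [lra|exact HV|].
      assert (Hfar := boundary_far rho s x y ltac:(lra) Hb). rewrite (Rabs_pos_eq s) in Hfar by lra. lra. }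
    assert (N2 : nrm (V x y) <= B0).
    { rewrite <- E0. apply Vs_bound; [lra|exact HV|].
      assert (Hfar := boundary_far rho 0 x y ltac:(lra) Hb). rewrite Rabs_R0 in Hfar. lra. }
    unfold B.
    repeat (eapply Rle_trans; [apply Hmul|]; apply Rmult_le_compat_l; [lra|];
      apply Rmult_le_compat; try apply Anorm_ge0; auto). }
  clearbody B. apply Aeq_of_sub, Anorm_small. intros eps He.
  rewrite Lim_locally'_iff in Hk.
  pose proof (Anorm_ge0 n (period rho)) as Hn0. set (N := nrm (period rho)) in *.
  assert (HKN : 0 < 2 * K * (N + 1)) by (repeat apply Rmult_lt_0_compat; lra).
  destruct (Hk (eps / (2 * K * (N + 1)))) as (de & Hde & Hq); [apply Rdiv_lt_0_compat; lra|].
  assert (HKB : 0 < 2 * (KJ * (B * (4 * rho)))) by (repeat apply Rmult_lt_0_compat; lra).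
  set (s := Rmin (de / 2) (Rmin (rho / 2) (eps / (2 * (KJ * (B * (4 * rho))))))).
  assert (Hs0 : 0 < s) by (repeat apply Rmin_glb_lt; try lra; apply Rdiv_lt_0_compat; lra).
  assert (S1 : s <= de / 2) by apply Rmin_l.
  assert (S2 : s <= rho / 2) by (eapply Rle_trans; [apply Rmin_r|apply Rmin_l]).
  assert (S3 : s <= eps / (2 * (KJ * (B * (4 * rho))))) by (eapply Rle_trans; [apply Rmin_r|apply Rmin_r]).
  specialize (Hq s ltac:(lra) ltac:(rewrite Rabs_pos_eq; lra)).
  specialize (Hmain s ltac:(lra)).
  set (q := Ascal (/ s) (Asub (f (0 + s) 0) (f 0 0))) in *.
  eapply Rle_trans; [apply (Anorm_sub_triang n _ (mul (period rho) q))|].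
  assert (T1 : nrm (Asub (mul (period rho) k) (mul (period rho) q)) <= eps / 2).
  { rewrite (Anorm_ext n _ (mul (period rho) (Asub k q))) by ring.
    rewrite Anorm_sub_sym in Hq.
    eapply Rle_trans; [apply Hmul|]. fold N.
    apply Rle_trans with (K * ((N + 1) * (eps / (2 * K * (N + 1))))).
    - apply Rmult_le_compat_l; [lra|]. apply Rmult_le_compat; try lra. apply Anorm_ge0.
    - right; field; lra. }
  assert (T2 : s * (KJ * (B * (4 * rho))) <= eps / 2).
  { apply (Rmult_le_compat_r (KJ * (B * (4 * rho)))) in S3; [|lra].
    eapply Rle_trans; [exact S3|]. right; field. repeat split; lra. }
  lra.
Qed.

(** * Monogenic functions *)

Lemma Lim_derivative_part (part : Cplx -> R) f G t r :
  (forall x z w, part (RCmul x (Cadd z (Copp w))) = x * (part z - part w)) ->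
  (forall z w, Rabs (part z - part w) <= Cmod (Cadd z (Copp w))) ->
  (1 <= r <= n)%nat ->
  Lim (locally' 0) (fun s => Ascal (/ s) (Asub (f (t + s)) (f t))) G ->
  is_derive (fun t => part (f t r)) t (part (G r)).
Proof.
  intros Hlin Hnorm Hr H. apply is_derive_Reals. intros eps He.
  rewrite Lim_locally'_iff in H. destruct (H eps He) as (de & Hde & Hl).
  exists (mkposreal de Hde). intros s Hs Hlt. simpl in Hlt.
  eapply Rle_lt_trans; [|apply (Hl s Hs Hlt)].
  eapply Rle_trans; [|apply (Cmod_le_Anorm n _ r Hr)].
  eapply Rle_trans; [|apply Hnorm]. unfold Ascal at 1, Asub at 1.
  rewrite Hlin. right. f_equal. field. exact Hs.
Qed.

(** The mean value theorem gives each real component its own intermediate point; comparing all of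
    them with the one value [v] costs the factor [2 * INR n]. *)
Lemma mean_value_bound f G v eps eta : 0 < eps ->
  (forall t, 0 <= t <= eps ->
     Lim (locally' 0) (fun s => Ascal (/ s) (Asub (f (t + s)) (f t))) (G t)) ->
  (forall t, 0 <= t <= eps -> nrm (Asub (G t) v) <= eta) ->
  nrm (Asub (Ascal (/ eps) (Asub (f eps) (f 0))) v) <= 2 * INR n * eta.
Proof.
  intros He Hder HG. apply Anorm_le_parts. intros r Hr.
  assert (Hpart : forall part : Cplx -> R,
    (forall x z w, part (RCmul x (Cadd z (Copp w))) = x * (part z - part w)) ->
    (forall z w, part (Cadd z (Copp w)) = part z - part w) ->
    (forall z, Rabs (part z) <= Cmod z) ->
    Rabs (part (Asub (Ascal (/ eps) (Asub (f eps) (f 0))) v r)) <= eta).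
  { intros part Hl Ha Hn.
    assert (Hn' : forall z w, Rabs (part z - part w) <= Cmod (Cadd z (Copp w)))
      by (intros; rewrite <- Ha; apply Hn).
    assert (Hd : forall t, 0 <= t <= eps -> is_derive (fun t => part (f t r)) t (part (G t r)))
      by (intros t Ht; apply Lim_derivative_part; auto).
    destruct (MVT_gen (fun t => part (f t r)) 0 eps (fun t => part (G t r))) as (c & Hc & E).
    - intros t Ht. rewrite Rmin_left, Rmax_right in Ht by lra. apply Hd; lra.
    - intros t Ht. rewrite Rmin_left, Rmax_right in Ht by lra.
      apply derivable_continuous_pt. exists (part (G t r)). apply is_derive_Reals, Hd, Ht.
    - rewrite Rmin_left, Rmax_right in Hc by lra.
      unfold Asub at 1. rewrite Ha. unfold Ascal, Asub. rewrite Hl, E.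
      replace (/ eps * (part (G c r) * (eps - 0)) - part (v r)) with (part (G c r) - part (v r))
        by (field; lra).
      eapply Rle_trans; [apply Hn'|].
      eapply Rle_trans; [apply (Cmod_le_Anorm n (Asub (G c) v) r Hr)|]. apply HG, Hc. }
  split; apply Hpart; try reflexivity; [apply Rabs_fst_le_Cmod|apply Rabs_snd_le_Cmod].
Qed.

(* The operator that recovers the derivative at the centre of a square from the values on
   its boundary. *)
Definition Tker (rho : R) (F : R -> R -> Alg) : Alg :=
  mul (Ainv (period rho))
    (rect_int (fun x y => mul (F x y) (mul (V x y) (V x y))) (- rho) rho (- rho) rho).

Lemma contB_kernel rho F : 0 < rho -> contB F (- rho) rho (- rho) rho ->
  contB (fun x y => mul (F x y) (mul (V x y) (V x y))) (- rho) rho (- rho) rho.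
Proof.
  intros Hr HF x y Hb. apply cont2_Amul; [apply HF, Hb|].
  apply cont2_Amul; apply (contB_V rho Hr), Hb.
Qed.

Lemma Tker_Asub rho F G : 0 < rho ->
  contB F (- rho) rho (- rho) rho -> contB G (- rho) rho (- rho) rho ->
  Tker rho (fun x y => Asub (F x y) (G x y)) == Asub (Tker rho F) (Tker rho G).
Proof.
  intros Hr HF HG. assert (Hrr : - rho <= rho) by lra. unfold Tker.
  rewrite (rect_int_unique (fun x y => mul (Asub (F x y) (G x y)) (mul (V x y) (V x y))) _ _ _ _
    (Asub (rect_int (fun x y => mul (F x y) (mul (V x y) (V x y))) (- rho) rho (- rho) rho)
          (rect_int (fun x y => mul (G x y) (mul (V x y) (V x y))) (- rho) rho (- rho) rho))).
  - ring.
  - eapply is_rect_int_ext; [exact Hrr|exact Hrr| |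
      exact (is_rect_int_Asub _ _ _ _ _ _ _ _ Hrr Hrr
        (rect_int_correct _ _ _ _ _ Hrr Hrr (contB_kernel rho F Hr HF))
        (rect_int_correct _ _ _ _ _ Hrr Hrr (contB_kernel rho G Hr HG)))].
    intros x y _. cbv beta. ring.
Qed.

Lemma Tker_Amul rho k F : 0 < rho -> contB F (- rho) rho (- rho) rho ->
  Tker rho (fun x y => mul k (F x y)) == mul k (Tker rho F).
Proof.
  intros Hr HF. assert (Hrr : - rho <= rho) by lra. unfold Tker.
  rewrite (rect_int_unique (fun x y => mul (mul k (F x y)) (mul (V x y) (V x y))) _ _ _ _
    (mul k (rect_int (fun x y => mul (F x y) (mul (V x y) (V x y))) (- rho) rho (- rho) rho))).
  - ring.
  - eapply is_rect_int_ext; [exact Hrr|exact Hrr| |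
      exact (is_rect_int_Amul k _ _ _ _ _ _ Hrr Hrr
        (rect_int_correct _ _ _ _ _ Hrr Hrr (contB_kernel rho F Hr HF)))].
    intros x y _. cbv beta. ring.
Qed.

(** Boundedness in the supremum norm over the boundary lets uniform convergence of functions there
    pass to the recovered derivatives. *)
Lemma Tker_bound rho : 0 < rho -> exists K, K > 0 /\ forall F eta,
  contB F (- rho) rho (- rho) rho ->
  (forall x y, on_boundary (- rho) rho (- rho) rho x y -> nrm (F x y) <= eta) ->
  nrm (Tker rho F) <= K * eta.
Proof.
  intro Hr. destruct Amul_bounded as (K & HK & Hmul).
  destruct rect_int_bound as (KJ & HKJ & HJ). destruct V_bound as (Ci & HCi & HV).
  set (B0 := Ci / rho). assert (HB0 : 0 < B0) by (apply Rdiv_lt_0_compat; lra).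
  pose proof (Anorm_ge0 n (Ainv (period rho))) as Hp. set (P := nrm (Ainv (period rho))) in *.
  exists (K * ((P + 1) * (KJ * (K * (K * (B0 * B0)) * (4 * rho))))).
  split; [repeat (first [lra | apply Rmult_lt_0_compat])|].
  intros F eta HF HFe. unfold Tker.
  assert (Heta : 0 <= eta).
  { eapply Rle_trans; [apply (Anorm_ge0 n (F rho 0))|apply HFe]. obd. }
  assert (E0 : Vs 0 = V) by (extensionality x; extensionality y; unfold Vs; f_equal; ring).
  assert (HB : nrm (rect_int (fun x y => mul (F x y) (mul (V x y) (V x y))) (- rho) rho (- rho) rho)
     <= KJ * (K * (eta * (K * (B0 * B0))) * ((rho - - rho) + (rho - - rho)))).
  { apply HJ; [lra|lra|apply contB_kernel; assumption|].
    intros x y Hb.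
    assert (N2 : nrm (V x y) <= B0).
    { rewrite <- E0. apply Vs_bound; [lra|exact HV|].
      assert (Hfar := boundary_far rho 0 x y ltac:(lra) Hb). rewrite Rabs_R0 in Hfar. lra. }
    repeat (eapply Rle_trans; [apply Hmul|]; apply Rmult_le_compat_l; [lra|];
      apply Rmult_le_compat; try apply Anorm_ge0; auto). }
  eapply Rle_trans; [apply Hmul|]. fold P.
  set (I := nrm (rect_int _ _ _ _ _)) in *. assert (0 <= I) by apply Anorm_ge0.
  replace (K * ((P + 1) * (KJ * (K * (K * (B0 * B0)) * (4 * rho)))) * eta) with
    (K * ((P + 1) * (KJ * (K * (eta * (K * (B0 * B0))) * ((rho - - rho) + (rho - - rho)))))) by ring.
  apply Rmult_le_compat_l; [lra|]. apply Rmult_le_compat; lra.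
Qed.

(** * Plane slices of a domain in E_k *)

Section Domain.

Variables (k : nat) (acoef : nat -> nat -> Cplx) (Om : Alg -> Prop).
Local Notation inE := (in_Ek m n k acoef).
Local Notation deriv := (is_gateaux_deriv m n k Ups u acoef Om).
Hypothesis Hk : (1 <= k)%nat.
Hypothesis HOm : open_in_Ek m n k acoef Om.
Hypothesis HeE : inE e.

Lemma inE_ext a b : a == b -> inE a -> inE b.
Proof. intros E (x & Hx). exists x. rewrite <- E. exact Hx. Qed.

Lemma inE_Aadd a b : inE a -> inE b -> inE (Aadd a b).
Proof.
  intros (x & Hx) (y & Hy). exists (fun j => x j + y j).
  rewrite Hx, Hy. intros r _. unfold Aadd, Ecomb. rewrite <- Csum_add.
  apply Csum_ext; intros j _. unfold Cadd, RCmul, Cre, Cim; simpl; f_equal; ring.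
Qed.

Lemma inE_Ascal c a : inE a -> inE (Ascal c a).
Proof.
  intros (x & Hx). exists (fun j => c * x j).
  rewrite Hx. intros r _. unfold Ascal, Ecomb.
  assert (HR : forall c z, RCmul c z = Cmul (c, 0) z).
  { intros c' z. unfold RCmul, Cmul, Cre, Cim; simpl; f_equal; ring. }
  rewrite HR, <- Csum_mul. apply Csum_ext; intros j _.
  unfold Cmul, RCmul, Cre, Cim; simpl; f_equal; ring.
Qed.

Lemma inE_one : inE one.
Proof.
  exists (fun j => if Nat.eqb j 1 then 1 else 0). intros r _. unfold Ecomb.
  rewrite (Csum_single k _ 1%nat); [|lia|].
  - simpl. unfold evec; simpl. unfold RCmul, Cre, Cim. rewrite !Rmult_1_l.
    apply surjective_pairing.
  - intros j Hj Hne. destruct (Nat.eqb_spec j 1); [lia|].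
    unfold RCmul, C0. f_equal; ring.
Qed.

Lemma inE_w x y : inE (w x y).
Proof.
  apply inE_Aadd; apply inE_Ascal; [apply inE_one|]. apply (inE_ext e); [ring|exact HeE].
Qed.

Lemma inE_Asub a b : inE a -> inE b -> inE (Asub a b).
Proof.
  intros Ha Hb. replace (Asub a b) with (Aadd a (Ascal (-1) b)) by avec.
  apply inE_Aadd; [exact Ha|apply inE_Ascal, Hb].
Qed.

(** The one-sided limit along [-h] is the left-hand limit along [h]; the values agree because
    [mul h (Phi' z)] is linear in [h]. *)
Lemma gateaux_two_sided Phi Phi' z h : deriv Phi Phi' -> Om z -> inE h ->
  Lim (locally' 0) (fun t => Ascal (/ t) (Asub (Phi (Aadd z (Ascal t h))) (Phi z))) (mul h (Phi' z)).
Proof.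
  intros Hd Hz Hh. rewrite Lim_locally'_iff. intros eps He.
  destruct (Hd z Hz h Hh eps He) as (d1 & Hd1 & H1).
  destruct (Hd z Hz (Ascal (-1) h) (inE_Ascal (-1) h Hh) eps He) as (d2 & Hd2 & H2).
  exists (Rmin d1 d2); split; [apply Rmin_glb_lt; lra|]. intros t Ht Hlt.
  pose proof (Rmin_l d1 d2) as L1; pose proof (Rmin_r d1 d2) as L2.
  destruct (Rlt_dec 0 t) as [Hp|Hn].
  - rewrite Rabs_pos_eq in Hlt by lra. apply H1. lra.
  - rewrite Rabs_left in Hlt by lra. destruct (H2 (- t) ltac:(lra)) as [_ H].
    replace (Ascal (- t) (Ascal (-1) h)) with (Ascal t h) in H by avec.
    rewrite (Anorm_ext n _ (Aopp (Asub (Ascal (/ t) (Asub (Phi (Aadd z (Ascal t h))) (Phi z)))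
      (mul h (Phi' z))))) in H.
    + rewrite Anorm_Aopp in H. exact H.
    + rewrite Amul_Ascal_l. generalize (mul h (Phi' z)), (Asub (Phi (Aadd z (Ascal t h))) (Phi z)).
      intros a b. rewrite Rinv_opp.
      match goal with |- ?a == ?b => replace b with a; [reflexivity|] end. avec.
Qed.

Lemma w_norm : exists M, M > 0 /\ forall x y, nrm (w x y) <= M * (Rabs x + Rabs y).
Proof.
  exists (nrm one + nrm (mul e one) + 1).
  pose proof (Anorm_ge0 n one); pose proof (Anorm_ge0 n (mul e one)).
  split; [lra|]. intros x y. unfold w, lin. eapply Rle_trans; [apply Anorm_Aadd|].
  rewrite !Anorm_Ascal. pose proof (Rabs_pos x); pose proof (Rabs_pos y).
  assert (0 <= Rabs x * nrm (mul e one)) by (apply Rmult_le_pos; lra).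
  assert (0 <= Rabs y * nrm one) by (apply Rmult_le_pos; lra). lra.
Qed.

(** The factor 2 leaves an open neighbourhood of the closed square of half-side [rho], as the
    integral formulas require. *)
Definition around (rho : R) (z : Alg) : Prop :=
  forall x y, Rabs x < 2 * rho -> Rabs y < 2 * rho -> Om (Aadd z (w x y)).

(** One [rho] for all points near [z], so that the same operator [Tker rho] represents the
    derivative at each of them. *)
Lemma local_radius z : Om z -> exists rho de, rho > 0 /\ de > 0 /\
  forall h, inE h -> nrm h < de -> Om (Aadd z h) /\ around rho (Aadd z h).
Proof.
  intro Hz. destruct HOm as [_ Hop]. destruct (Hop z Hz) as (r & Hr & Hball).
  destruct w_norm as (M & HM & Hw).
  exists (r / (8 * M)), (r / 2). split; [apply Rdiv_lt_0_compat; lra|]. split; [lra|].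
  intros h Hh Hlt. split; [apply Hball; [exact Hh|lra]|].
  intros x y Hx Hy.
  replace (Aadd (Aadd z h) (w x y)) with (Aadd z (Aadd h (w x y)))
    by (generalize (w x y); intros; avec).
  apply Hball; [apply inE_Aadd; [exact Hh|apply inE_w]|].
  eapply Rle_lt_trans; [apply Anorm_Aadd|].
  assert (nrm (w x y) <= r / 2).
  { eapply Rle_trans; [apply Hw|].
    apply Rle_trans with (M * (4 * (r / (8 * M)))); [apply Rmult_le_compat_l; lra|].
    right; field; lra. }
  lra.
Qed.

Lemma slice_cont2 Phi rho z : continuous_on n Om Phi -> around rho z ->
  forall x y, Rabs x < 2 * rho -> Rabs y < 2 * rho ->
  cont2 (fun x y => Phi (Aadd z (w x y))) x y.
Proof.
  intros Hc Har x y Hx Hy. rewrite cont2_iff. intros eps He.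
  destruct (Hc _ (Har x y Hx Hy) eps He) as (d1 & Hd1 & H1).
  assert (Hcw := cont2_lin one x y). rewrite cont2_iff in Hcw.
  destruct (Hcw d1 Hd1) as (d2 & Hd2 & H2).
  set (d3 := Rmin (2 * rho - Rabs x) (2 * rho - Rabs y)).
  assert (Hd3 : d3 > 0) by (apply Rmin_glb_lt; lra).
  exists (Rmin d2 (d3 / 2)); split; [apply Rmin_glb_lt; lra|].
  pose proof (Rmin_l d2 (d3 / 2)) as L1; pose proof (Rmin_r d2 (d3 / 2)) as L2.
  pose proof (Rmin_l (2 * rho - Rabs x) (2 * rho - Rabs y)) as L3.
  pose proof (Rmin_r (2 * rho - Rabs x) (2 * rho - Rabs y)) as L4. fold d3 in L3, L4.
  intros x' y' Hx' Hy'. apply H1.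
  - apply Har.
    + replace x' with ((x' - x) + x) by ring. eapply Rle_lt_trans; [apply Rabs_triang|lra].
    + replace y' with ((y' - y) + y) by ring. eapply Rle_lt_trans; [apply Rabs_triang|lra].
  - replace (Asub (Aadd z (w x' y')) (Aadd z (w x y))) with (Asub (w x' y') (w x y))
      by (generalize (w x' y'), (w x y); intros; avec).
    apply H2; lra.
Qed.

(** The directions [1] and [e] lie in [E_k] and share the factor [Phi'], which is exactly the
    Cauchy-Riemann condition on the slice. *)
Lemma slice_hasder Phi Phi' rho z : deriv Phi Phi' -> around rho z ->
  forall x y, Rabs x < 2 * rho -> Rabs y < 2 * rho ->
  hasder (fun x y => Phi (Aadd z (w x y))) x y (Phi' (Aadd z (w x y))).
Proof.
  intros Hd Har x y Hx Hy. assert (Hz := Har x y Hx Hy).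
  assert (E1 : forall t, Aadd z (w (x + t) y) = Aadd (Aadd z (w x y)) (Ascal t one)).
  { intro t. unfold w, lin. generalize (mul e one); intros. avec. }
  assert (E2 : forall t, Aadd z (w x (y + t)) = Aadd (Aadd z (w x y)) (Ascal t (mul e one))).
  { intro t. unfold w, lin. generalize (mul e one); intros. avec. }
  split.
  - assert (H := gateaux_two_sided Phi Phi' _ one Hd Hz inE_one). revert H.
    apply Lim_ext; [apply locally'_filter0| |ring].
    apply filter_forall. intro t. rewrite E1. reflexivity.
  - assert (Hin : inE (mul e one)) by (apply (inE_ext e); [ring|exact HeE]).
    assert (H := gateaux_two_sided Phi Phi' _ (mul e one) Hd Hz Hin). revert H.
    apply Lim_ext; [apply locally'_filter0| |ring].
    apply filter_forall. intro t. rewrite E2. reflexivity.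
Qed.

Lemma slice_contB Phi rho z : 0 < rho -> continuous_on n Om Phi -> around rho z ->
  contB (fun x y => Phi (Aadd z (w x y))) (- rho) rho (- rho) rho.
Proof.
  intros Hr Hc Har x y (Hx & Hy & _). apply (slice_cont2 Phi rho z Hc Har); apply Rabs_def1; lra.
Qed.

(** [derivative_formula] on the slice through [z], divided by the period. Afterwards [Phi'] is
    studied only through this operator. *)
Lemma derivative_Tker Phi Phi' rho z : 0 < rho -> continuous_on n Om Phi -> deriv Phi Phi' ->
  around rho z -> Phi' z == Tker rho (fun x y => Phi (Aadd z (w x y))).
Proof.
  intros Hr Hc Hd Har.
  assert (HU : open2 (fun x y => Rabs x < 2 * rho /\ Rabs y < 2 * rho)).
  { intros x y [Hx Hy].
    pose proof (Rmin_l (2 * rho - Rabs x) (2 * rho - Rabs y)) as L3.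
    pose proof (Rmin_r (2 * rho - Rabs x) (2 * rho - Rabs y)) as L4.
    assert (Hd3 : 0 < Rmin (2 * rho - Rabs x) (2 * rho - Rabs y)) by (apply Rmin_glb_lt; lra).
    exists (Rmin (2 * rho - Rabs x) (2 * rho - Rabs y) / 2); split; [lra|].
    intros x' y' Hx' Hy'. split.
    + replace x' with ((x' - x) + x) by ring. eapply Rle_lt_trans; [apply Rabs_triang|lra].
    + replace y' with ((y' - y) + y) by ring. eapply Rle_lt_trans; [apply Rabs_triang|lra]. }
  assert (H := derivative_formula (fun x y => Rabs x < 2 * rho /\ Rabs y < 2 * rho)
    (fun x y => Phi (Aadd z (w x y))) rho (Phi' (Aadd z (w 0 0))) HU Hr).
  assert (Ez : Aadd z (w 0 0) = z) by (unfold w, lin; generalize (mul e one); intros; avec).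
  rewrite Ez in H.
  unfold Tker. rewrite <- H; clear H.
  - transitivity (mul (mul (period rho) (Ainv (period rho))) (Phi' z)); [|ring].
    rewrite (Ainv_r _ (period_unit rho Hr)). ring.
  - intros x y Hx Hy; split; apply Rabs_def1; lra.
  - intros x y [Hx Hy]. split; [apply (slice_cont2 Phi rho z Hc Har x y Hx Hy)|].
    eexists. apply (slice_hasder Phi Phi' rho z Hd Har x y Hx Hy).
  - assert (H00 : Rabs 0 < 2 * rho) by (rewrite Rabs_R0; lra).
    assert (H0 := slice_hasder Phi Phi' rho z Hd Har 0 0 H00 H00).
    rewrite Ez in H0. exact H0.
Qed.

(** The comparison point [z'] ranges over [Om] and not only over the slice, because neighbours of
    [z] in [E_k] leave the plane. *)
Lemma slice_uniform Psi rho z eps : 0 < rho -> continuous_on n Om Psi -> around rho z -> eps > 0 ->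
  exists de, de > 0 /\ forall x y, - rho <= x <= rho -> - rho <= y <= rho ->
    forall z', Om z' -> nrm (Asub z' (Aadd z (w x y))) < de ->
      nrm (Asub (Psi z') (Psi (Aadd z (w x y)))) <= eps.
Proof.
  intros Hr Hc Har He.
  apply (uniform_on_rectangle (fun x y de => forall z', Om z' ->
    nrm (Asub z' (Aadd z (w x y))) < de ->
      nrm (Asub (Psi z') (Psi (Aadd z (w x y)))) <= eps) (- rho) rho (- rho) rho); try lra.
  - intros x y de de' Hde HQ z' Hz' Hlt. apply HQ; [exact Hz'|lra].
  - intros x y Hx Hy.
    assert (Hin : forall x y, - rho <= x <= rho -> - rho <= y <= rho -> Om (Aadd z (w x y)))
      by (intros; apply Har; apply Rabs_def1; lra).
    assert (He2 : eps / 2 > 0) by lra.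
    destruct (Hc _ (Hin x y Hx Hy) (eps / 2) He2) as (d1 & Hd1 & H1).
    assert (Hd12 : d1 / 2 > 0) by lra.
    assert (Hcw := cont2_lin one x y). rewrite cont2_iff in Hcw.
    destruct (Hcw (d1 / 2) Hd12) as (d2 & Hd2 & H2).
    exists (Rmin d2 (d1 / 2)); split; [apply Rmin_glb_lt; lra|].
    pose proof (Rmin_l d2 (d1 / 2)) as L1; pose proof (Rmin_r d2 (d1 / 2)) as L2.
    intros x' y' Hx' Hy' Hdx Hdy z' Hz' Hlt.
    specialize (H2 x' y' ltac:(lra) ltac:(lra)).
    assert (Ew : Asub (lin one x' y') (lin one x y) = Asub (Aadd z (w x' y')) (Aadd z (w x y)))
      by (unfold w; generalize (lin one x' y'), (lin one x y); intros; avec).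
    rewrite Ew in H2.
    assert (A1 : nrm (Asub (Psi z') (Psi (Aadd z (w x y)))) < eps / 2).
    { apply H1; [exact Hz'|]. eapply Rle_lt_trans; [apply (Anorm_sub_triang n _ (Aadd z (w x' y')))|lra]. }
    assert (A2 : nrm (Asub (Psi (Aadd z (w x' y'))) (Psi (Aadd z (w x y)))) < eps / 2).
    { apply H1; [apply Hin; assumption|lra]. }
    rewrite Anorm_sub_sym in A2.
    eapply Rle_trans; [apply (Anorm_sub_triang n _ (Psi (Aadd z (w x y))))|lra].
Qed.

(** [Phi' z' - Phi' z] is [Tker rho] of the difference of two slices, which is uniformly small on
    the boundary. *)
Lemma derivative_continuous Phi Phi' : continuous_on n Om Phi -> deriv Phi Phi' ->
  continuous_on n Om Phi'.
Proof.
  intros Hc Hd z Hz eps He.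
  destruct (local_radius z Hz) as (rho & d0 & Hr & Hd0 & Hloc).
  destruct (Tker_bound rho Hr) as (K & HK & HT).
  assert (Haz : around rho z).
  { destruct (Hloc (Ascal 0 one)) as [_ H].
    - apply inE_Ascal, inE_one.
    - rewrite Anorm_Ascal, Rabs_R0, Rmult_0_l. exact Hd0.
    - replace (Aadd z (Ascal 0 one)) with z in H by avec. exact H. }
  assert (Hq : eps / (2 * K) > 0) by (apply Rdiv_lt_0_compat; lra).
  destruct (slice_uniform Phi rho z _ Hr Hc Haz Hq) as (d1 & Hd1 & Hu).
  exists (Rmin d0 d1); split; [apply Rmin_glb_lt; lra|].
  pose proof (Rmin_l d0 d1) as L1; pose proof (Rmin_r d0 d1) as L2.
  intros z' Hz' Hlt.
  assert (Haz' : around rho z').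
  { destruct (Hloc (Asub z' z)) as [_ H].
    - apply inE_Asub; apply HOm; assumption.
    - lra.
    - replace (Aadd z (Asub z' z)) with z' in H by avec. exact H. }
  rewrite (derivative_Tker Phi Phi' rho z Hr Hc Hd Haz), (derivative_Tker Phi Phi' rho z' Hr Hc Hd Haz').
  assert (C1' := slice_contB Phi rho z Hr Hc Haz). assert (C2' := slice_contB Phi rho z' Hr Hc Haz').
  rewrite <- (Tker_Asub rho _ _ Hr C2' C1').
  apply Rle_lt_trans with (K * (eps / (2 * K))).
  - apply HT.
    + intros x y Hb. apply cont2_Asub; [apply C2', Hb|apply C1', Hb].
    + intros x y Hb. destruct Hb as (Hx & Hy & _). apply Hu; auto.
      * apply Haz'; apply Rabs_def1; lra.
      * replace (Asub (Aadd z' (w x y)) (Aadd z (w x y))) with (Asub z' z)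
          by (generalize (w x y); intros; avec). lra.
  - replace (K * (eps / (2 * K))) with (eps / 2) by (field; lra). lra.
Qed.

(** [Tker] commutes with difference quotients and with multiplication by [h]. On the boundary the
    quotients of [Phi] along [h] tend uniformly to [h Phi'], by the mean value bound and continuity
    of [Phi']. So [Tker] of the slice of [Phi'] is a derivative, and it does not depend on [h]. *)
Lemma derivative_differentiable Phi Phi' z : continuous_on n Om Phi -> deriv Phi Phi' -> Om z ->
  exists d, forall h, inE h -> forall eta, eta > 0 -> exists delta, delta > 0 /\
    forall eps, 0 < eps < delta -> Om (Aadd z (Ascal eps h)) /\
      nrm (Asub (Ascal (/ eps) (Asub (Phi' (Aadd z (Ascal eps h))) (Phi' z))) (mul h d)) < eta.
Proof.
  intros Hc Hd Hz. assert (Hc' := derivative_continuous Phi Phi' Hc Hd).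
  destruct (local_radius z Hz) as (rho & d0 & Hr & Hd0 & Hloc).
  destruct (Tker_bound rho Hr) as (K & HK & HT).
  destruct Amul_bounded as (KM & HKM & Hmul).
  assert (Haz : around rho z).
  { destruct (Hloc (Ascal 0 one)) as [_ H].
    - apply inE_Ascal, inE_one.
    - rewrite Anorm_Ascal, Rabs_R0, Rmult_0_l. exact Hd0.
    - replace (Aadd z (Ascal 0 one)) with z in H by avec. exact H. }
  exists (Tker rho (fun x y => Phi' (Aadd z (w x y)))).
  intros h Hh eta Heta.
  pose proof (Anorm_ge0 n h) as Hh0. set (H0 := nrm h) in *. pose proof (pos_INR n) as Hn0.
  (* [K] comes from [Tker], [2 * INR n] from the mean value bound, [KM * H0] from multiplying by
     [h]. The added ones keep [Q] positive, also for [h = 0]. *)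
  set (Q := K * (2 * (INR n + 1) * (KM * (H0 + 1)))).
  assert (HQ : 0 < Q) by (unfold Q; repeat (first [lra | apply Rmult_lt_0_compat])).
  assert (Heta' : eta / (2 * Q) > 0) by (apply Rdiv_lt_0_compat; lra).
  assert (EQ : Q * (eta / (2 * Q)) = eta / 2) by (field; lra).
  set (eta' := eta / (2 * Q)) in *. clearbody eta'.
  destruct (slice_uniform Phi' rho z eta' Hr Hc' Haz Heta') as (d1 & Hd1 & Hu).
  exists (Rmin d0 d1 / (H0 + 1)).
  assert (Hmin : 0 < Rmin d0 d1) by (apply Rmin_glb_lt; lra).
  pose proof (Rmin_l d0 d1) as L1; pose proof (Rmin_r d0 d1) as L2.
  split; [apply Rdiv_lt_0_compat; lra|]. intros eps Heps.
  assert (Hsmall : forall t, 0 <= t <= eps -> nrm (Ascal t h) < Rmin d0 d1).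
  { intros t Ht. rewrite Anorm_Ascal, Rabs_pos_eq by lra. fold H0.
    destruct Heps as [He0 He1]. apply (Rmult_lt_compat_r (H0 + 1)) in He1; [|lra].
    unfold Rdiv in He1. rewrite Rmult_assoc, Rinv_l, Rmult_1_r in He1 by lra.
    apply Rle_lt_trans with (eps * (H0 + 1)); [|exact He1]. apply Rmult_le_compat; lra. }
  assert (Hpt : forall t, 0 <= t <= eps ->
     Om (Aadd z (Ascal t h)) /\ around rho (Aadd z (Ascal t h))).
  { intros t Ht. apply Hloc; [apply inE_Ascal, Hh|]. specialize (Hsmall t Ht). lra. }
  destruct (Hpt eps ltac:(lra)) as [Hoe Hae]. split; [exact Hoe|].
  assert (B1 := slice_contB Phi rho _ Hr Hc Hae). assert (B2 := slice_contB Phi rho z Hr Hc Haz).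
  assert (B3 := slice_contB Phi' rho z Hr Hc' Haz).
  assert (E : Asub (Ascal (/ eps) (Asub (Phi' (Aadd z (Ascal eps h))) (Phi' z)))
      (mul h (Tker rho (fun x y => Phi' (Aadd z (w x y))))) ==
    Tker rho (fun x y => Asub (mul (Ascal (/ eps) one)
       (Asub (Phi (Aadd (Aadd z (Ascal eps h)) (w x y))) (Phi (Aadd z (w x y)))))
       (mul h (Phi' (Aadd z (w x y)))))).
  { rewrite (Tker_Asub rho), (Tker_Amul rho), (Tker_Amul rho h), (Tker_Asub rho); auto.
    - rewrite (Ascal_mul (/ eps) (Asub _ _)).
      rewrite (derivative_Tker Phi Phi' rho z Hr Hc Hd Haz), (derivative_Tker Phi Phi' rho _ Hr Hc Hd Hae).
      reflexivity.
    - intros x y Hb. apply cont2_Asub; [apply B1, Hb|apply B2, Hb].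
    - intros x y Hb. apply cont2_Amul; [apply cont2_const|].
      apply cont2_Asub; [apply B1, Hb|apply B2, Hb].
    - intros x y Hb. apply cont2_Amul; [apply cont2_const|apply B3, Hb]. }
  rewrite E.
  apply Rle_lt_trans with (K * (2 * INR n * (KM * (H0 * eta')))).
  - apply HT.
    + intros x y Hb. apply cont2_Asub; (apply cont2_Amul; [apply cont2_const|]);
        [apply cont2_Asub; [apply B1, Hb|apply B2, Hb]|apply B3, Hb].
    + intros x y (Hx & Hy & _).
      assert (Hin : forall t, 0 <= t <= eps -> Om (Aadd (Aadd z (w x y)) (Ascal t h))).
      { intros t Ht. replace (Aadd (Aadd z (w x y)) (Ascal t h)) with
          (Aadd (Aadd z (Ascal t h)) (w x y)) by (generalize (w x y); intros; avec).
        apply (Hpt t Ht); apply Rabs_def1; lra. }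
      rewrite <- (Ascal_mul (/ eps)).
      assert (Hmv := mean_value_bound (fun t => Phi (Aadd (Aadd z (w x y)) (Ascal t h)))
        (fun t => mul h (Phi' (Aadd (Aadd z (w x y)) (Ascal t h))))
        (mul h (Phi' (Aadd z (w x y)))) eps (KM * (H0 * eta')) ltac:(lra)).
      cbv beta in Hmv.
      replace (Aadd (Aadd z (w x y)) (Ascal 0 h)) with (Aadd z (w x y)) in Hmv
        by (generalize (w x y); intros; avec).
      replace (Aadd (Aadd z (Ascal eps h)) (w x y)) with (Aadd (Aadd z (w x y)) (Ascal eps h))
        by (generalize (w x y); intros; avec).
      apply Hmv; clear Hmv.
      * intros t Ht.
        assert (Hg := gateaux_two_sided Phi Phi' _ h Hd (Hin t Ht) Hh). revert Hg.
        apply Lim_ext; [apply locally'_filter0| |reflexivity].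
        apply filter_forall. intro s.
        assert (Es : forall s, Aadd (Aadd (Aadd z (w x y)) (Ascal t h)) (Ascal s h) =
          Aadd (Aadd z (w x y)) (Ascal (t + s) h)) by (intro; generalize (w x y); intros; avec).
        rewrite Es. reflexivity.
      * intros t Ht.
        rewrite (Anorm_ext n _ (mul h (Asub (Phi' (Aadd (Aadd z (w x y)) (Ascal t h)))
          (Phi' (Aadd z (w x y)))))) by ring.
        eapply Rle_trans; [apply Hmul|]. apply Rmult_le_compat_l; [lra|].
        apply Rmult_le_compat_l; [exact Hh0|]. apply Hu; auto.
        replace (Asub (Aadd (Aadd z (w x y)) (Ascal t h)) (Aadd z (w x y))) with (Ascal t h)
          by (generalize (w x y); intros; avec).
        specialize (Hsmall t Ht). lra.
  - apply Rle_lt_trans with (Q * eta').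
    + unfold Q. replace (K * (2 * (INR n + 1) * (KM * (H0 + 1))) * eta') with
        (K * (2 * (INR n + 1) * (KM * ((H0 + 1) * eta')))) by ring.
      apply Rmult_le_compat_l; [lra|]. apply Rmult_le_compat; try lra.
      * repeat apply Rmult_le_pos; lra.
      * apply Rmult_le_compat_l; [lra|]. apply Rmult_le_compat_r; lra.
    + rewrite EQ. lra.
Qed.

Lemma derivative_monogenic Phi Phi' : continuous_on n Om Phi -> deriv Phi Phi' ->
  monogenic m n k Ups u acoef Om Phi'.
Proof.
  intros Hc Hd. split; [exact (derivative_continuous Phi Phi' Hc Hd)|].
  assert (Hex : forall z, exists d, Om z -> forall h, inE h -> forall eta, eta > 0 ->
    exists delta, delta > 0 /\
    forall eps, 0 < eps < delta -> Om (Aadd z (Ascal eps h)) /\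
      nrm (Asub (Ascal (/ eps) (Asub (Phi' (Aadd z (Ascal eps h))) (Phi' z))) (mul h d)) < eta).
  (* The choice of a derivative ranges over all of [Alg]; off [Om] the value [Azero] is
     arbitrary. *)
  { intro z. destruct (classic (Om z)) as [Hz|Hz]; [|exists Azero; tauto].
    destruct (derivative_differentiable Phi Phi' z Hc Hd Hz) as (d & H). exists d; auto. }
  exists (fun z => proj1_sig (constructive_indefinite_description _ (Hex z))).
  intros z Hz. exact (proj2_sig (constructive_indefinite_description _ (Hex z)) Hz).
Qed.

End Domain.
End Plane.

(* Inductively perturb [h] by a small multiple of an element whose next character is [i]. *)
Lemma generic_direction k acoef :
  (forall p, (1 <= p <= m)%nat -> forall c : Cplx,
     exists h, in_Ek m n k acoef h /\ f_coord p h = c) ->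
  exists e, in_Ek m n k acoef e /\ forall p, (1 <= p <= m)%nat -> snd (e p) <> 0.
Proof.
  intro Hsurj.
  assert (HM : forall M, (M <= m)%nat ->
    exists e, in_Ek m n k acoef e /\ forall p, (1 <= p <= M)%nat -> snd (e p) <> 0).
  { induction M as [|M IH]; intro HM.
    - exists Azero. split; [|intros; lia].
      exists (fun _ => 0). intros r _. unfold Azero, Ecomb. symmetry. apply Csum_zero.
      intros j _. unfold RCmul, C0. f_equal; ring.
    - destruct (IH ltac:(lia)) as (e & He & Hep).
      destruct (Hsurj (S M) ltac:(lia) (0, 1)) as (h & Hh & Hhp). unfold f_coord in Hhp.
      (* Only a vanishing new imaginary part calls for a change: adding [t h] makes it [t], and a
         small [t] keeps the earlier ones nonzero. *)
      destruct (Req_dec (snd (e (S M))) 0) as [Hz|Hz].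
      + assert (Hsmall : forall N, (N <= M)%nat -> exists t0, t0 > 0 /\ forall t, 0 < t < t0 ->
           forall p, (1 <= p <= N)%nat -> snd (e p) + t * snd (h p) <> 0).
        { induction N as [|N IHN]; intro HN; [exists 1; split; [lra|intros; lia]|].
          destruct (IHN ltac:(lia)) as (t1 & Ht1 & H1).
          assert (Hn := Hep (S N) ltac:(lia)). apply Rabs_pos_lt in Hn.
          set (q := Rabs (snd (h (S N))) + 1).
          assert (Hq : q > 0) by (unfold q; pose proof (Rabs_pos (snd (h (S N)))); lra).
          exists (Rmin t1 (Rabs (snd (e (S N))) / q)).
          split; [apply Rmin_glb_lt; [lra|apply Rdiv_lt_0_compat; lra]|].
          intros t Ht p Hp.
          pose proof (Rmin_l t1 (Rabs (snd (e (S N))) / q)) as L1.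
          pose proof (Rmin_r t1 (Rabs (snd (e (S N))) / q)) as L2.
          destruct (Nat.eq_dec p (S N)) as [->|Hne]; [|apply H1; [lra|lia]].
          intro E. assert (Et : t * q < Rabs (snd (e (S N)))).
          { apply Rlt_le_trans with (Rabs (snd (e (S N))) / q * q); [apply Rmult_lt_compat_r; lra|].
            right; field; lra. }
          replace (snd (e (S N))) with (- (t * snd (h (S N)))) in Et by lra.
          rewrite Rabs_Ropp, Rabs_mult, (Rabs_pos_eq t) in Et by lra. unfold q in Et. nra. }
        destruct (Hsmall M (le_n M)) as (t0 & Ht0 & Ht).
        exists (Aadd e (Ascal (t0 / 2) h)). split.
        * apply inE_Aadd; [exact He|apply inE_Ascal, Hh].
        * intros p Hp. unfold Aadd, Ascal, Cadd, RCmul, Cim; simpl.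
          destruct (Nat.eq_dec p (S M)) as [->|Hne]; [|apply Ht; [lra|lia]].
          rewrite Hz, Hhp. simpl. lra.
      + exists e. split; [exact He|]. intros p Hp.
        destruct (Nat.eq_dec p (S M)) as [->|Hne]; [exact Hz|apply Hep; lia]. }
  exact (HM m (le_n m)).
Qed.

End Algebra.

Theorem theorem3 (m n k : nat) (Ups : nat -> nat -> nat -> Cplx) (u : nat -> nat)
  (acoef : nat -> nat -> Cplx)
  (Halg : is_algebra_Anm m n Ups u)
  (Hk : (2 <= k <= 2 * n)%nat)
  (Hind : lin_indep_R m n k acoef)
  (Hsurj : forall uu, (1 <= uu <= m)%nat -> forall w : Cplx,
             exists h, in_Ek m n k acoef h /\ f_coord uu h = w)
  (Om : Alg -> Prop) (HOm : domain_in_Ek m n k acoef Om)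
  (Phi : Alg -> Alg) (HPhi : monogenic m n k Ups u acoef Om Phi) :
  exists D : nat -> Alg -> Alg,
    D O = Phi /\
    forall r : nat,
      is_gateaux_deriv m n k Ups u acoef Om (D r) (D (S r)) /\
      monogenic m n k Ups u acoef Om (D (S r)).
Proof.
  destruct (generic_direction m n k acoef Hsurj) as (e & He & Him).
  (* The recursion runs on monogenic functions with their proofs, since the next derivative can be
     chosen only when monogenicity is at hand. *)
  assert (Hstep : forall P : {P | monogenic m n k Ups u acoef Om P},
    exists P' : {P | monogenic m n k Ups u acoef Om P},
      is_gateaux_deriv m n k Ups u acoef Om (proj1_sig P) (proj1_sig P')).
  { intros [P [Hc [P' HP']]].
    unshelve eexists (exist _ P' _); [|exact HP'].
    exact (derivative_monogenic m n Ups u Halg e Him k acoef Om ltac:(lia) (proj1 HOm) He P P' Hc HP'). }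
  pose (nxt P := proj1_sig (constructive_indefinite_description _ (Hstep P))).
  pose (D := fix D (r : nat) := match r with O => exist _ Phi HPhi | S r' => nxt (D r') end).
  exists (fun r => proj1_sig (D r)). split; [reflexivity|]. intro r. split.
  - exact (proj2_sig (constructive_indefinite_description _ (Hstep (D r)))).
  - exact (proj2_sig (D (S r))).
Qed.
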